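(* Let $\mathcal{N}_j$, $j\in\{1,\dots,n\}$, be non-degenerate clones-free LFNNs with the same input set $V_{in}$ and the same single output node, i.e. output set $\{v_{out}\}$. Suppose no two networks $\mathcal{N}_{j_1},\mathcal{N}_{j_2}$ with $j_1\neq j_2$ are extensionally isomorphic. Let $\sigma=C+\sum_{s\in S}c_s\tanh(\pi(\cdot-s))$ with $C\in\mathbb{R}$, $S\subset\mathbb{R}$ a discrete self-avoiding set, and $\{c_s\}_{s\in S}\in\ell^1(S)$ consisting of non-zero real numbers. Then $\{\mathcal{N}_j^\sigma\}_{j=1}^n\cup\{\mathbf{1}\}$ is a linearly independent set of functions from $\mathbb{R}^{V_{in}}$ to $\mathbb{R}$, where $\mathbf{1}$ is the constant function $1$.
   Context: A DAG is a pair $(V,E)$ with $V$ finite, $E\subset V\times V$, without directed cycles. $\mathrm{par}(v)=\{\tilde v:(\tilde v,v)\in E\}$; input nodes are those with empty parent set; the level is $\mathrm{lv}(v)=0$ for input nodes and otherwise $1+\max\{\mathrm{lv}(u):u\in\mathrm{par}(v)\}$. A general feed-forward neural network (GFNN) is $\mathcal{N}=(V,E,V_{in},V_{out},\Omega,\Theta)$ with $(V,E)$ a DAG, $V_{in}$ its set of input nodes, $V_{out}\subset V\setminus V_{in}$, weights $\Omega=\{\omega_{\tilde v v}\in\mathbb{R}\setminus\{0\}:(v,\tilde v)\in E\}$ and biases $\Theta=\{\theta_v\in\mathbb{R}:v\in V\setminus V_{in}\}$. An LFNN is a GFNN with $\mathrm{lv}(\tilde v)=\mathrm{lv}(v)+1$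 for every edge $(v,\tilde v)$. For $\rho:\mathbb{R}\to\mathbb{R}$, each node $v$ realizes $v^\rho:\mathbb{R}^{V_{in}}\to\mathbb{R}$: $v^\rho(\mathbf{t})=t_v$ for $v\in V_{in}$, otherwise $v^\rho(\mathbf{t})=\rho(\sum_{u\in\mathrm{par}(v)}\omega_{vu}u^\rho(\mathbf{t})+\theta_v)$; and $\mathcal{N}^\rho=(w^\rho)_{w\in V_{out}}$. Distinct nodes $v_1,v_2$ are clones if $\mathrm{par}(v_1)=\mathrm{par}(v_2)$, $\theta_{v_1}=\theta_{v_2}$ and $\omega_{v_1u}=\omega_{v_2u}$ for all $u\in\mathrm{par}(v_1)$; clones-free means no clones. $\mathcal{N}$ is non-degenerate if every node is in $V_{out}$ or has a directed path to some node of $V_{out}$. Two GFNNs $\mathcal{N}^1,\mathcal{N}^2$ with the same input set are extensionally isomorphic if there is a bijection $\pi:V^1\to V^2$ that is the identity on $V_{in}$, satisfies $\pi(V^1_{out})=V^2_{out}$, maps edges to edges ($(v,\tilde v)\in E^1$ iff $(\pi(v),\pi(\tilde v))\in E^2$) with $\omega^2_{\pi(\tilde v)\pi(v)}=\omega^1_{\tilde v v}$, and satisfies $\theta^2_{\pi(v)}=\theta^1_v$ for $v\notin V_{in}$. A discrete set $S\subset\mathbb{R}$ is self-avoiding if for every finite collection of pairwise distinct pairs $\{(\omega_j,\theta_j)\}_{j=1}^m\subset(2\mathbb{Z}+1)\times\mathbb{R}$ there are $j^*\in\{1,\dots,m\}$ and $t^*\in\frac{S-\theta_{j^*}}{\omega_{j^*}}\setminus\bigcup_{j\neq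 j^*}\frac{S-\theta_j}{\omega_j}$. *)

(* Defs.v *)
From HB Require Import structures.
From mathcomp Require Import all_boot all_order all_algebra finmap.
From mathcomp Require Import all_classical all_reals all_analysis.

Set Implicit Arguments.
Unset Strict Implicit.
Unset Printing Implicit Defensive.
Import Order.TTheory GRing.Theory Num.Theory.
Import numFieldNormedType.Exports.
Local Open Scope classical_set_scope.
Local Open Scope ring_scope.

(* Nodes are drawn from a fixed universe T of names, so that distinct networks
   can literally share their input nodes and their output node. The edge
   relation vanishes outside V; weights off the edges and biases off the
   non-input nodes are junk values. As in the usual convention, weight w v is
   the weight of the edge (v, w). *)
Record gfnn (R : realType) (T : choiceType) (Vin : {fset T}) := GFNN {
  nodes : {fset T} ;
  edge : rel T ;
  outputs : {fset T} ;
  weight : T -> T -> R ;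
  bias : T -> R ;
  edge_nodes : forall u v, edge u v -> (u \in nodes) && (v \in nodes) ;
  edge_acyclic : forall c : seq T, cycle edge c -> c = [::] ;
  inputsE : Vin = 
    [fset v in nodes | [fset u in nodes | edge u v] == fset0]%fset ;
  outputs_sub : (outputs `<=` nodes `\` Vin)%fset ;
  weight_neq0 : forall u v, edge u v -> weight v u != 0
}.

Section Network.
Variables (R : realType) (T : choiceType) (Vin : {fset T}).
Implicit Types N : gfnn R Vin.

Definition par N (v : T) : {fset T} :=
  [fset u in nodes N | edge N u v]%fset.

(* Recursion along the edges with fuel; #|` nodes N | steps suffice since N is
   acyclic, see dag_recE. *)
Fixpoint fuel_rec (A : Type) (a0 : A) (F : (T -> A) -> T -> A) (n : nat) : T -> A :=
  if n is m.+1 then F (fuel_rec a0 F m) else fun=> a0.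

Definition dag_rec N (A : Type) (a0 : A) (F : (T -> A) -> T -> A) : T -> A :=
  fuel_rec a0 F #|` nodes N |%fset.

Definition level_step N (lv : T -> nat) (v : T) : nat :=
  if par N v == fset0%fset then 0%N else (\max_(u <- par N v) lv u).+1.

Definition level N : T -> nat := dag_rec N 0%N (level_step N).

Definition is_lfnn N : Prop :=
  forall v w, edge N v w -> level N w = (level N v).+1.

Definition node_step N (rho : R -> R) (t : Vin -> R) (f : T -> R) (v : T) : R :=
  if insub v is Some i then t i
  else rho (\sum_(u <- par N v) weight N v u * f u + bias N v).

Definition node_map N (rho : R -> R) (v : T) (t : Vin -> R) : R :=
  dag_rec N 0 (node_step N rho t) v.

(* Biases exist at non-input nodes only, so only such nodes can be clones. *)
Definition clones N (v1 v2 : T) : Prop :=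
  [/\ [/\ v1 \in (nodes N `\` Vin)%fset, v2 \in (nodes N `\` Vin)%fset & v1 != v2],
      par N v1 = par N v2, bias N v1 = bias N v2 &
      forall u, u \in par N v1 -> weight N v1 u = weight N v2 u].

Definition clones_free N : Prop := forall v1 v2, ~ clones N v1 v2.

Definition non_degenerate N : Prop :=
  forall v, v \in nodes N ->
    v \in outputs N \/
    exists2 p : seq T, path (edge N) v p & last v p \in outputs N.

Definition ext_isomorphic N1 N2 : Prop :=
  exists pi : nodes N1 -> nodes N2,
    [/\ bijective pi,
        forall v, val v \in Vin -> val (pi v) = val v,
        [set val (pi v) | v in [set v | val v \in outputs N1]]
          = [set` outputs N2] &
        [/\ forall v w, edge N1 (val v) (val w) = edge N2 (val (pi v)) (val (pi w)),
            forall v w, edge N1 (val v) (val w) ->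
              weight N2 (val (pi w)) (val (pi v)) = weight N1 (val w) (val v) &
            forall v, val v \notin Vin -> bias N2 (val (pi v)) = bias N1 (val v)]].

Lemma back_path_uniq N v p : path (fun x y => edge N y x) v p -> uniq (v :: p).
Proof.
elim: p v => [//|u p IH] v pth; have [+ pth'] := andP pth => vu.
rewrite cons_uniq IH // andbT; apply/negP => /path.splitP eq.
case: eq pth {IH pth' vu} => p1 p2; rewrite cat_path => /andP[pth _].
have /(edge_acyclic (g := N)) : cycle (edge N) (rev (v :: p1)) by rewrite rev_cycle.
by rewrite rev_cons; case: (rev p1).
Qed.

Lemma back_path_nodes N v p :
  path (fun x y => edge N y x) v p -> {subset p <= nodes N}.
Proof.
elim: p v => [//|u p IH] v /= /andP[vu /IH sub] x.
by rewrite inE => /orP[/eqP->|/sub//]; have /andP[] := edge_nodes vu.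
Qed.

Lemma fuel_rec_stable N (A : Type) (a0 : A) F n v :
  (forall f g v, {in par N v, f =1 g} -> F f v = F g v) ->
  (forall p, path (fun x y => edge N y x) v p -> (size p < n)%N) ->
  fuel_rec a0 F n.+1 v = fuel_rec a0 F n v.
Proof.
move=> Fext; elim: n v => [v /(_ [::] isT)//|n IH v bnd].
apply: (Fext (fuel_rec a0 F n.+1) (fuel_rec a0 F n)) => u.
rewrite !inE => /andP[_ uv]; apply: IH => p pth.
by have := bnd (u :: p); rewrite /= uv pth => /(_ isT).
Qed.

Lemma dag_recE N (A : Type) (a0 : A) F v :
  (forall f g v, {in par N v, f =1 g} -> F f v = F g v) ->
  v \in nodes N -> dag_rec N a0 F v = F (dag_rec N a0 F) v.
Proof.
move=> Fext vN; rewrite {1}/dag_rec -(fuel_rec_stable (N := N)) // => p pth.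
have -> : (size p < #|` nodes N|%fset)%N = (size (v :: p) <= size (enum_fset (nodes N)))%N.
  by rewrite cardfE cardE.
apply: uniq_leq_size; first exact: back_path_uniq pth.
by move=> x; rewrite inE => /orP[/eqP->//|]; exact: back_path_nodes pth x.
Qed.

Lemma levelE N v : v \in nodes N ->
  level N v =
    if v \in Vin then 0%N else (\max_(u <- par N v) level N u).+1.
Proof.
move=> vN; rewrite /level dag_recE // => [|f g w fg]; last first.
  rewrite /level_step; case: ifP => // _; congr _.+1.
  by rewrite big_seq [RHS]big_seq; apply: eq_bigr => u /fg.
rewrite -/(level N) /level_step.
suff -> : (v \in Vin) = (par N v == fset0%fset) by [].
by rewrite [in LHS](inputsE N) in_fset /= inE vN.
Qed.

Lemma node_mapE N rho v t : v \in nodes N ->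
  node_map N rho v t =
    if insub v is Some i then t i
    else rho (\sum_(u <- par N v) weight N v u * node_map N rho u t + bias N v).
Proof.
move=> vN; rewrite /node_map dag_recE // => f g w fg.
rewrite /node_step; case: insub => //; congr (rho (_ + _)).
by rewrite big_seq [RHS]big_seq; apply: eq_bigr => u /fg ->.
Qed.

End Network.

Section Analysis.
Variable R : realType.

Definition tanh (x : R) : R := (expR x - expR (- x)) / (expR x + expR (- x)).

Definition discrete_set (S : set R) : Prop := S `<=` isolated S.

Definition self_avoiding (S : set R) : Prop :=
  forall (m : nat) (omega : 'I_m -> int) (theta : 'I_m -> R),
    (0 < m)%N ->
    (forall j, ~~ (2 %| omega j)%Z) ->
    injective (fun j => (omega j, theta j)) ->
    exists (j0 : 'I_m) (t : R),
      [set (s - theta j0) / (omega j0)%:~R | s in S] t /\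
      forall j, j != j0 -> ~ [set (s - theta j) / (omega j)%:~R | s in S] t.

(* The sum of an absolutely summable real family (\esum is only meant for
   nonnegative families). *)
Definition rsum (S : set R) (f : R -> R) : R :=
  fine (\esum_(s in S) (EFin \o f)^\+ s - \esum_(s in S) (EFin \o f)^\- s)%E.

Definition linearly_independent (X : Type) (I : finType) (f : I -> X -> R) : Prop :=
  forall a : I -> R,
    (forall x, \sum_i a i * f i x = 0) -> forall i, a i = 0.

End Analysis.

(* Main.v *)
Require Import Defs.
From HB Require Import structures.
From mathcomp Require Import all_boot all_order all_algebra finmap.
From mathcomp Require Import all_classical all_reals all_analysis.
From mathcomp Require Import complex ring lra zify.
Set Implicit Arguments.
Unset Strict Implicit.
Unset Printing Implicit Defensive.
Import Order.TTheory GRing.Theory Num.Theory.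
Import numFieldNormedType.Exports.
Local Open Scope classical_set_scope.
Local Open Scope ring_scope.

(** Restricting to a generic line through 0 in the input space and identifying
    the nodes of all the networks that compute the same expression, one gets a
    single layered system with pairwise distinct nodes in one real variable.
    Clones-freeness makes the identification injective inside each network,
    and two networks whose outputs are identified are extensionally isomorphic.
    It remains to show, by induction on the number of nodes, that the nodes of
    such a system and the constant 1 are linearly independent.

    The function sigma extends to an [i]-periodic function on C, analytic off
    closure S + i (Z + 1/2).  The set of directions along which a relation
    persists contains integer vectors approximating the given one
    (simultaneous Diophantine approximation, and analytic continuation over a
    connected natural domain), so the weights at the first layer may be taken
    to be integers, one of them odd.  On the line Im z = 1/2 self-avoidance
    yields an isolated pole of some inner function of the second layer; near it
    the inner functions are W_i / w + h_i(w) with h_i analytic.  Since sigma is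
    i-periodic, sending w to 0 along points where the W_i Im (1 / w) are almost
    integers and taking finite differences decouples x = Re (1 / w) from w, and
    for a generic fixed small real w the relation becomes one for a smaller
    system in the variable x. *)

(** Comparing singularities node by node fails beyond the second layer: at a pole of an inner
    function the singularities of the nodes that depend on it accumulate. This is why the pole is
    approached only where every W_i Im (1 / w) is almost an integer: up to periods the deeper layers
    then receive almost real inputs, on which they are bounded, Lipschitz and analytic. The variable
    x stays free there and becomes the input of a system with one layer less; nodes that do not feel
    the pole are constant in x and are absorbed into the biases. Integer weights matter because on
    the line Im z = 1/2 a neuron of even weight is back on the real axis up to a period, while one
    of odd weight meets its poles, and self-avoidance speaks of odd weights only. Discreteness of S
    is used twice: for the gaps that keep natural domains connected, and to isolate a pole.
    Relations carry coefficients on all nodes, not only on outputs, because the equality of two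
    inner functions is itself such a relation on fewer nodes; this keeps the nodes of the smaller
    system distinct for generic w. *)

Local Notation re := complex.Re.
Local Notation im := complex.Im.
Local Notation rc := (real_complex _).

(** * Complex numbers *)

Section Modulus.
Variable R : realType.
Local Notation C := R[i].
Implicit Types (z w : C) (x y r : R).

(** The norm carried by [R[i]] takes its values in [R[i]]; a modulus in [R] keeps all estimates
    within reach of arithmetic over [R]. *)
Definition cn z : R := ComplexField.Normc.normc z.

Lemma cnE z : cn z = Num.sqrt (re z ^+ 2 + im z ^+ 2).
Proof. by case: z. Qed.

Lemma cnD z w : cn (z + w) <= cn z + cn w.
Proof. exact: le_normcD. Qed.

Lemma cnM z w : cn (z * w) = cn z * cn w.
Proof. exact: ComplexField.Normc.normcM. Qed.

Lemma cnN z : cn (- z) = cn z.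
Proof. exact: normcN. Qed.

Lemma cnV z : cn z^-1 = (cn z)^-1.
Proof. exact: ComplexField.Normc.normcV. Qed.

Lemma cn0 : cn 0 = 0.
Proof. exact: ComplexField.Normc.normc0. Qed.

Lemma cn1 : cn 1 = 1.
Proof. exact: ComplexField.Normc.normc1. Qed.

Lemma cn_ge0 z : 0 <= cn z.
Proof. by rewrite cnE sqrtr_ge0. Qed.

Lemma cn_eq0 z : (cn z == 0) = (z == 0).
Proof.
by apply/eqP/eqP => [/ComplexField.Normc.eq0_normc//|->]; rewrite cn0.
Qed.

Lemma cn_gt0 z : (0 < cn z) = (z != 0).
Proof. by rewrite lt_def cn_ge0 andbT cn_eq0. Qed.

Lemma cnB z w : cn (z - w) <= cn z + cn w.
Proof. by rewrite -(cnN w) cnD. Qed.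

Lemma cn_distC z w : cn (z - w) = cn (w - z).
Proof. by rewrite -cnN opprB. Qed.

Lemma cnX z n : cn (z ^+ n) = cn z ^+ n.
Proof. by elim: n => [|n IH]; rewrite ?expr0 ?cn1 // !exprS cnM IH. Qed.

Lemma cn_real x : cn (rc x) = `|x|.
Proof. by rewrite cnE /= expr0n /= addr0 sqrtr_sqr. Qed.

Lemma cn_i : cn 'i%C = 1.
Proof. by rewrite cnE /= expr0n /= add0r expr1n sqrtr1. Qed.

Lemma cnMn z n : cn (z *+ n) = cn z *+ n.
Proof. exact: normcMn. Qed.

Lemma cn_nat n : cn n%:R = n%:R.
Proof. by rewrite cnMn cn1. Qed.

Lemma cn_le_sub z w : cn z - cn w <= cn (z - w).
Proof. by rewrite lerBlDr (le_trans _ (cnD _ _)) // subrK. Qed.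

Lemma cn_sum I (s : seq I) (P : pred I) (F : I -> C) :
  cn (\sum_(i <- s | P i) F i) <= \sum_(i <- s | P i) cn (F i).
Proof.
elim/big_ind2: _ => [|x1 x2 y1 y2 h1 h2|//]; first by rewrite cn0.
by rewrite (le_trans (cnD _ _)) // lerD.
Qed.

Lemma sum_cn_le (I : Type) (s : seq I) (P : pred I) (F : I -> C) (G : I -> R) :
  (forall i, P i -> cn (F i) <= G i) ->
  cn (\sum_(i <- s | P i) F i) <= \sum_(i <- s | P i) G i.
Proof. by move=> h; apply: le_trans (cn_sum _ _ _) (ler_sum _ _). Qed.

Lemma le_re_cn z : `|re z| <= cn z.
Proof.
by rewrite cnE -sqrtr_sqr ler_wsqrtr // lerDl sqr_ge0.
Qed.

Lemma le_im_cn z : `|im z| <= cn z.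
Proof.
by rewrite cnE -sqrtr_sqr ler_wsqrtr // lerDr sqr_ge0.
Qed.

Lemma cnP z : z = rc (re z) + 'i%C * rc (im z).
Proof. exact: complexE. Qed.

Lemma le_cn_reim z : cn z <= `|re z| + `|im z|.
Proof.
rewrite {1}[z]cnP (le_trans (cnD _ _)) // cnM cn_i mul1r !cn_real //.
Qed.

Lemma reD z w : re (z + w) = re z + re w. Proof. by case: z w => ? ? [? ?]. Qed.
Lemma imD z w : im (z + w) = im z + im w. Proof. by case: z w => ? ? [? ?]. Qed.
Lemma reN z : re (- z) = - re z. Proof. by case: z. Qed.
Lemma imN z : im (- z) = - im z. Proof. by case: z. Qed.
Lemma reM z w : re (z * w) = re z * re w - im z * im w. Proof. by case: z w => ? ? [? ?]. Qed.
Lemma imM z w : im (z * w) = re z * im w + im z * re w. Proof. by case: z w => ? ? [? ?]. Qed.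
Lemma re_rc x : re (rc x) = x. Proof. by []. Qed.
Lemma im_rc x : im (rc x) = 0. Proof. by []. Qed.
Lemma re_i : re ('i%C : C) = 0. Proof. by []. Qed.
Lemma im_i : im ('i%C : C) = 1. Proof. by []. Qed.
Lemma im_sum I (s : seq I) (P : pred I) (F : I -> C) :
  im (\sum_(i <- s | P i) F i) = \sum_(i <- s | P i) im (F i).
Proof. by elim/big_rec2: _ => // i x y _ <-; rewrite imD. Qed.
Lemma re0 : re (0 : C) = 0. Proof. by []. Qed.
Lemma im0 : im (0 : C) = 0. Proof. by []. Qed.
Lemma re1 : re (1 : C) = 1. Proof. by []. Qed.
Lemma im1 : im (1 : C) = 0. Proof. by []. Qed.
Definition reimE := (re0, im0, re1, im1, reD, imD, reN, imN, reM, imM, re_rc, im_rc, re_i, im_i).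

Lemma cplx_ext z w : re z = re w -> im z = im w -> z = w.
Proof. by case: z w => ? ? [? ?] /= -> ->. Qed.

Lemma ii : 'i%C * 'i%C = -1 :> C.
Proof. by rewrite -expr2 sqr_i. Qed.

Lemma rcD x y : rc (x + y) = rc x + rc y :> C. Proof. exact: rmorphD. Qed.
Lemma rcB x y : rc (x - y) = rc x - rc y :> C. Proof. exact: rmorphB. Qed.
Lemma rcN x : rc (- x) = - rc x :> C. Proof. exact: rmorphN. Qed.
Lemma rcM x y : rc (x * y) = rc x * rc y :> C. Proof. exact: rmorphM. Qed.
Lemma rcV x : rc x^-1 = (rc x)^-1 :> C. Proof. exact: fmorphV. Qed.
Lemma rc_eq0 x : (rc x == 0 :> C) = (x == 0). Proof. exact: fmorph_eq0. Qed.
Lemma rc_sum I (s : seq I) (P : pred I) (F : I -> R) :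
  rc (\sum_(i <- s | P i) F i) = \sum_(i <- s | P i) rc (F i) :> C.
Proof. exact: rmorph_sum. Qed.

Lemma cn_small0 z (K : R) : (forall e, 0 < e -> cn z <= K * e) -> z = 0.
Proof.
move=> h; apply/eqP; rewrite -cn_eq0; apply/eqP.
apply/le_anti; rewrite cn_ge0 andbT; apply/ler_addgt0Pr => e e0; rewrite add0r.
have [K0|K0] := leP K 0.
  by rewrite (le_trans (h 1 _)) // mulr1 (le_trans K0) // ltW.
by rewrite (le_trans (h (e / K) _)) ?divr_gt0 // mulrCA divff ?mulr1 // gt_eqF.
Qed.

End Modulus.

(** * Uniform limits of polynomials *)

(* [appr f z0 r]: f is a uniform limit of polynomials on the closed disc of
   centre z0 and radius r; this is the working form of analyticity. *)
Section Approx.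
Variable R : realType.
Local Notation C := R[i].
Implicit Types (z w : C) (r : R) (f g : C -> C).

Definition appr f z0 r := forall e, 0 < e -> exists P : {poly C},
  forall z, cn (z - z0) <= r -> cn (f z - P.[z]) <= e.

Definition holo f z0 := exists2 r, 0 < r & appr f z0 r.

Lemma poly_lip (P : {poly C}) z0 r : exists2 K, 0 <= K &
  forall z w, cn (z - z0) <= r -> cn (w - z0) <= r ->
  cn (P.[z] - P.[w]) <= K * cn (z - w).
Proof.
have [r0|r0] := ltP r 0.
  exists 0 => // z w h; have := cn_ge0 (z - z0); lra.
(* A bound [B] on the polynomial is carried along, since the Lipschitz constant of the next Horner
   step involves the size of [P]. *)
suff [K [B [K0 B0 h]]] : exists K B, [/\ 0 <= K, 0 <= B & forall z, cn (z - z0) <= r ->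
   cn P.[z] <= B /\ forall w, cn (w - z0) <= r -> cn (P.[z] - P.[w]) <= K * cn (z - w)].
  by exists K => // z w /h[_ +]; apply.
elim/poly_ind: P => [|P c [K [B [K0 B0 IH]]]].
  by exists 0, 0; split => // z _; split => [|w _]; rewrite !horner0 ?subrr cn0 ?mul0r.
exists (K * (cn z0 + r) + B), (B * (cn z0 + r) + cn c); split.
- by rewrite addr_ge0 // mulr_ge0 // addr_ge0 // cn_ge0.
- by rewrite addr_ge0 ?cn_ge0 // mulr_ge0 // addr_ge0 // cn_ge0.
have bd w : cn (w - z0) <= r -> cn w <= cn z0 + r.
  by move=> h; rewrite -(subrK z0 w) addrC (le_trans (cnD _ _)) // lerD2l.
move=> z zr; have [IH1 IH2] := IH _ zr; split=> [|w wr]; rewrite !hornerMXaddC.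
  by rewrite (le_trans (cnD _ _)) // lerD2r cnM ler_pM ?cn_ge0 ?bd.
have -> : P.[z] * z + c - (P.[w] * w + c) = (P.[z] - P.[w]) * z + P.[w] * (z - w) by ring.
rewrite (le_trans (cnD _ _)) // !cnM mulrDl lerD //.
  rewrite mulrAC ler_pM ?cn_ge0 ?bd //; exact: IH2.
by rewrite ler_wpM2r ?cn_ge0 //; have [] := IH _ wr.
Qed.

Lemma appr_le f z0 r z1 r1 : appr f z0 r -> r1 + cn (z1 - z0) <= r -> appr f z1 r1.
Proof.
move=> h le e /h[P hP]; exists P => z zr; apply: hP; apply: le_trans le.
by rewrite -(subrK z1 z) -addrA (le_trans (cnD _ _)) // lerD2r.
Qed.

Lemma appr_rad f z0 r r1 : appr f z0 r -> r1 <= r -> appr f z0 r1.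
Proof. by move=> h le; apply: appr_le h _; rewrite subrr cn0 addr0. Qed.

Lemma appr_ext f g z0 r : (forall z, cn (z - z0) <= r -> f z = g z) ->
  appr f z0 r -> appr g z0 r.
Proof. by move=> e h k /h[P hP]; exists P => z zr; rewrite -e ?hP. Qed.

Lemma appr_bound f z0 r : appr f z0 r ->
  exists2 B, 0 < B & forall z, cn (z - z0) <= r -> cn (f z) <= B.
Proof.
move=> /(_ 1 ltr01)[P hP]; have [K K0 hK] := poly_lip P z0 r.
exists (cn P.[z0] + K * `|r| + 2).
  have := cn_ge0 P.[z0]; have := mulr_ge0 K0 (normr_ge0 r); lra.
move=> z zr; have r0 : 0 <= r := le_trans (cn_ge0 _) zr.
have h1 := hP z zr.
have h2 : cn (P.[z] - P.[z0]) <= K * `|r|.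
  apply: le_trans (hK z z0 zr _) _; first by rewrite subrr cn0.
  by rewrite ler_wpM2l // ger0_norm.
have -> : f z = (f z - P.[z]) + ((P.[z] - P.[z0]) + P.[z0]) by ring.
have := cnD (f z - P.[z]) ((P.[z] - P.[z0]) + P.[z0]).
have := cnD (P.[z] - P.[z0]) P.[z0]; lra.
Qed.

Lemma appr_poly (P : {poly C}) z0 r : appr (fun z => P.[z]) z0 r.
Proof. by move=> e e0; exists P => z _; rewrite subrr cn0 ltW. Qed.

Lemma appr_cst c z0 r : appr (fun=> c) z0 r.
Proof. by apply: appr_ext (appr_poly c%:P z0 r) => z _; rewrite hornerC. Qed.

Lemma appr_id z0 r : appr id z0 r.
Proof. by apply: appr_ext (appr_poly 'X z0 r) => z _; rewrite hornerX. Qed.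

Lemma apprD f g z0 r : appr f z0 r -> appr g z0 r -> appr (fun z => f z + g z) z0 r.
Proof.
move=> hf hg e e0; have e2 : 0 < e / 2 by lra.
have [P hP] := hf _ e2; have [Q hQ] := hg _ e2; exists (P + Q) => z zr.
have -> : f z + g z - (P + Q).[z] = (f z - P.[z]) + (g z - Q.[z]) by rewrite hornerD; ring.
have := cnD (f z - P.[z]) (g z - Q.[z]); have := hP z zr; have := hQ z zr; lra.
Qed.

Lemma apprM f g z0 r : appr f z0 r -> appr g z0 r -> appr (fun z => f z * g z) z0 r.
Proof.
move=> hf hg e e0; have [Bf Bf0 hBf] := appr_bound hf; have [Bg Bg0 hBg] := appr_bound hg.
(* Chosen so that [d <= 1], which makes the product of the two errors at most [d], and so that [d]
   times [Bf + Bg + 1] stays below [e]. *)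
set d := e / (Bf + Bg + 1 + e).
have d0 : 0 < d by rewrite divr_gt0 //; lra.
have dK : d * (Bf + Bg + 1 + e) = e by rewrite divfK // gt_eqF //; lra.
have d1 : d <= 1.
  by rewrite ler_pdivrMr ?mul1r; lra.
have [P hP] := hf _ d0; have [Q hQ] := hg _ d0; exists (P * Q) => z zr.
have -> : f z * g z - (P * Q).[z] =
   (f z - P.[z]) * g z + f z * (g z - Q.[z]) - (f z - P.[z]) * (g z - Q.[z]).
  by rewrite hornerM; ring.
have h1 : cn ((f z - P.[z]) * g z) <= d * Bg by rewrite cnM ler_pM ?cn_ge0 ?hP ?hBg.
have h2 : cn (f z * (g z - Q.[z])) <= Bf * d by rewrite cnM ler_pM ?cn_ge0 ?hQ ?hBf.
have h3 : cn ((f z - P.[z]) * (g z - Q.[z])) <= d * 1.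
  by rewrite cnM ler_pM ?cn_ge0 ?hP // (le_trans (hQ z zr)).
apply: le_trans (cnB _ _) _; apply: le_trans (lerD (cnD _ _) (lexx _)) _.
have : d * Bg + Bf * d + d * 1 + d * e = e by rewrite -[RHS]dK; ring.
have := mulr_gt0 d0 e0; lra.
Qed.

Lemma apprZ c f z0 r : appr f z0 r -> appr (fun z => c * f z) z0 r.
Proof. exact: apprM (appr_cst _ _ _). Qed.

Lemma apprN f z0 r : appr f z0 r -> appr (fun z => - f z) z0 r.
Proof. by move=> /(apprZ (-1)) h; apply: appr_ext h => z _; rewrite mulN1r. Qed.

Lemma apprB f g z0 r : appr f z0 r -> appr g z0 r -> appr (fun z => f z - g z) z0 r.
Proof. by move=> hf /apprN; apply: apprD. Qed.

Lemma apprX f z0 r n : appr f z0 r -> appr (fun z => f z ^+ n) z0 r.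
Proof.
move=> h; elim: n => [|n IH]; first by apply: appr_ext (appr_cst 1 _ _) => z _; rewrite expr0.
by apply: appr_ext (apprM h IH) => z _; rewrite exprS.
Qed.

Lemma appr_sum I (s : seq I) (P : pred I) (F : I -> C -> C) z0 r :
  (forall i, P i -> appr (F i) z0 r) -> appr (fun z => \sum_(i <- s | P i) F i z) z0 r.
Proof.
move=> h; elim: s => [|i s IH].
  by apply: appr_ext (appr_cst 0 _ _) => z _; rewrite big_nil.
case Pi: (P i); last by apply: appr_ext IH => z _; rewrite big_cons Pi.
by apply: appr_ext (apprD (h i Pi) IH) => z _; rewrite big_cons Pi.
Qed.

Lemma appr_comp_poly (Q : {poly C}) f z0 r : appr f z0 r -> appr (fun z => Q.[f z]) z0 r.
Proof.
move=> h; elim/poly_ind: Q => [|Q c IH].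
  by apply: appr_ext (appr_cst 0 _ _) => z _; rewrite horner0.
apply: appr_ext (apprD (apprM IH h) (appr_cst c _ _)) => z _; by rewrite hornerMXaddC.
Qed.

Lemma appr_unif f z0 r :
  (forall e, 0 < e -> exists2 g, appr g z0 r &
     forall z, cn (z - z0) <= r -> cn (f z - g z) <= e) -> appr f z0 r.
Proof.
move=> h e e0; have e2 : 0 < e / 2 by lra.
have [g hg hfg] := h _ e2; have [P hP] := hg _ e2; exists P => z zr.
have -> : f z - P.[z] = (f z - g z) + (g z - P.[z]) by ring.
have := cnD (f z - g z) (g z - P.[z]); have := hfg z zr; have := hP z zr; lra.
Qed.

(** Only the outer function has to be replaced by a polynomial: polynomial expressions in [f] are
    already covered. *)
Lemma appr_comp g f z0 r w0 rho : appr f z0 r -> appr g w0 rho ->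
  (forall z, cn (z - z0) <= r -> cn (f z - w0) <= rho) -> appr (fun z => g (f z)) z0 r.
Proof.
move=> hf hg inc; apply: appr_unif => e /hg[Q hQ].
by exists (fun z => Q.[f z]) => [|z zr]; [exact: appr_comp_poly|apply: hQ; exact: inc].
Qed.

Lemma appr_cont f z0 r : 0 < r -> appr f z0 r -> forall e, 0 < e ->
  exists2 d, 0 < d & d <= r /\ forall z, cn (z - z0) <= d -> cn (f z - f z0) <= e.
Proof.
move=> r0 hf e e0; have e3 : 0 < e / 3 by lra.
have [P hP] := hf _ e3; have [K K0 hK] := poly_lip P z0 r.
exists (Num.min r (e / 3 / (K + 1))).
  by rewrite lt_min r0 divr_gt0 //; lra.
split=> [|z]; first by rewrite ge_min lexx.
rewrite le_min => /andP[zr zd].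
have z0r : cn (z0 - z0) <= r by rewrite subrr cn0 ltW.
have -> : f z - f z0 = (f z - P.[z]) + (P.[z] - P.[z0]) - (f z0 - P.[z0]) by ring.
have h1 := hP z zr; have h2 := hP z0 z0r; have h3 := hK z z0 zr z0r.
have h4 : K * cn (z - z0) <= e / 3.
  apply: le_trans (_ : (K + 1) * cn (z - z0) <= _).
    by rewrite mulrDl lerDl mul1r cn_ge0.
  by rewrite mulrC -ler_pdivlMr //; lra.
apply: le_trans (cnB _ _) _; apply: le_trans (lerD (cnD _ _) (lexx _)) _; lra.
Qed.

Lemma holo_cont f z0 : holo f z0 -> forall e, 0 < e ->
  exists2 d, 0 < d & forall z, cn (z - z0) <= d -> cn (f z - f z0) <= e.
Proof. by move=> [r r0 /(appr_cont r0) h] e /h[d d0 [_ hd]]; exists d. Qed.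

Lemma holo_ext f g z0 : (exists2 d, 0 < d & forall z, cn (z - z0) < d -> f z = g z) ->
  holo f z0 -> holo g z0.
Proof.
move=> [d d0 e] [r r0 hf]; have m0 : 0 < Num.min r (d / 2) by rewrite lt_min r0; lra.
exists (Num.min r (d / 2)) => //; apply: appr_ext (appr_rad hf _); last by rewrite ge_min lexx.
by move=> z; rewrite le_min => /andP[_ zd]; apply: e; lra.
Qed.

Lemma holo2 f g k z0 : (forall r, appr f z0 r -> appr g z0 r -> appr k z0 r) ->
  holo f z0 -> holo g z0 -> holo k z0.
Proof.
move=> h [r r0 hf] [s s0 hg]; exists (Num.min r s); first by rewrite lt_min r0.
by apply: h; [apply: appr_rad hf _|apply: appr_rad hg _]; rewrite ge_min lexx ?orbT.
Qed.

Lemma holoD f g z0 : holo f z0 -> holo g z0 -> holo (fun z => f z + g z) z0.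
Proof. by apply: holo2 => r; apply: apprD. Qed.
Lemma holoB f g z0 : holo f z0 -> holo g z0 -> holo (fun z => f z - g z) z0.
Proof. by apply: holo2 => r; apply: apprB. Qed.
Lemma holoM f g z0 : holo f z0 -> holo g z0 -> holo (fun z => f z * g z) z0.
Proof. by apply: holo2 => r; apply: apprM. Qed.
Lemma holo_cst c z0 : holo (fun=> c) z0.
Proof. by exists 1 => //; apply: appr_cst. Qed.
Lemma holo_id z0 : holo id z0.
Proof. by exists 1 => //; apply: appr_id. Qed.
Lemma holoZ c f z0 : holo f z0 -> holo (fun z => c * f z) z0.
Proof. exact: holoM (holo_cst _ _). Qed.
Lemma holo_sum I (s : seq I) (P : pred I) (F : I -> C -> C) z0 :
  (forall i, P i -> holo (F i) z0) -> holo (fun z => \sum_(i <- s | P i) F i z) z0.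
Proof.
move=> h; elim: s => [|i s IH].
  by apply: holo_ext (holo_cst 0 _); exists 1 => // z _; rewrite big_nil.
case Pi: (P i); last by apply: holo_ext IH; exists 1 => // z _; rewrite big_cons Pi.
by apply: holo_ext (holoD (h i Pi) IH); exists 1 => // z _; rewrite big_cons Pi.
Qed.

Lemma holo_comp g f z0 : holo f z0 -> holo g (f z0) -> holo (fun z => g (f z)) z0.
Proof.
move=> [r r0 hf] [rho rho0 hg]; have [d d0 [dr hd]] := appr_cont r0 hf rho0.
by exists d => //; apply: appr_comp hg hd; apply: appr_rad hf dr.
Qed.

Lemma half_pow_small (K e : R) : 0 < e -> exists n, K * 2^-1 ^+ n <= e.
Proof.
move=> e0; have h : `|2^-1 : R| < 1 by rewrite ger0_norm; lra.
have K0 : 0 < `|K| + 1 by have := normr_ge0 K; lra.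
have /cvgrPdist_le/(_ (e / (`|K| + 1))) := cvg_expr h.
case=> [|n _ hn]; first by rewrite divr_gt0.
exists n; have := hn n (leqnn _); rewrite /= sub0r normrN ger0_norm ?exprn_ge0 ?invr_ge0 //.
rewrite ler_pdivlMr // mulrC => /(le_trans _); apply.
by rewrite ler_wpM2r ?exprn_ge0 ?invr_ge0 // (le_trans (ler_norm _)) // lerDl.
Qed.

(** Geometric series of ratio [1 - a^-1 * z], whose modulus is at most 1/2 on this disc. *)
Lemma appr_inv a : a != 0 -> appr (fun z => z^-1) a (cn a / 2).
Proof.
move=> a0; have ca : 0 < cn a by rewrite cn_gt0.
apply: appr_unif => e e0.
have [n hn] := half_pow_small (2 / cn a) e0.
exists (fun z => a^-1 * \sum_(i < n) (1 - a^-1 * z) ^+ i).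
  apply: apprZ; apply: appr_sum => i _; apply: apprX.
  by apply: apprB; [exact: appr_cst|apply: apprZ; exact: appr_id].
move=> z za; set q := 1 - a^-1 * z.
have qE : q = a^-1 * (a - z) by rewrite mulrBr mulVf.
have cq : cn q <= 2^-1.
  rewrite qE cnM cnV cn_distC mulrC ler_pdivrMr //; lra.
have cz : cn a / 2 <= cn z.
  have -> : z = a - (a - z) by ring.
  have := cn_le_sub a (a - z); rewrite (cn_distC a z); lra.
have z0 : z != 0 by rewrite -cn_gt0; lra.
have -> : z^-1 - a^-1 * \sum_(i < n) q ^+ i = z^-1 * q ^+ n.
  have e1 : z = a * (1 - q) by rewrite qE mulrBr mulr1 mulVKf //; ring.
  have h1 := subrX1 q n.
  have : (1 - q) * \sum_(i < n) q ^+ i = 1 - q ^+ n.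
    by rewrite -opprB mulNr -h1 opprB.
  move=> h2; apply: (mulfI z0); rewrite mulrBr mulfV // [z in z * (a^-1 * _)]e1 mulVKf //.
  rewrite mulrACA mulfV // mul1r h2; ring.
rewrite cnM cnV cnX; apply: le_trans hn; apply: ler_pM.
- by rewrite invr_ge0 cn_ge0.
- by rewrite exprn_ge0 // cn_ge0.
- by rewrite -[2 / _]invf_div lef_pV2 // posrE; lra.
- by rewrite lerXn2r // nnegrE ?cn_ge0 //; lra.
Qed.

End Approx.

(** * Taylor expansions and isolated zeros *)

Section Taylor.
Variable R : realType.
Local Notation C := R[i].
Implicit Types (z w : C) (r : R) (f g : C -> C).

Lemma le_half_pow (x y K : R) : (forall k, x <= y + K * 2^-1 ^+ k) -> x <= y.
Proof.
move=> h; apply/ler_addgt0Pr => e /(half_pow_small K)[n hn].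
by apply: le_trans (h n) _; rewrite lerD2l.
Qed.

(** The limit is the supremum of the lower ends of the intervals of centre [u k] and radius
    [K * 2^-1 ^+ k]; each upper end bounds all of these. *)
Lemma half_cauchy (u : nat -> R) (K : R) :
  (forall k l, `|u k - u l| <= K * (2^-1 ^+ k + 2^-1 ^+ l)) ->
  exists a, forall k, `|u k - a| <= K * 2^-1 ^+ k.
Proof.
move=> h; pose A := [set x | exists k, x = u k - K * 2^-1 ^+ k].
have ub l : ubound A (u l + K * 2^-1 ^+ l).
  move=> _ [k ->]; have := h k l; rewrite ler_norml => /andP[_]; lra.
have hs : has_sup A by split; [exists (u 0 - K * 2^-1 ^+ 0), 0%N|exists (u 0 + K * 2^-1 ^+ 0)].
exists (sup A) => k; rewrite ler_norml; apply/andP; split.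
  by have := ge_sup hs.1 (@ub k); lra.
have : u k - K * 2^-1 ^+ k <= sup A by apply: ub_le_sup hs.2 _ _; exists k.
lra.
Qed.

Lemma half_cauchyC (u : nat -> C) (K : R) :
  (forall k l, cn (u k - u l) <= K * (2^-1 ^+ k + 2^-1 ^+ l)) ->
  exists a, forall k, cn (u k - a) <= 2 * K * 2^-1 ^+ k.
Proof.
move=> h.
have [a ha] : exists a, forall k, `|re (u k) - a| <= K * 2^-1 ^+ k.
  apply: half_cauchy => k l; apply: le_trans (h k l).
  by have := le_re_cn (u k - u l); rewrite !reimE.
have [b hb] : exists a, forall k, `|im (u k) - a| <= K * 2^-1 ^+ k.
  apply: half_cauchy => k l; apply: le_trans (h k l).
  by have := le_im_cn (u k - u l); rewrite !reimE.
exists (Complex a b) => k; apply: le_trans (le_cn_reim _) _.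
rewrite !reimE /=; have := ha k; have := hb k; lra.
Qed.

(** Iterated square roots of -1 give an element whose 2^k-th power is -1; its order divides 2^(k+1)
    but not 2^k. Orders that are powers of two suffice for averaging over circles. *)
Lemma root_of_unity2 k : exists z : C, (2 ^ k.+1).-primitive_root z.
Proof.
have [z hz] : exists z : C, z ^+ (2 ^ k) = -1.
  elim: k => [|k [z hz]]; first by exists (-1); rewrite expr1.
  by exists (sqrtc z); rewrite expnS exprM sqr_sqrtc.
exists z; have [||m pm md] := @prim_order_exists _ (2 ^ k.+1) z; first by rewrite expn_gt0.
  by rewrite expnS mulnC exprM hz sqrrN expr1n.
have /(dvdn_pfactor _ _ (isT : prime 2))[j jk mE] := md.
suff <- : m = (2 ^ k.+1)%N by [].
rewrite mE; congr (2 ^ _)%N; apply/eqP; rewrite eqn_leq jk leqNgt ltnS; apply/negP => jk'.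
have : z ^+ (2 ^ k) = 1.
  by apply/eqP; rewrite -(prim_order_dvd pm) mE dvdn_exp2l.
rewrite hz => /eqP; rewrite -subr_eq0 -opprD oppr_eq0.
by rewrite -(natrD _ 1 1) pnatr_eq0.
Qed.

Lemma prim_cn1 n z : n.-primitive_root z -> cn z = 1.
Proof.
move=> pz; have n0 := prim_order_gt0 pz.
have := congr1 (@cn R) (prim_expr_order pz); rewrite cnX cn1 => /eqP.
by rewrite -[X in _ == X](expr1n _ n) eqrXn2 ?cn_ge0 // => /eqP.
Qed.

(* Averaging P over a circle against a character of Z/2^k extracts a coefficient. *)
Lemma cauchy_poly (P : {poly C}) r B : 0 < r ->
  (forall z, cn z <= r -> cn P.[z] <= B) -> forall n, cn P`_n * r ^+ n <= B.
Proof.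
move=> r0 hB n; have B0 : 0 <= B by apply: le_trans (cn_ge0 _) (hB 0 _); rewrite cn0 ltW.
have [sn|ns] := leqP (size P) n; first by rewrite nth_default // cn0 mul0r.
set m := size P; have [z pz] := root_of_unity2 m; set N := (2 ^ m.+1)%N in pz.
have mN : (m < N)%N by rewrite (leq_trans (ltnSn m)) // ltnW // ltn_expl.
have cz := prim_cn1 pz.
have key : \sum_(l < N) P.[rc r * z ^+ l] * z ^+ (l * (N - n)) = N%:R * (P`_n * rc r ^+ n).
  transitivity (\sum_(l < N) \sum_(j < m) P`_j * rc r ^+ j * (z ^+ (j + (N - n))) ^+ l).
    apply: eq_bigr => l _; rewrite horner_coef mulr_suml; apply: eq_bigr => j _.
    rewrite exprMn -!exprM -!mulrA; congr (_ * (_ * _)); rewrite -exprD mulnDl.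
    by rewrite [(l * j)%N]mulnC [(l * (N - n))%N]mulnC.
  rewrite exchange_big /= (bigD1 (Ordinal ns)) //= [X in _ + X]big1 ?addr0 => [|j jn].
    rewrite subnKC ?(leq_trans (ltnW ns)) ?(ltnW mN) // (prim_expr_order pz).
    rewrite (eq_bigr (fun=> P`_n * rc r ^+ n)) => [|l _]; last by rewrite expr1n mulr1.
    by rewrite sumr_const card_ord mulr_natl.
  rewrite -mulr_sumr; set q := z ^+ _.
  (* For [j] and [n] below [N], the exponent [j + (N - n)] lies strictly between 0 and 2N, so [N]
     divides it only if [j = n]. *)
  have q1 : q != 1.
    rewrite /q -(prim_order_dvd pz); apply/negP => /dvdnP[t ht].
    have jm : (j < N)%N := ltn_trans (ltn_ord j) mN.
    have nN : (n < N)%N := ltn_trans ns mN.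
    have t1 : t = 1%N.
      have t0 : (0 < t)%N.
        rewrite lt0n; apply/eqP => tz; move: ht; rewrite tz mul0n => /eqP.
        by rewrite addn_eq0 subn_eq0 leqNgt nN andbF.
      apply/eqP; rewrite eqn_leq t0 andbT -ltnS.
      rewrite -(ltn_pmul2r (leq_trans (ltn0Sn _) mN)) -ht mul2n -addnn.
      by rewrite -addSn leq_add // leq_subr.
    move/eqP: jn; apply; apply: val_inj => /=.
    move: ht; rewrite t1 mul1n => /(congr1 (addn^~ n)); rewrite -addnA subnK ?(ltnW nN) //.
    by rewrite [in RHS]addnC => /addIn.
  have /eqP : (q - 1) * (\sum_(l < N) q ^+ l) = 0.
    by rewrite -subrX1 /q -exprM mulnC exprM (prim_expr_order pz) expr1n subrr.
  by rewrite mulf_eq0 subr_eq0 (negbTE q1) /= => /eqP ->; rewrite mulr0.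
have N0 : 0 < N%:R :> R by rewrite ltr0n (leq_trans _ mN).
have : cn (N%:R * (P`_n * rc r ^+ n)) <= N%:R * B.
  rewrite -key (le_trans (sum_cn_le (G := fun=> B) _ _)) // => [l _|].
    rewrite cnM !cnX cz expr1n mulr1; apply: hB.
    by rewrite cnM cn_real cnX cz expr1n mulr1 ger0_norm // ltW.
  by rewrite sumr_const card_ord mulr_natl.
by rewrite !cnM cnX cn_real cn_nat (ger0_norm (ltW r0)) ler_pM2l.
Qed.

Lemma geo_tail (t : R) m n : 0 <= t -> t <= 2^-1 ->
  \sum_(m <= i < n) t ^+ i <= 2 * t ^+ m.
Proof.
move=> t0 t1; have [mn|nm] := leqP m n; last by rewrite big_geq ?mulr_ge0 ?exprn_ge0 // ltnW.
have h : (1 - t) * \sum_(m <= i < n) t ^+ i = t ^+ m - t ^+ n.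
  rewrite mulr_sumr (eq_bigr (fun i => - (t ^+ i.+1 - t ^+ i))) => [|i _]; last first.
    by rewrite exprS; ring.
  by rewrite sumrN telescope_sumr // opprB.
have s0 : 0 <= \sum_(m <= i < n) t ^+ i by apply: sumr_ge0 => i _; apply: exprn_ge0.
have : 0 <= (2^-1 - t) * \sum_(m <= i < n) t ^+ i by rewrite mulr_ge0 // subr_ge0.
have := exprn_ge0 n t0; move: h; rewrite !mulrBl !mul1r; lra.
Qed.

Lemma appr_center f z0 r : appr f z0 r <-> appr (fun z => f (z0 + z)) 0 r.
Proof.
split=> h.
  apply: (appr_comp (apprD (appr_cst z0 0 r) (appr_id 0 r)) h) => z /=.
  by rewrite subr0 addrC addKr.
apply: (@appr_ext _ (fun z => f (z0 + (z - z0)))) => [z _|].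
  by rewrite [z0 + _]addrC subrK.
by apply: (appr_comp (apprB (appr_id z0 r) (appr_cst z0 z0 r)) h) => z /=; rewrite subr0.
Qed.

Lemma poly_tail (P : {poly C}) r B M z : 0 < r -> 0 <= B ->
  (forall n, cn P`_n * r ^+ n <= B) -> cn z <= r / 2 ->
  cn (P.[z] - \sum_(n < M) P`_n * z ^+ n) <= 2 * B * (cn z / r) ^+ M.
Proof.
move=> r0 B0 hB hz; set t := cn z / r.
have t0 : 0 <= t by rewrite divr_ge0 ?cn_ge0 // ltW.
have t1 : t <= 2^-1 by rewrite ler_pdivrMr //; lra.
have -> : P.[z] - \sum_(n < M) P`_n * z ^+ n = \sum_(M <= n < maxn M (size P)) P`_n * z ^+ n.
  have -> : P.[z] = \sum_(0 <= n < maxn M (size P)) P`_n * z ^+ n.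
    by rewrite big_mkord -(horner_coef_wide z (leq_maxr M _)).
  rewrite (big_cat_nat (n := M)) ?leq_maxl //= big_mkord; ring.
apply: (le_trans (sum_cn_le (G := fun n => B * t ^+ n) _ _)) => [n _|].
  rewrite cnM cnX /t expr_div_n mulrA ler_pdivlMr ?exprn_gt0 // mulrAC.
  by rewrite ler_wpM2r ?exprn_ge0 ?cn_ge0.
by rewrite -mulr_sumr -mulrA mulrCA ler_wpM2l // geo_tail.
Qed.

(** The coefficients are limits of those of the approximating polynomials, whose differences are
    controlled by the Cauchy estimate [cauchy_poly]. The remainder bound passes to the limit from
    [poly_tail]. *)
Lemma taylor f z0 r B : 0 < r -> appr f z0 r -> (forall z, cn (z - z0) <= r -> cn (f z) <= B) ->
  exists2 a : nat -> C, forall n, cn (a n) * r ^+ n <= B &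
    forall M z, cn z <= r / 2 ->
      cn (f (z0 + z) - \sum_(n < M) a n * z ^+ n) <= 2 * B * (cn z / r) ^+ M.
Proof.
move=> r0 /appr_center hf hB; pose F z := f (z0 + z).
have {}hB z : cn z <= r -> cn (F z) <= B by move=> h; apply: hB; rewrite addrC addKr.
have B0 : 0 <= B by apply: le_trans (cn_ge0 _) (hB 0 _); rewrite cn0 ltW.
have h2 k : 0 < (2^-1 : R) ^+ k by rewrite exprn_gt0 // invr_gt0.
pose P k := sval (cid (hf _ (h2 k))).
have hP k z : cn z <= r -> cn (F z - (P k).[z]) <= 2^-1 ^+ k.
  by move=> h; apply: (svalP (cid (hf _ (h2 k)))); rewrite subr0.
have bP k n : cn (P k)`_n * r ^+ n <= B + 2^-1 ^+ k.
  apply: cauchy_poly => // z zr; have := hP k z zr; have := hB z zr.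
  have := cnB (F z) (F z - (P k).[z]); rewrite subKr; lra.
have rn n : 0 < r ^+ n by rewrite exprn_gt0.
have cP k l n : cn ((P k)`_n - (P l)`_n) <= (r ^+ n)^-1 * (2^-1 ^+ k + 2^-1 ^+ l).
  rewrite mulrC ler_pdivlMr // -coefB; apply: cauchy_poly => // z zr.
  rewrite hornerD hornerN.
  have -> : (P k).[z] - (P l).[z] = (F z - (P l).[z]) - (F z - (P k).[z]) by ring.
  apply: le_trans (cnB _ _) _; have := hP k z zr; have := hP l z zr; lra.
have hex n : exists a, forall k, cn ((P k)`_n - a) <= 2 * (r ^+ n)^-1 * 2^-1 ^+ k.
  by apply: half_cauchyC => k l; exact: cP.
pose a n := sval (cid (hex n)).
have ha n k : cn ((P k)`_n - a n) * r ^+ n <= 2 * 2^-1 ^+ k.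
  by have := svalP (cid (hex n)) k; rewrite -/(a n) mulrAC ler_pdivlMr.
exists a => [n|M z zr].
  apply: (@le_half_pow _ _ 3) => k.
  have -> : a n = (P k)`_n - ((P k)`_n - a n) by ring.
  apply: le_trans (ler_wpM2r (ltW (rn n)) (cnB _ _)) _; rewrite mulrDl.
  have := bP k n; have := ha n k; lra.
set t := cn z / r.
have t0 : 0 <= t by rewrite divr_ge0 ?cn_ge0 // ltW.
have t1 : t <= 2^-1 by rewrite ler_pdivrMr //; lra.
have tM : t ^+ M <= 1 by rewrite exprn_ile1 //; lra.
have zr' : cn z <= r by lra.
(* Three sources of error: [F] against [P k] (1), the Cauchy bound [B + 2^-1 ^+ k] in place of [B]
   (2), and the first [M] coefficients (2 for each). *)
apply: (@le_half_pow _ _ (1 + 2 + 2 * M%:R)) => k.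
have -> : f (z0 + z) - \sum_(n < M) a n * z ^+ n = (F z - (P k).[z]) +
  ((P k).[z] - \sum_(n < M) (P k)`_n * z ^+ n) + \sum_(n < M) ((P k)`_n - a n) * z ^+ n.
  rewrite /F; under [X in _ = _ + X]eq_bigr do rewrite mulrBl.
  rewrite sumrB; ring.
apply: le_trans (cnD _ _) _; apply: le_trans (lerD (cnD _ _) (lexx _)) _.
have e1 := hP k z zr'.
have Bk : 0 <= B + 2^-1 ^+ k by have := h2 k; lra.
have e2 := @poly_tail (P k) r _ M z r0 Bk (bP k) zr; rewrite -/t in e2.
have e3 : cn (\sum_(n < M) ((P k)`_n - a n) * z ^+ n) <= M%:R * (2 * 2^-1 ^+ k).
  apply: (le_trans (sum_cn_le (G := fun=> 2 * 2^-1 ^+ k) _ _)) => [n _|].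
    rewrite cnM cnX; apply: le_trans (ha n k); rewrite ler_wpM2l ?cn_ge0 //.
    by rewrite lerXn2r // nnegrE ?cn_ge0 // ltW.
  by rewrite sumr_const card_ord -[X in X <= _]mulr_natl.
have e4 : (2 * 2^-1 ^+ k) * t ^+ M <= 2 * 2^-1 ^+ k.
  by rewrite ler_piMr // mulr_ge0 // ltW.
have : 2 * (B + 2^-1 ^+ k) * t ^+ M = 2 * B * t ^+ M + (2 * 2^-1 ^+ k) * t ^+ M by ring.
have : (1 + 2 + 2 * M%:R) * 2^-1 ^+ k = 2^-1 ^+ k + 2 * 2^-1 ^+ k + M%:R * (2 * 2^-1 ^+ k) :> R by ring.
lra.
Qed.

(** An asymptotic expansion at 0 determines its coefficients; the constant may depend on the order
    [M], as it does in the application. *)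
Lemma taylor_uniq f (a b : nat -> C) (rho : R) (K : nat -> R) : 0 < rho ->
  (forall M z, cn z <= rho -> cn (f z - \sum_(n < M) a n * z ^+ n) <= K M * cn z ^+ M) ->
  (forall M z, cn z <= rho -> cn (f z - \sum_(n < M) b n * z ^+ n) <= K M * cn z ^+ M) ->
  forall n, a n = b n.
Proof.
move=> rho0 ha hb n; elim/ltn_ind: n => n IH.
apply/eqP; rewrite -subr_eq0; apply/eqP; apply: (@cn_small0 _ _ (2 * K n.+1)) => e e0.
pose d := Num.min rho e; have d0 : 0 < d by rewrite lt_min rho0.
pose z : C := rc d; have cz : cn z = d by rewrite cn_real gtr0_norm.
have zr : cn z <= rho by rewrite cz ge_min lexx.
have Kn0 : 0 <= K n.+1.
  have := le_trans (cn_ge0 _) (ha n.+1 z zr); rewrite pmulr_lge0 //.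
  by rewrite exprn_gt0 // cz.
have h : cn ((a n - b n) * z ^+ n) <= 2 * K n.+1 * d ^+ n.+1.
  have -> : (a n - b n) * z ^+ n = (f z - \sum_(i < n.+1) b i * z ^+ i) -
     (f z - \sum_(i < n.+1) a i * z ^+ i).
    rewrite !big_ord_recr /=; have -> : \sum_(i < n) a i * z ^+ i = \sum_(i < n) b i * z ^+ i.
      by apply: eq_bigr => i _; rewrite IH.
    ring.
  apply: le_trans (cnB _ _) _; have := ha n.+1 z zr; have := hb n.+1 z zr; rewrite cz; lra.
rewrite cnM cnX cz in h; rewrite exprS mulrA ler_pM2r ?exprn_gt0 // in h.
apply: le_trans h _; rewrite ler_wpM2l ?mulr_ge0 // ge_min lexx orbT //.
Qed.

(** Isolated zeros: unless all Taylor coefficients vanish, the first non-zero one, of index [d],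
    dominates the remainder of order [d + 1] on a small punctured disc. *)
Lemma zero_dich f z0 : holo f z0 ->
  (exists2 d, 0 < d & forall z, cn (z - z0) < d -> f z = 0) \/
  (exists2 d, 0 < d & forall z, 0 < cn (z - z0) -> cn (z - z0) < d -> f z <> 0).
Proof.
move=> [r r0 hf]; have [B B0 hB] := appr_bound hf.
have [a ha hT] := taylor r0 hf hB.
have [az|/existsNP[m /eqP am]] := pselect (forall n, a n = 0).
  left; exists (r / 2) => [|z zr]; first by lra.
  apply/eqP; rewrite -cn_eq0; apply/eqP/le_anti; rewrite cn_ge0 andbT.
  apply: (@le_half_pow _ _ (2 * B)) => k; rewrite add0r.
  have := hT k (z - z0) (ltW zr); rewrite [z0 + _]addrC subrK big1 ?subr0 => [|i _]; last by rewrite az mul0r.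
  move/le_trans; apply; apply: ler_wpM2l; first by rewrite mulr_ge0 // ltW.
  have t0 : 0 <= cn (z - z0) / r by rewrite divr_ge0 ?cn_ge0 // ltW.
  by rewrite lerXn2r ?nnegrE ?invr_ge0 // ler_pdivrMr //; lra.
right; have exm : exists n, a n != 0 by exists m.
case: (ex_minnP exm) => d ad dmin.
have cad : 0 < cn (a d) by rewrite cn_gt0.
exists (Num.min (r / 2) (cn (a d) * r ^+ d.+1 / (4 * B))).
  rewrite lt_min; apply/andP; split; first by lra.
  by rewrite divr_gt0 ?mulr_gt0 ?exprn_gt0.
move=> z; set w := z - z0; rewrite lt_min => w0 /andP[w1 w2] fz.
have := hT d.+1 w (ltW w1); rewrite [z0 + w]addrC subrK fz big_ord_recr /= big1 => [|i _]; last first.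
  apply/eqP; rewrite mulf_eq0; apply/orP; left; apply/negPn/negP => ai.
  by have := dmin _ ai; rewrite leqNgt ltn_ord.
rewrite !add0r cnN cnM cnX expr_div_n => h.
have : cn (a d) * cn w ^+ d * r ^+ d.+1 <= 2 * B * cn w ^+ d.+1.
  by rewrite -ler_pdivlMr ?exprn_gt0 // (le_trans h) // mulrA.
rewrite [cn w ^+ d.+1]exprS mulrA mulrAC ler_pM2r ?exprn_gt0 // => h'.
move: w2; rewrite ltr_pdivlMr ?mulr_gt0 //.
have := mulr_gt0 B0 w0; lra.
Qed.

End Taylor.

(** * Derivatives and strict differentiability *)

Section Derivative.
Variable R : realType.
Local Notation C := R[i].
Implicit Types (z w h : C) (r : R) (f g : C -> C).

Definition wder f z a := exists K d, [/\ 0 < d, 0 <= K &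
  forall h, cn h <= d -> cn (f (z + h) - f z - a * h) <= K * cn h ^+ 2].

Lemma wder_uniq f z a b : wder f z a -> wder f z b -> a = b.
Proof.
move=> [K [d [d0 K0 ha]]] [L [d' [d'0 L0 hb]]]; apply/eqP; rewrite -subr_eq0; apply/eqP.
apply: (@cn_small0 _ _ (K + L)) => e e0.
pose x := Num.min e (Num.min d d'); have x0 : 0 < x by rewrite !lt_min e0 d0.
have cx : cn (rc x : C) = x by rewrite cn_real gtr0_norm.
have := ha (rc x); have := hb (rc x); rewrite cx => /(_ _)/wrap[]; first by rewrite !ge_min lexx !orbT.
move=> h1 /(_ _)/wrap[]; first by rewrite !ge_min lexx !orbT.
move=> h2; have : cn ((a - b) * rc x) <= (K + L) * x ^+ 2.
  have -> : (a - b) * rc x = (f (z + rc x) - f z - b * rc x) - (f (z + rc x) - f z - a * rc x) by ring.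
  apply: le_trans (cnB _ _) _; rewrite mulrDl; lra.
rewrite cnM cx expr2 mulrA ler_pM2r // => /le_trans; apply.
by rewrite ler_wpM2l ?addr_ge0 // ge_min lexx.
Qed.

Lemma wderB f g z a b : wder f z a -> wder g z b -> wder (fun z => f z - g z) z (a - b).
Proof.
move=> [K [d [d0 K0 ha]]] [L [d' [d'0 L0 hb]]]; exists (K + L), (Num.min d d').
split; [by rewrite lt_min d0|exact: addr_ge0|move=> h; rewrite le_min => /andP[h1 h2]].
have -> : f (z + h) - g (z + h) - (f z - g z) - (a - b) * h =
  (f (z + h) - f z - a * h) - (g (z + h) - g z - b * h) by ring.
by apply: le_trans (cnB _ _) _; rewrite mulrDl lerD ?ha ?hb.
Qed.

Lemma wder_poly (P : {poly C}) z : wder (fun z => P.[z]) z P^`().[z].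
Proof.
elim/poly_ind: P => [|P c [K [d [d0 K0 ha]]]].
  by exists 0, 1; split => // h _; rewrite deriv0 !horner0 !mul0r !subrr cn0.
exists (cn P^`().[z] + K * (cn z + d)), d; split => //.
  by rewrite addr_ge0 ?mulr_ge0 ?addr_ge0 ?cn_ge0 // ltW.
move=> h hd; rewrite !hornerMXaddC derivMXaddC hornerD hornerM hornerX.
set E := P.[z + h] - P.[z] - P^`().[z] * h.
have -> : P.[z + h] * (z + h) + c - (P.[z] * z + c) - (P.[z] + P^`().[z] * z) * h =
  P^`().[z] * h ^+ 2 + E * (z + h) by rewrite /E; ring.
apply: le_trans (cnD _ _) _; rewrite (cnM _ (h ^+ 2)) cnX (cnM E) mulrDl lerD2l mulrAC ler_pM ?cn_ge0 ?ha //.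
by rewrite (le_trans (cnD _ _)) // lerD2l.
Qed.

Lemma taylor1 f z0 r B : 0 < r -> appr f z0 r -> (forall z, cn (z - z0) <= r -> cn (f z) <= B) ->
  exists2 a, cn a * r <= B & forall h, cn h <= r / 2 ->
    cn (f (z0 + h) - f z0 - a * h) <= 2 * B / r ^+ 2 * cn h ^+ 2.
Proof.
move=> r0 hf hB; have [a ha hT] := taylor r0 hf hB.
exists (a 1%N) => [|h hr]; first by have := ha 1%N; rewrite expr1.
have a0 : a 0%N = f z0.
  have := hT 1%N 0; rewrite cn0 addr0 big_ord1 expr0 mulr1 mul0r expr1 mulr0.
  have r2 : 0 <= r / 2 by lra.
  move=> /(_ r2) h1; apply/eqP; rewrite eq_sym -subr_eq0 -cn_eq0; apply/eqP/le_anti.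
  by rewrite h1 cn_ge0.
have := hT 2%N h hr; rewrite !big_ord_recr big_ord0 /= add0r expr0 mulr1 expr1 a0 opprD addrA.
by rewrite expr_div_n mulrA mulrAC.
Qed.

(** If [P] is within [e * (r / 2)] of [f], the Cauchy estimate for the first Taylor coefficient of
    [f - P] on discs of radius [r / 2] bounds the difference of the derivatives by [e]. So the
    derivatives of the [P] approximate [g] uniformly. *)
Lemma holo_der f z0 r : 0 < r -> appr f z0 r -> exists g K, [/\ appr g z0 (r / 2), 0 <= K &
  forall z h, cn (z - z0) <= r / 2 -> cn h <= r / 4 ->
    cn (f (z + h) - f z - g z * h) <= K * cn h ^+ 2].
Proof.
move=> r0 hf; have [B B0 hB] := appr_bound hf; have r2 : 0 < r / 2 by lra.
have sub f1 z : appr f1 z0 r -> cn (z - z0) <= r / 2 -> appr f1 z (r / 2).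
  by move=> h1 zr; apply: appr_le h1 _; lra.
have subd z w : cn (z - z0) <= r / 2 -> cn (w - z) <= r / 2 -> cn (w - z0) <= r.
  by move=> h1 h2; rewrite -(subrK z w) -addrA (le_trans (cnD _ _)) //; lra.
have ex z : exists a, cn (z - z0) <= r / 2 -> forall h, cn h <= r / 4 ->
    cn (f (z + h) - f z - a * h) <= 2 * B / (r / 2) ^+ 2 * cn h ^+ 2.
  have [zr|zr] := leP (cn (z - z0)) (r / 2); last by exists 0.
  have [|a _ ha] := @taylor1 f z (r / 2) B r2 (sub f z hf zr).
    by move=> w wr; apply: hB; apply: subd zr wr.
  by exists a => _ h hr; apply: ha; lra.
pose g z := sval (cid (ex z)).
have hg z h : cn (z - z0) <= r / 2 -> cn h <= r / 4 ->
    cn (f (z + h) - f z - g z * h) <= 2 * B / (r / 2) ^+ 2 * cn h ^+ 2.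
  by move=> zr; apply: (svalP (cid (ex z))).
have K0 : 0 <= 2 * B / (r / 2) ^+ 2 by rewrite divr_ge0 ?mulr_ge0 ?exprn_ge0 // ltW.
exists g, (2 * B / (r / 2) ^+ 2); split => // e e0.
have [P hP] := hf (e * (r / 2)) (mulr_gt0 e0 r2); exists P^`() => z zr.
pose k z := f z - P.[z].
have ak : appr k z (r / 2) by apply: apprB; [exact: sub|exact: appr_poly].
have [|a ca ha] := @taylor1 k z (r / 2) (e * (r / 2)) r2 ak.
  by move=> w wr; apply: hP; apply: subd zr wr.
suff <- : a = g z - P^`().[z] by move: ca; rewrite ler_pM2r.
apply: (@wder_uniq k z).
  exists (2 * (e * (r / 2)) / (r / 2) ^+ 2), (r / 2 / 2); split => //; first by lra.
  by rewrite divr_ge0 ?mulr_ge0 ?exprn_ge0 // ltW.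
apply: wderB (wder_poly P z); exists (2 * B / (r / 2) ^+ 2), (r / 4); split => //; first by lra.
by move=> h; apply: hg.
Qed.

(** Strict differentiability: both points vary. For [a != 0] it makes [f], divided by [a], a small
    Lipschitz perturbation of the identity near [z]. *)
Definition sder f z a := forall e, 0 < e -> exists2 d, 0 < d &
  forall w1 w2, cn (w1 - z) <= d -> cn (w2 - z) <= d ->
    cn (f w1 - f w2 - a * (w1 - w2)) <= e * cn (w1 - w2).

Lemma holo_sder f z0 : holo f z0 ->
  (exists2 d, 0 < d & forall z, cn (z - z0) <= d -> f z = f z0) \/
  (exists2 d, 0 < d & forall z, 0 < cn (z - z0) -> cn (z - z0) < d ->
     exists2 a, a != 0 & sder f z a).
Proof.
move=> [r r0 hf]; have [g [K [hg K0 hK]]] := holo_der r0 hf.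
have r2 : 0 < r / 2 by lra.
have hg0 : holo g z0 by exists (r / 2).
have [[d d0 gz]|[d d0 gn]] := zero_dich hg0.
  left; exists (Num.min (d / 2) (r / 4)) => [|z]; first by rewrite lt_min; lra.
  rewrite le_min => /andP[zd zr]; set h := z - z0 in zd zr.
  (* Where the derivative vanishes, each of [n.+1] equal steps from [z0] to [z] contributes only a
     quadratic error, so the total is of order 1 / (n + 1). *)
  have step (n : nat) : forall k, (k <= n.+1)%N ->
     cn (f (z0 + (k%:R / n.+1%:R) * h) - f z0) <= k%:R * (K * (cn h / n.+1%:R) ^+ 2).
    elim=> [|k IH] kn; first by rewrite !mul0r addr0 subrr cn0.
    have kn1 : (k%:R / n.+1%:R : R) <= 1 by rewrite ler_pdivrMr ?mul1r ?ler_nat ?ltr0n // ltnW.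
    set w := z0 + (k%:R / n.+1%:R) * h; set dh := h / n.+1%:R.
    have cw : cn (w - z0) <= cn h.
      rewrite /w addrC addKr !cnM cnV !cn_nat ler_piMl ?cn_ge0 //.
    have cdh : cn dh = cn h / n.+1%:R by rewrite cnM cnV cn_nat.
    have cdh' : cn dh <= cn h.
      by rewrite cdh ler_pdivrMr ?ltr0n // ler_peMr ?cn_ge0 // ler1n.
    have := hK w dh; rewrite gz; last by lra.
    rewrite mul0r subr0 => h1.
    have -> : z0 + k.+1%:R / n.+1%:R * h = w + dh by rewrite /w /dh -(natr1 k); ring.
    have -> : f (w + dh) - f z0 = (f (w + dh) - f w) + (f w - f z0) by ring.
    have -> : k.+1%:R * (K * (cn h / n.+1%:R) ^+ 2) = K * (cn h / n.+1%:R) ^+ 2 +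
        k%:R * (K * (cn h / n.+1%:R) ^+ 2) by rewrite -(natr1 k); ring.
    apply: le_trans (cnD _ _) (lerD _ (IH (ltnW kn))).
    by rewrite -cdh; apply: h1; lra.
  apply/eqP; rewrite -subr_eq0; apply/eqP; apply: (@cn_small0 _ _ (K * cn h ^+ 2)) => e e0.
  pose n := Num.truncn e^-1; have := step n n.+1 (leqnn _).
  rewrite divff ?pnatr_eq0 // mul1r /h [z0 + _]addrC subrK -/h => /le_trans; apply.
  have n0 : 0 < n.+1%:R :> R by rewrite ltr0n.
  have ne : n.+1%:R^-1 <= e.
    by rewrite -[e]invrK lef_pV2 ?posrE ?invr_gt0 // ltW // truncnS_gt.
  have -> : n.+1%:R * (K * (cn h / n.+1%:R) ^+ 2) = K * cn h ^+ 2 * n.+1%:R^-1.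
    by field; rewrite gt_eqF.
  by rewrite ler_wpM2l // mulr_ge0 // sqr_ge0.
right; exists (Num.min d (r / 4)) => [|z zp]; first by rewrite lt_min; lra.
rewrite lt_min => /andP[zd zr]; exists (g z); first by apply/eqP; apply: gn.
move=> e e0; have e2 : 0 < e / 2 by lra.
have hgz : appr g z (r / 4) by apply: appr_le hg _; lra.
have r4 : 0 < r / 4 by lra.
have [d1 d10 [d1r hd1]] := appr_cont r4 hgz e2.
exists (Num.min d1 (Num.min (r / 8) (e / 4 / (K + 1)))).
  by rewrite !lt_min d10 /= !divr_gt0 ?ltr_wpDl //.
move=> w1 w2; rewrite !le_min => /andP[_ /andP[w1r w1e]] /andP[w2d /andP[w2r w2e]].
have w2z : cn (w2 - z0) <= r / 2.
  by rewrite -(subrK z w2) -addrA (le_trans (cnD _ _)) //; lra.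
have w12 : cn (w1 - w2) <= cn (w1 - z) + cn (w2 - z).
  by have := cnB (w1 - z) (w2 - z); congr (cn _ <= _); ring.
have := hK w2 (w1 - w2) w2z; rewrite [w2 + _]addrC subrK => h1.
have {}h1 : cn (f w1 - f w2 - g w2 * (w1 - w2)) <= K * cn (w1 - w2) ^+ 2 by apply: h1; lra.
have -> : f w1 - f w2 - g z * (w1 - w2) = (f w1 - f w2 - g w2 * (w1 - w2)) + (g w2 - g z) * (w1 - w2) by ring.
apply: le_trans (cnD _ _) _; rewrite cnM.
have h2 : cn (g w2 - g z) * cn (w1 - w2) <= e / 2 * cn (w1 - w2) by rewrite ler_wpM2r ?cn_ge0 ?hd1.
have h3 : K * cn (w1 - w2) ^+ 2 <= e / 2 * cn (w1 - w2).
  rewrite expr2 mulrA ler_wpM2r ?cn_ge0 //.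
  apply: le_trans (_ : (K + 1) * cn (w1 - w2) <= _); first by rewrite mulrDl lerDl mul1r cn_ge0.
  have K1 : 0 < K + 1 by lra.
  rewrite mulrC -ler_pdivlMr //; apply: le_trans w12 _.
  have -> : e / 2 / (K + 1) = e / 4 / (K + 1) + e / 4 / (K + 1) by field; rewrite gt_eqF.
  exact: lerD.
have -> : e * cn (w1 - w2) = e / 2 * cn (w1 - w2) + e / 2 * cn (w1 - w2) by field.
exact: lerD (le_trans h1 h3) h2.
Qed.

End Derivative.

(** * Connectedness of natural domains *)

Section Preconnected.
Variable R : realType.
Local Notation C := R[i].
Implicit Types (z w h : C) (r : R) (f g : C -> C) (U A : set C).

Definition opn U := forall z, U z -> exists2 d, 0 < d & forall w, cn (w - z) < d -> U w.

Definition locc U A := forall z, U z -> exists2 d, 0 < d &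
  forall w, U w -> cn (w - z) < d -> (A w <-> A z).

(* Connectedness: a predicate locally constant on U is constant on U. *)
Definition preconn U := forall A, locc U A -> forall z w, U z -> U w -> A z -> A w.

(** Connectedness of the unit interval: the supremum of the [t] such that [P] holds on [0, t] is
    attained and cannot lie below 1. *)
Lemma unit_locc (P : R -> Prop) :
  (forall t, 0 <= t <= 1 -> exists2 d, 0 < d &
     forall s, 0 <= s <= 1 -> `|s - t| < d -> (P s <-> P t)) -> P 0 -> P 1.
Proof.
move=> h P0; pose A := [set t : R | 0 <= t <= 1 /\ forall s, 0 <= s <= t -> P s].
have A0 : A 0.
  by split=> [|s]; rewrite ?lexx ?ler01 // => /le_anti <-.
have ub1 : ubound A 1 by move=> t [/andP[]].
have hs : has_sup A by split; [exists 0|exists 1].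
set c := sup A; have c1 : c <= 1 by apply: ge_sup hs.1 _.
have c0 : 0 <= c by apply: ub_le_sup hs.2 _ A0.
have c01 : 0 <= c <= 1 by rewrite c0.
have [d d0 hd] := h c c01.
have [t At tc] := sup_adherent d0 hs; rewrite -/c in tc.
have tlec : t <= c by apply: ub_le_sup hs.2 _ At.
have [/andP[t0 t1] Pt] := At.
have Pc : P c.
  apply/(hd t); [by rewrite t0|by rewrite distrC ger0_norm ?subr_ge0 //; lra|].
  by apply: Pt; rewrite t0 lexx.
have Ps s : 0 <= s <= 1 -> s < c + d -> P s.
  move=> /andP[s0 s1] sd; have [st|ts] := leP s t; first by apply: Pt; rewrite s0.
  by apply/(hd s) => //; rewrite ?s0 // ltr_norml; apply/andP; split; lra.
have [cd|cd] := ltP 1 (c + d); first by apply: Ps => //; rewrite lexx ler01.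
have : A (c + d / 2).
  split=> [|s /andP[s0 s1]]; first by apply/andP; split; lra.
  by apply: Ps; [apply/andP; split|]; lra.
by move/(ub_le_sup hs.2) => /=; rewrite -/c; lra.
Qed.

Lemma seg_locc U A z w : locc U A ->
  (forall t, 0 <= t <= 1 -> U (z + rc t * (w - z))) -> A z <-> A w.
Proof.
suff key z' w' : locc U A -> (forall t, 0 <= t <= 1 -> U (z' + rc t * (w' - z'))) -> A z' -> A w'.
  move=> hA hU; split; apply: key => // t /andP[t0 t1].
  have -> : w + rc t * (z - w) = z + rc (1 - t) * (w - z) by rewrite rcB; ring.
  by apply: hU; apply/andP; split; lra.
move=> hA hU Az; pose P t := A (z' + rc t * (w' - z')).
have : P 1.
  apply: unit_locc; last by rewrite /P rmorph0 mul0r addr0.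
  move=> t t01; have [d d0 hd] := hA _ (hU t t01).
  have q0 : 0 < cn (w' - z') + 1 by have := cn_ge0 (w' - z'); lra.
  exists (d / (cn (w' - z') + 1)) => [|s s01 st]; first by rewrite divr_gt0.
  apply: hd; first exact: hU.
  have -> : z' + rc s * (w' - z') - (z' + rc t * (w' - z')) = rc (s - t) * (w' - z') by rewrite rcB; ring.
  rewrite cnM cn_real; apply: le_lt_trans (_ : `|s - t| * (cn (w' - z') + 1) < d).
    by rewrite ler_wpM2l // lerDl.
  by rewrite -ltr_pdivlMr.
by rewrite /P rmorph1 mul1r addrC subrK.
Qed.

Lemma convex_preconn U : (forall z w t, U z -> U w -> 0 <= t <= 1 -> U (z + rc t * (w - z))) ->
  preconn U.
Proof. by move=> cU A hA z w Uz Uw; apply: (seg_locc hA _).1 => t; apply: cU. Qed.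

Lemma punctured_preconn z0 r : preconn [set z : C | 0 < cn (z - z0) < r].
Proof.
move=> A hA z w /= /andP[z1 z2] /andP[w1 w2].
have seg z' w' : 0 < cn (z' - z0) < r -> 0 < cn (w' - z0) < r ->
   (forall t, 0 <= t <= 1 -> z' - z0 + rc t * (w' - z') != 0) -> A z' <-> A w'.
  move=> /andP[a1 a2] /andP[b1 b2] h; apply: (seg_locc hA) => t t01 /=.
  have -> : z' + rc t * (w' - z') - z0 = z' - z0 + rc t * (w' - z') by ring.
  rewrite cn_gt0 h //=; have /andP[t0 t1] := t01.
  have -> : z' - z0 + rc t * (w' - z') = rc (1 - t) * (z' - z0) + rc t * (w' - z0) by rewrite rcB; ring.
  apply: le_lt_trans (cnD _ _) _; rewrite !cnM !cn_real !ger0_norm //; last by lra.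
  have [->|tn] := eqVneq t 0; first by rewrite subr0 mul1r mul0r addr0.
  have tp : 0 < t by rewrite lt_def tn.
  have := ltr_pM2l tp (cn (w' - z0)) r; rewrite b2 => h1.
  have h2 : (1 - t) * cn (z' - z0) <= (1 - t) * r by rewrite ler_wpM2l //; lra.
  lra.
(* A detour by a quarter turn about [z0]: [z] is joined to the two points obtained from it by
   rotation, and from at least one of them the segment to [w] misses [z0]. *)
pose m (s : C) := z0 + s * 'i%C * (z - z0).
have cm s : cn s = 1 -> cn (m s - z0) = cn (z - z0).
  by move=> s1; rewrite /m addrC addKr !cnM s1 cn_i !mul1r.
have zm s : s = 1 \/ s = -1 -> A z <-> A (m s).
  move=> hs; have s1 : cn s = 1 by case: hs => ->; rewrite ?cnN cn1.
  apply: seg; rewrite ?cm ?z1 // => t /andP[t0 t1].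
  have -> : z - z0 + rc t * (m s - z) = (z - z0) * (rc (1 - t) + s * rc t * 'i%C) by rewrite /m rcB; ring.
  rewrite mulf_neq0 //; first by rewrite -cn_gt0.
  apply/eqP => e; have := congr1 (@complex.Re R) e; have := congr1 (@complex.Im R) e.
  by case: hs => ->; rewrite ?mul1r ?mulN1r !reimE; lra.
have [s [hs ms]] : exists s : C, (s = 1 \/ s = -1) /\
    forall t, 0 <= t <= 1 -> m s - z0 + rc t * (w - m s) != 0.
  have [|/existsNP[t /not_implyP[/andP[t0 t1] /negP]]] :=
      pselect (forall t, 0 <= t <= 1 -> m 1 - z0 + rc t * (w - m 1) != 0).
    by exists 1; split; [left|].
  rewrite negbK => /eqP e1; exists (-1); split; [by right|move=> u /andP[u0 u1]].
  apply/eqP => e2.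
  have : rc (u * (1 - t) + t * (1 - u)) * (z - z0) = 0.
    have : rc u * (m 1 - z0 + rc t * (w - m 1)) - rc t * (m (-1) - z0 + rc u * (w - m (-1))) = 0.
      by rewrite e1 e2 !mulr0 subrr.
    move=> h; apply: (mulfI (x := 'i%C)); first by rewrite -cn_gt0 cn_i.
    rewrite mulr0 -[RHS]h /m rcD !rcM !rcB; ring.
  move/eqP; rewrite mulf_eq0 -[z - z0 == 0]negbK -cn_gt0 z1 orbF rc_eq0 => /eqP h.
  have p1 : 0 <= u * (1 - t) by rewrite mulr_ge0 //; lra.
  have p2 : 0 <= t * (1 - u) by rewrite mulr_ge0 //; lra.
  have q1 : u * (1 - t) = 0 by lra.
  have q2 : t * (1 - u) = 0 by lra.
  have [tz|tn] := eqVneq t 0.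
    have : m 1 - z0 = 0 by rewrite -e1 tz rmorph0 mul0r addr0.
    by move/eqP; rewrite -cn_eq0 cm ?cn1 // gt_eqF.
  have u1' : u = 1.
    by move/eqP: q2; rewrite mulf_eq0 (negbTE tn) /= subr_eq0 => /eqP.
  have : w - z0 = 0 by rewrite -e2 u1' rmorph1 mul1r; ring.
  by move/eqP; rewrite -cn_eq0 gt_eqF.
have s1 : cn s = 1 by case: hs => ->; rewrite ?cnN cn1.
move=> Az; apply: (seg (m s) w _ _ ms).1; rewrite ?cm ?z1 ?w1 //.
exact: (zm s hs).1.
Qed.

(** By [zero_dich], vanishing identically near a point is a locally constant property on [U]. *)
Lemma identity_thm U f z0 : preconn U -> (forall z, U z -> holo f z) -> U z0 ->
  (exists2 d, 0 < d & forall z, cn (z - z0) < d -> f z = 0) -> forall z, U z -> f z = 0.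
Proof.
move=> cU hf Uz0 f0 z Uz.
pose A := [set z | exists2 d : R, 0 < d & forall w, cn (w - z) < d -> f w = 0].
suff [d d0 hd] : A z by apply: hd; rewrite subrr cn0.
apply: (cU A _ z0) => // {z Uz} z Uz.
have [[d d0 hd]|[d d0 hd]] := zero_dich (hf z Uz).
  exists d => // w _ wz; split=> _; last first.
    exists (d - cn (w - z)) => [|v]; rewrite ?subr_gt0 // => vw; apply: hd.
    by rewrite -(subrK w v) -addrA (le_lt_trans (cnD _ _)) //; lra.
  by exists d.
exists d => // w _ wz; have [->//|nwz] := eqVneq w z.
split=> [[e e0 he]|[e e0 he]]; exfalso.
  by apply: (hd w); rewrite ?cn_gt0 ?subr_eq0 //; apply: he; rewrite subrr cn0.
pose x := Num.min (d / 2) (e / 2); have x0 : 0 < x by rewrite lt_min; lra.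
have cx : cn (z + rc x - z) = x by rewrite addrC addKr cn_real gtr0_norm.
have xd : x <= d / 2 by rewrite ge_min lexx.
have xe : x <= e / 2 by rewrite ge_min lexx orbT.
by apply: (hd (z + rc x)); rewrite ?cx //; [lra|apply: he; rewrite cx; lra].
Qed.

Lemma identity_real U f (x0 : R) d : preconn U -> (forall z, U z -> holo f z) -> U (rc x0) ->
  0 < d -> (forall x, `|x - x0| < d -> f (rc x) = 0) -> forall z, U z -> f z = 0.
Proof.
move=> cU hf Ux d0 h; apply: (identity_thm cU hf Ux).
have [//|[e e0 he]] := zero_dich (hf _ Ux).
exfalso; pose x := Num.min (d / 2) (e / 2); have xp : 0 < x by rewrite lt_min; lra.
have xd : x <= d / 2 by rewrite ge_min lexx.
have xe : x <= e / 2 by rewrite ge_min lexx orbT.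
have cx : cn (rc (x0 + x) - rc x0 : C) = x by rewrite rcD addrC addKr cn_real gtr0_norm.
apply: (he (rc (x0 + x))); rewrite ?cx //; first by lra.
by apply: h; rewrite addrC addKr gtr0_norm //; lra.
Qed.

End Preconnected.

(** * Planar maps close to the identity *)

Lemma lip_IVT (R : realType) (f : R -> R) (a b v K : R) : a <= b ->
  (forall x y, a <= x <= b -> a <= y <= b -> `|f x - f y| <= K * `|x - y|) ->
  f a <= v <= f b -> exists2 c, a <= c <= b & f c = v.
Proof.
(* Clamping to [a, b] turns a function controlled only on the interval into a continuous one on the
   whole line. *)
move=> ab lip hv; pose cl x := Num.max a (Num.min b x).
have clab x : a <= cl x <= b by rewrite /cl le_max lexx ge_max ab ge_min lexx.
have cl1 x y : `|cl x - cl y| <= `|x - y|.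
  rewrite /cl; rewrite ler_norml; move: (ler_norm (x - y)) (ler_norm (y - x)); rewrite (distrC y x).
  clear -ab; rewrite /Num.max /Num.min; do ! case: ifP; rewrite ?ltNge => *; apply/andP; split; lra.
have clid x : a <= x <= b -> cl x = x.
  by move=> /andP[h1 h2]; rewrite /cl (min_idPr h2) (max_idPr h1).
have K1 : 0 < `|K| + 1 by have := normr_ge0 K; lra.
have ct : {within `[a, b], continuous (f \o cl)}.
  apply: continuous_subspaceT => x; apply/cvgrPdist_le => e e0.
  near=> y; apply: le_trans (lip _ _ (clab _) (clab _)) _.
  apply: le_trans (_ : (`|K| + 1) * `|cl x - cl y| <= _).
    by rewrite ler_wpM2r // (le_trans (ler_norm _)) // lerDl.
  rewrite mulrC -ler_pdivlMr //; apply: le_trans (cl1 _ _) _.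
  near: y; apply: cvgr_dist_le; [exact: cvg_id|exact: divr_gt0].
have aa : a <= a <= b by rewrite lexx ab.
have bb : a <= b <= b by rewrite lexx ab.
have [|c + <-] := @IVT R (f \o cl) a b v ab ct.
  move: hv => /andP[h1 h2]; rewrite /= !clid // ge_min le_max h1 h2 orbT //.
by rewrite in_itv /= => cab; exists c; rewrite //= clid.
Unshelve. all: by end_near. Qed.

(** A weak inverse function theorem from two intermediate value arguments: [v] vanishes along a
    graph y = Y x, and u (x, Y x), a small Lipschitz perturbation of x, runs through all values near
    0. *)
Lemma graph_hits (R : realType) (u v : R -> R -> R) (r e m : R) : 0 < e -> e <= r ->
  (forall x y x' y', `|x| <= r -> `|y| <= r -> `|x'| <= r -> `|y'| <= r ->
   `|u x y - u x' y' - (x - x')| <= (`|x - x'| + `|y - y'|) / 10 /\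
   `|v x y - v x' y' - (y - y')| <= (`|x - x'| + `|y - y'|) / 10) ->
  u 0 0 = 0 -> v 0 0 = 0 -> `|m| < e / 4 ->
  exists x y, [/\ `|x| <= e / 2, `|y| <= e / 2, v x y = 0 & u x y = m].
Proof.
move=> e0 er diff u00 v00 hm; set q := e / 2.
have q0 : 0 < q by rewrite divr_gt0.
have qr : q <= r by rewrite /q; lra.
have hm2 : `|m| < q / 2 by move: hm; rewrite /q; lra.
have nq x : - q <= x <= q -> `|x| <= q by rewrite -ler_norml.
have eb x : - q <= x <= q -> `|x| <= r by move=> /nq /le_trans; apply.
have n0 : `|0 : R| <= r by rewrite normr0; lra.
have qq : - q <= q by clear -q0; lra.
have b1 : - q <= q <= q by rewrite qq lexx.
have b2 : - q <= - q <= q by rewrite qq lexx.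
clear hm er e0; clearbody q.
have nrm (x y : R) : `|x - y| <= `|y| / 10 -> `|x| <= 2 * `|y|.
  move=> h; rewrite -(subrK y x); apply: le_trans (ler_normD _ _) _.
  by clear -h; have := normr_ge0 y; lra.
have exy x : exists y, - q <= x <= q -> - q <= y <= q /\ v x y = 0.
  have [xe|/negP xe] := boolP (- q <= x <= q); last by exists 0.
  have xr := eb x xe; have [||y yb vy0] := @lip_IVT R (v x) (- q) q 0 2 qq.
  - move=> y y' yb yb'; have [_ h] := diff x y x y' xr (eb _ yb) xr (eb _ yb').
    by apply: nrm; rewrite subrr normr0 add0r in h.
  - have [_ p1] := diff x q 0 0 xr (eb _ b1) n0 n0.
    have [_ p2] := diff x (- q) 0 0 xr (eb _ b2) n0 n0.
    rewrite v00 !subr0 (gtr0_norm q0) in p1; rewrite v00 !subr0 (normrN q) (gtr0_norm q0) in p2.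
    move: p1 p2; rewrite !ler_norml => /andP[p1 p2] /andP[p3 p4].
    by have := nq x xe; clear -p1 p2 p3 p4 q0 => h; apply/andP; split; lra.
  by exists y.
pose Y x := sval (cid (exy x)).
have hY x : - q <= x <= q -> - q <= Y x <= q /\ v x (Y x) = 0 by exact: (svalP (cid (exy x))).
clearbody Y.
have [||x xe ux] := @lip_IVT R (fun x => u x (Y x)) (- q) q m 2 qq.
- move=> x x' xe xe'; have [y1 z1] := hY x xe; have [y2 z2] := hY x' xe'.
  have [p1 p2] := diff _ _ _ _ (eb _ xe) (eb _ y1) (eb _ xe') (eb _ y2).
  rewrite z1 z2 subrr sub0r normrN in p2.
  rewrite -(subrK (x - x') (_ - _)); apply: le_trans (ler_normD _ _) _.
  by clear -p1 p2; have := normr_ge0 (x - x'); lra.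
- have [/nq y1 _] := hY _ b1; have [/nq y2 _] := hY _ b2.
  have [p1 _] := diff q (Y q) 0 0 (eb _ b1) (le_trans y1 qr) n0 n0.
  have [p2 _] := diff (- q) (Y (- q)) 0 0 (eb _ b2) (le_trans y2 qr) n0 n0.
  rewrite u00 !subr0 (gtr0_norm q0) in p1.
  rewrite u00 !subr0 (normrN q) (gtr0_norm q0) in p2.
  move: p1 p2 hm2; rewrite !ler_norml ltr_norml => /andP[p1 p2] /andP[p3 p4] /andP[m1 m2].
  by clear -p1 p2 p3 p4 m1 m2 q0 y1 y2; apply/andP; split; lra.
by have [/nq yb vz] := hY x xe; exists x, (Y x); split => //; exact: nq.
Qed.

(** * Removing the preimage of the singular set from a connected domain *)

Section Removal.
Variables (R : realType) (S : set R).
Local Notation C := R[i].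
Implicit Types (z w h : C) (r : R) (f g F : C -> C) (U A W : set C).

Definition onl (y : R) := exists k : int, y = k%:~R + 2^-1.

(* The points of closure S + i (Z + 1/2), off which csig is analytic. *)
Definition bad z := onl (im z) /\ forall e, 0 < e -> exists2 s, S s & `|s - re z| < e.

Lemma int_lt1 (k : int) : `|k%:~R : R| < 1 -> k = 0.
Proof.
by move=> h; have : `|k| < 1 by [rewrite -(ltr_int R) intr_norm]; lia.
Qed.

Lemma onl_near y : exists2 d, 0 < d & forall y', `|y' - y| < d -> onl y' -> y' = y.
Proof.
pose m := Num.floor (y - 2^-1).
have m1 : m%:~R <= y - 2^-1 by exact: floor_le.
have m2 : y - 2^-1 < (m + 1)%:~R by exact: floorD1_gt.
rewrite intrD in m2.
have [e|ne] := eqVneq (m%:~R) (y - 2^-1).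
  exists 1 => // y' h [k e']; suff : k - m = 0 by move/subr0_eq => km; rewrite e' km e; lra.
  apply: int_lt1; rewrite intrB e; congr (`|_| < 1): h; rewrite e'; ring.
have m3 : m%:~R < y - 2^-1 by rewrite lt_def eq_sym ne.
exists (Num.min (y - 2^-1 - m%:~R) (m%:~R + 1 - (y - 2^-1))).
  by rewrite lt_min; apply/andP; split; lra.
move=> y'; rewrite lt_min !ltr_norml => /andP[/andP[h1 h2] /andP[h3 h4]] [k e'].
exfalso; have [km|mk] := leP k m.
  have : k%:~R <= m%:~R :> R by rewrite ler_int.
  lra.
have : (m + 1)%:~R <= k%:~R :> R by rewrite ler_int lezD1.
rewrite intrD; lra.
Qed.

Lemma good_open z : ~ bad z -> exists2 d, 0 < d & forall w, cn (w - z) < d -> ~ bad w.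
Proof.
move=> gz; have [d d0 hd] := onl_near (im z).
have imle w : `|im w - im z| <= cn (w - z) by have := le_im_cn (w - z); rewrite !reimE.
have rele w : `|re w - re z| <= cn (w - z) by have := le_re_cn (w - z); rewrite !reimE.
have [on|noff] := pselect (onl (im z)).
  have /existsNP[e /not_implyP[e0 he]] : ~ forall e, 0 < e -> exists2 s, S s & `|s - re z| < e.
    by move=> h; apply: gz.
  exists (e / 2) => [|w wz [_ hw]]; first by lra.
  have [|s Ss hs] := hw (e / 2); first by lra.
  apply: he; exists s => //; rewrite (_ : s - re z = (s - re w) + (re w - re z)); last by ring.
  by apply: le_lt_trans (ler_normD _ _) _; have := rele w; lra.
exists d => // w wz [onw _]; apply: noff; rewrite -(hd (im w)) //.
exact: le_lt_trans (imle w) wz.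
Qed.

Lemma real_good z : im z = 0 -> ~ bad z.
Proof.
move=> iz [[k]]; rewrite iz => e _; have : `|(2 * k + 1)%:~R : R| < 1.
  by rewrite intrD intrM -[2%:~R]/(2 : R) (_ : 2 * k%:~R + 1 = 0) ?normr0 //; lra.
by move/int_lt1 => h; lia.
Qed.

Hypothesis gapS : forall a b, a < b ->
  exists c d, [/\ a < c, c < d, d < b & forall x, c < x < d -> ~ S x].

Let goodset W F := [set z | W z /\ ~ bad (F z)].

Lemma goodset_opn W F : opn W -> (forall z, W z -> holo F z) -> opn (goodset W F).
Proof.
move=> oW hF z [Wz gz]; have [d d0 hd] := oW z Wz; have [e e0 he] := good_open gz.
have e2 : 0 < e / 2 by lra.
have [c c0 hc] := holo_cont (hF z Wz) e2.
exists (Num.min d c) => [|w]; first by rewrite lt_min d0.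
rewrite lt_min => /andP[wd wc]; split; first exact: hd.
by apply: he; apply: le_lt_trans (hc w (ltW wc)) _; lra.
Qed.

(* Near a non-critical point of F, the preimage of the line is a graph which
   separates two sides; a gap of S lets one pass from one side to the other. *)
Lemma noncritical_locc W F A z0 : opn W -> W z0 -> bad (F z0) ->
  (exists2 a, a != 0 & sder F z0 a) -> locc (goodset W F) A ->
  exists2 d, 0 < d & (exists P : Prop, forall w, goodset W F w -> cn (w - z0) < d -> (A w <-> P)) /\
    (forall e, 0 < e -> exists2 w, goodset W F w & cn (w - z0) < e).
Proof.
move=> oW Wz0 bz0 [a a0 hder] hA.
have ca : 0 < cn a by rewrite cn_gt0.
have [dW dW0 hdW] := oW z0 Wz0.
have e10 : 0 < cn a / 10 by rewrite divr_gt0.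
have [dF dF0 hdF] := hder _ e10.
(* Coordinates in which [F] minus its value at [z0] is x + i y, up to a Lipschitz error of one tenth
   of the increments. *)
pose pt x y : C := z0 + a^-1 * (rc x + 'i%C * rc y).
have ptd x y x' y' : pt x y - pt x' y' = a^-1 * (rc (x - x') + 'i%C * rc (y - y')).
  by rewrite /pt !rcB; ring.
have pt00 : pt 0 0 = z0 by rewrite /pt rmorph0 mulr0 addr0 mulr0 addr0.
have ptz x y : pt x y - z0 = a^-1 * (rc x + 'i%C * rc y) by rewrite /pt addrC addKr.
have cxy x y : cn (rc x + 'i%C * rc y : C) <= `|x| + `|y|.
  by apply: le_trans (cnD _ _) _; rewrite cnM cn_i mul1r !cn_real.
have [k imk] := bz0.1.
pose u x y := re (F (pt x y)) - re (F z0); pose v x y := im (F (pt x y)) - im (F z0).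
(* The bound 1/4 keeps [v] below 1 in absolute value, so that no second line with height in Z + 1/2
   is reached; the other two keep the box inside [W] and inside the disc of strict
   differentiability. *)
pose rho0 := Num.min (4^-1) (Num.min (dW * cn a / 4) (dF * cn a / 4)).
have rho00 : 0 < rho0 by rewrite !lt_min invr_gt0 ltr0n /= !divr_gt0 ?mulr_gt0.
have [r14 [rW rF]] : rho0 <= 4^-1 /\ rho0 <= dW * cn a / 4 /\ rho0 <= dF * cn a / 4.
  by rewrite !ge_min !lexx !orbT.
clearbody rho0.
have box3 (rho : R) (hr : 0 < rho <= rho0) x y : `|x| <= rho -> `|y| <= rho ->
    cn (pt x y - z0) < dW /\ cn (pt x y - z0) <= dF.
  move: hr => /andP[rp rr] hx hy; have h : cn (pt x y - z0) <= 2 * rho0 / cn a.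
    rewrite ptz cnM cnV mulrC ler_pdivlMr // divfK ?gt_eqF //.
    by apply: le_trans (cxy _ _) _; lra.
  have q1 : 2 * rho0 / cn a < dW.
    by rewrite ltr_pdivrMr //; have := mulr_gt0 dW0 ca; lra.
  have q2 : 2 * rho0 / cn a <= dF.
    by rewrite ler_pdivrMr //; have := mulr_gt0 dF0 ca; lra.
  by split; [exact: le_lt_trans h q1|exact: le_trans h q2].
have diff x y x' y' : `|x| <= rho0 -> `|y| <= rho0 -> `|x'| <= rho0 -> `|y'| <= rho0 ->
   `|u x y - u x' y' - (x - x')| <= (`|x - x'| + `|y - y'|) / 10 /\
   `|v x y - v x' y' - (y - y')| <= (`|x - x'| + `|y - y'|) / 10.
  move=> hx hy hx' hy'; have rr : 0 < rho0 <= rho0 by rewrite rho00 lexx.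
  have [_ b1] := box3 _ rr x y hx hy; have [_ b2] := box3 _ rr x' y' hx' hy'.
  have := hdF _ _ b1 b2; rewrite ptd mulVKf // cnM cnV.
  set D := rc _ + _; set E := F _ - _ - _ => h.
  have {}h : cn E <= (`|x - x'| + `|y - y'|) / 10.
    apply: le_trans h _; rewrite mulrA [_ / 10 * _]mulrAC divff ?gt_eqF // mul1r mulrC.
    by rewrite ler_wpM2r ?cxy.
  split; [apply: le_trans (le_trans (le_re_cn E) h)|apply: le_trans (le_trans (le_im_cn E) h)];
   rewrite /E /D /u /v !reimE; rewrite le_eqVlt; apply/orP; left; apply/eqP; congr `|_|; ring.
have v00 : v 0 0 = 0 by rewrite /v pt00 subrr.
have u00 : u 0 0 = 0 by rewrite /u pt00 subrr.
have n0 : `|0 : R| <= rho0 by rewrite normr0 ltW.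
have Wpt x y : `|x| <= rho0 -> `|y| <= rho0 -> W (pt x y).
  move=> hx hy; apply: hdW; have rr : 0 < rho0 <= rho0 by rewrite rho00 lexx.
  by have [] := box3 _ rr x y hx hy.
have vgood x y : `|x| <= rho0 -> `|y| <= rho0 -> v x y != 0 -> goodset W F (pt x y).
  move=> hx hy /eqP vn; split; first exact: Wpt.
  move=> [[k' e'] _]; apply: vn; rewrite /v e' imk.
  have [_ h2] := diff x y 0 0 hx hy n0 n0; rewrite v00 !subr0 in h2.
  have kk : k' - k = 0.
    apply: int_lt1; rewrite intrB.
    have ve : v x y = k'%:~R - k%:~R by rewrite /v e' imk; ring.
    rewrite -ve; apply: le_lt_trans (_ : `|v x y - y| + `|y| < 1).
      by rewrite -{1}(subrK y (v x y)) ler_normD.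
    lra.
  by rewrite (subr0_eq kk) subrr.
have vv x y y' : `|x| <= rho0 -> `|y| <= rho0 -> `|y'| <= rho0 -> y <= y' ->
    v x y + (y' - y) * (9/10) <= v x y'.
  move=> hx hy hy' yy; have [_] := diff x y' x y hx hy' hx hy.
  rewrite subrr normr0 add0r (ger0_norm (_ : 0 <= y' - y)) ?subr_ge0 // ler_norml => /andP[].
  by clear; lra.
have vy x y : `|x| <= rho0 -> `|y| <= rho0 -> `|v x y - y| <= (`|x| + `|y|) / 10.
  by move=> hx hy; have [_] := diff x y 0 0 hx hy n0 n0; rewrite v00 !subr0.
have hrho : `|rho0| <= rho0 by rewrite gtr0_norm.
have hrhoN : `|- rho0| <= rho0 by rewrite normrN gtr0_norm.
have ptseg x y x' y' t : pt x y + rc t * (pt x' y' - pt x y) = pt (x + t * (x' - x)) (y + t * (y' - y)).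
  by rewrite ptd /pt !rcD !rcM !rcB; ring.
have cvx (c y y' t : R) : `|y| <= c -> `|y'| <= c -> 0 <= t <= 1 -> `|y + t * (y' - y)| <= c.
  move=> h1 h2 /andP[t0 t1]; have -> : y + t * (y' - y) = (1 - t) * y + t * y' by ring.
  have c0 : 0 <= c := le_trans (normr_ge0 _) h1.
  apply: le_trans (ler_normD _ _) _; rewrite !normrM !(ger0_norm (_ : 0 <= t)) // ger0_norm ?subr_ge0 //.
  have := ler_wpM2l t0 h2; have t1' : 0 <= 1 - t by rewrite subr_ge0.
  by have := ler_wpM2l t1' h1; clear; lra.
have vtop x : `|x| <= rho0 -> 0 < v x rho0.
  move=> hx; have := vy x rho0 hx hrho; rewrite (gtr0_norm rho00) ler_norml => /andP[].
  by clear -hx rho00; lra.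
have vbot x : `|x| <= rho0 -> v x (- rho0) < 0.
  move=> hx; have := vy x _ hx hrhoN; rewrite (normrN rho0) (gtr0_norm rho00) ler_norml => /andP[].
  by clear -hx rho00; lra.
(* Everything above the curve v = 0 is joined vertically to the top edge of the box, then along that
   edge to its midpoint. *)
have up x y : `|x| <= rho0 -> `|y| <= rho0 -> 0 < v x y -> A (pt x y) <-> A (pt 0 rho0).
  move=> hx hy vp; apply: iff_trans (_ : A (pt x rho0) <-> _).
    apply: (seg_locc hA) => t t01; rewrite ptseg subrr mulr0 addr0.
    have hy' := cvx _ _ _ _ hy hrho t01; apply: vgood => //.
    rewrite gt_eqF //; have yr : 0 <= rho0 - y by move: hy; rewrite ler_norml => /andP[]; clear; lra.
    have tp : 0 <= t * (rho0 - y) by rewrite mulr_ge0 //; case/andP: t01.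
    have := @vv x y (y + t * (rho0 - y)) hx hy hy'; rewrite lerDl => /(_ tp); clear -tp vp; lra.
  apply: (seg_locc hA) => t t01; rewrite ptseg subrr mulr0 addr0.
  have hx' := cvx _ _ _ _ hx n0 t01; apply: vgood => //; rewrite gt_eqF //; exact: vtop.
have down x y : `|x| <= rho0 -> `|y| <= rho0 -> v x y < 0 -> A (pt x y) <-> A (pt 0 (- rho0)).
  move=> hx hy vp; apply: iff_trans (_ : A (pt x (- rho0)) <-> _).
    apply: (seg_locc hA) => t t01; rewrite ptseg subrr mulr0 addr0.
    have hy' := cvx _ _ _ _ hy hrhoN t01; apply: vgood => //.
    rewrite lt_eqF //; have yr : 0 <= y + rho0 by move: hy; rewrite ler_norml => /andP[]; clear; lra.
    have tp : 0 <= t * (y + rho0) by rewrite mulr_ge0 //; case/andP: t01.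
    have := @vv x (y + t * (- rho0 - y)) y hx hy' hy.
    have -> : y + t * (- rho0 - y) = y - t * (y + rho0) by ring.
    rewrite gerBl => /(_ tp); clear -tp vp; lra.
  apply: (seg_locc hA) => t t01; rewrite ptseg subrr mulr0 addr0.
  have hx' := cvx _ _ _ _ hx n0 t01; apply: vgood => //; rewrite lt_eqF //; exact: vbot.
have cpt x y y' : cn (pt x y' - pt x y) = `|y' - y| / cn a.
  by rewrite ptd subrr rmorph0 add0r !cnM cn_i cnV cn_real mul1r mulrC.
have mid x y : `|x| <= rho0 -> `|y| < rho0 -> v x y = 0 -> goodset W F (pt x y) ->
    (A (pt x y) <-> A (pt 0 rho0)) /\ (A (pt x y) <-> A (pt 0 (- rho0))).
  move=> hx hy v0 gp; have [d d0 hd] := hA _ gp.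
  pose q := Num.min (rho0 - `|y|) (d * cn a / 2).
  have q0 : 0 < q by rewrite lt_min subr_gt0 hy divr_gt0 // mulr_gt0.
  have q1 : q <= rho0 - `|y| by rewrite ge_min lexx.
  have q2 : q <= d * cn a / 2 by rewrite ge_min lexx orbT.
  clearbody q.
  have hy1 : `|y + q| <= rho0.
    by apply: le_trans (ler_normD _ _) _; rewrite (gtr0_norm q0); clear -q1; lra.
  have hy2 : `|y - q| <= rho0.
    by apply: le_trans (ler_normB _ _) _; rewrite (gtr0_norm q0); clear -q1; lra.
  have dq : q / cn a < d by rewrite ltr_pdivrMr //; have := mulr_gt0 d0 ca; clear -q2; lra.
  have yy1 : y <= y + q by rewrite lerDl ltW.
  have yy2 : y - q <= y by rewrite gerBl ltW.
  have v1 : 0 < v x (y + q) by have := @vv x y (y + q) hx (ltW hy) hy1 yy1; rewrite v0; clear -q0; lra.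
  have v2 : v x (y - q) < 0 by have := @vv x (y - q) y hx hy2 (ltW hy) yy2; rewrite v0; clear -q0; lra.
  split; apply: iff_trans; [apply: iff_sym; apply: (hd (pt x (y + q)))|exact: up|
    apply: iff_sym; apply: (hd (pt x (y - q)))|exact: down].
  - by apply: vgood; rewrite ?gt_eqF.
  - by rewrite cpt addrC addKr gtr0_norm.
  - by apply: vgood; rewrite ?lt_eqF.
  - by rewrite cpt addrC addKr normrN gtr0_norm.
(* [F] maps the curve v = 0 into a singular line, and its real part passes through the middle of a
   gap of [S]: this yields a good point on the curve. *)
have cross e : 0 < e <= rho0 -> exists x y, [/\ `|x| <= e / 2, `|y| <= e / 2, v x y = 0 & goodset W F (pt x y)].
  move=> /andP[e0 er]; have e4 : re (F z0) - e / 4 < re (F z0) + e / 4 by clear -e0; lra.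
  have [c [d [h1 h2 h3 hS]]] := gapS e4.
  have hm : `|(c + d) / 2 - re (F z0)| < e / 4.
    by clear -h1 h2 h3; rewrite ltr_norml; apply/andP; split; lra.
  have [x [y [hx hy vz ux]]] := graph_hits e0 er diff u00 v00 hm.
  exists x, y; split => //; split; first by apply: Wpt; clear -hx hy e0 er; lra.
  move=> [_ /(_ ((d - c) / 2))]; have dc : 0 < (d - c) / 2 by clear -h2; lra.
  move=> /(_ dc)[s Ss].
  have -> : re (F (pt x y)) = (c + d) / 2 by apply: (addIr (- re (F z0))); exact: ux.
  rewrite ltr_norml => /andP[q1 q2]; apply: (hS s) => //.
  by clear -q1 q2; apply/andP; split; lra.
have Apm : A (pt 0 rho0) <-> A (pt 0 (- rho0)).
  have rr : 0 < rho0 <= rho0 by rewrite rho00 lexx.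
  have [x [y [hx hy v0 gp]]] := cross rho0 rr.
  have hx' : `|x| <= rho0 by clear -hx rho00; lra.
  have hy' : `|y| < rho0 by clear -hy rho00; lra.
  have [m1 m2] := mid x y hx' hy' v0 gp; exact: iff_trans (iff_sym m1) m2.
exists (rho0 / cn a); first by rewrite divr_gt0.
split.
  exists (A (pt 0 rho0)) => w gw wd.
  pose x := re (a * (w - z0)); pose y := im (a * (w - z0)).
  have wE : w = pt x y by rewrite /pt -cnP mulKf // addrC subrK.
  have cw : cn (a * (w - z0)) < rho0 by rewrite cnM mulrC -ltr_pdivlMr.
  have hx : `|x| < rho0 := le_lt_trans (le_re_cn _) cw.
  have hy : `|y| < rho0 := le_lt_trans (le_im_cn _) cw.
  rewrite wE; have [vn|vp|v0] := ltgtP (v x y) 0.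
  - by apply: iff_trans (down x y (ltW hx) (ltW hy) vn) (iff_sym Apm).
  - exact: up (ltW hx) (ltW hy) vp.
  - by have [] := mid x y (ltW hx) hy v0; rewrite -?wE.
move=> e e0; pose e' := Num.min rho0 (e * cn a / 2).
have e'0 : 0 < e' by rewrite lt_min rho00 divr_gt0 // mulr_gt0.
have e'1 : e' <= rho0 by rewrite ge_min lexx.
have e'2 : e' <= e * cn a / 2 by rewrite ge_min lexx orbT.
have [|x [y [hx hy _ gp]]] := cross e'; first by rewrite e'0.
exists (pt x y) => //; rewrite ptz cnM cnV mulrC ltr_pdivrMr //.
by apply: le_lt_trans (cxy _ _) _; have := mulr_gt0 e0 ca; lra.
Qed.

(** As [F] is real on R, it cannot be constant with a bad value. If it is not constant, every point
    of [W], critical or not, has good points arbitrarily near and a neighbourhood whose good points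
    all agree on [A]; so [A] extends to a locally constant property of [W]. *)
Lemma remove_line W F : opn W -> preconn W -> (forall x, W (rc x)) ->
  (forall z, W z -> holo F z) -> (forall x, im (F (rc x)) = 0) ->
  [/\ opn (goodset W F), preconn (goodset W F) & forall x, goodset W F (rc x)].
Proof.
move=> oW cW RW hF rF; split; [exact: goodset_opn| |by move=> x; split => //; exact: real_good].
have [[z0 Wz0 [d d0 hd]]|nc] := pselect (exists2 z0, W z0 & exists2 d : R, 0 < d &
    forall z, cn (z - z0) <= d -> F z = F z0).
  have Fc : forall z, W z -> F z = F z0.
    move=> z Wz; apply/eqP; rewrite -subr_eq0; apply/eqP.
    apply: (identity_thm cW (f := fun z => F z - F z0) _ Wz0) => //.
      by move=> w Ww; apply: holoB; [exact: hF|exact: holo_cst].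
    by exists d => // w wd; rewrite hd ?subrr // ltW.
  have -> : goodset W F = W.
    apply/seteqP; split=> z; [by case|move=> Wz; split => //].
    by rewrite Fc // -(Fc _ (RW 0)); apply: real_good.
  exact: cW.
move=> A hA.
have near0 z : W z -> exists2 d, 0 < d &
   (exists P : Prop, forall w, goodset W F w -> cn (w - z) < d -> (A w <-> P)) /\
    (forall e, 0 < e -> exists2 w, goodset W F w & cn (w - z) < e).
  have reg w : W w -> (exists2 a, a != 0 & sder F w a) -> exists2 d, 0 < d &
     (exists P : Prop, forall w', goodset W F w' -> cn (w' - w) < d -> (A w' <-> P)) /\
    (forall e, 0 < e -> exists2 w', goodset W F w' & cn (w' - w) < e).
    move=> Ww hs; have [bw|gw] := pselect (bad (F w)); first exact: noncritical_locc hs hA.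
    have Gw : goodset W F w by [].
    have [d d0 hd] := hA w Gw; exists d => //; split; last first.
      by move=> e e0; exists w => //; rewrite subrr cn0.
    by exists (A w) => w' gw' ww; exact: hd.
  move=> Wz; have [[d d0 hd]|[d d0 hd]] := holo_sder (hF z Wz).
    by exfalso; apply: nc; exists z => //; exists d.
  have [dW dW0 hdW] := oW z Wz; pose r := Num.min d dW.
  have r0 : 0 < r by rewrite lt_min d0.
  have rd w : cn (w - z) < r -> cn (w - z) < d by rewrite lt_min => /andP[].
  have rW w : cn (w - z) < r -> W w by rewrite lt_min => /andP[_]; apply: hdW.
  have regp w : 0 < cn (w - z) < r -> exists2 d, 0 < d &
     (exists P : Prop, forall w', goodset W F w' -> cn (w' - w) < d -> (A w' <-> P)) /\
    (forall e, 0 < e -> exists2 w', goodset W F w' & cn (w' - w) < e).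
    by move=> /andP[w1 w2]; apply: reg; [exact: rW|apply: hd => //; exact: rd].
  (* Critical points are isolated, so the extension of [A] is locally constant on a punctured disc
     about [z], hence constant there. *)
  pose B := [set w | exists2 e : R, 0 < e & forall w', goodset W F w' -> cn (w' - w) < e -> A w'].
  have hB : locc [set w | 0 < cn (w - z) < r] B.
    move=> w /= /regp[e e0 [[P hP] dn]]; exists (e / 2) => [|w' hw' ww]; first by lra.
    have BP v : cn (v - w) < e / 2 -> (forall e, 0 < e -> exists2 w', goodset W F w' & cn (w' - v) < e) ->
        (B v <-> P).
      have tri x : cn (x - v) < e / 2 -> cn (v - w) < e / 2 -> cn (x - w) < e.
        by move=> h1 h2; rewrite -(subrK v x) -addrA (le_lt_trans (cnD _ _)) //; lra.
      move=> vw dv; split=> [[c c0 hc]|pP].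
        have [|x gx xv] := dv (Num.min c (e / 2)); first by rewrite lt_min c0; lra.
        move: xv; rewrite lt_min => /andP[xc xe]; apply/(hP x gx (tri _ xe vw)).
        exact: hc.
      exists (e / 2) => [|x gx xv]; first by lra.
      by apply/(hP x gx (tri _ xv vw)).
    have [e' e'0 [_ dn']] := regp w' hw'.
    apply: iff_trans (BP w' ww dn') (iff_sym (BP w _ dn)).
    by rewrite subrr cn0; lra.
  have BA w : goodset W F w -> (B w <-> A w).
    move=> gw; have [e e0 he] := hA w gw; split=> [[c c0 hc]|Aw].
      by apply: hc => //; rewrite subrr cn0.
    by exists e => // w' gw' ww; apply/(he w' gw' ww).
  have z1in : 0 < cn (z + rc (r / 2) - z) < r.
    by rewrite addrC addKr cn_real gtr0_norm; lra.
  have cP := @punctured_preconn _ z r B hB.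
  have [bz|gz] := pselect (bad (F z)); last first.
    have Gz : goodset W F z by [].
    have [e e0 he] := hA z Gz; exists e => //; split; first by exists (A z) => w gw wz; exact: he.
    by move=> c c0; exists z => //; rewrite subrr cn0.
  exists r => //; split.
    exists (B (z + rc (r / 2))) => w gw wr; apply: iff_trans (iff_sym (BA w gw)) _.
    have wp : 0 < cn (w - z) < r.
      rewrite wr andbT cn_gt0 subr_eq0; apply/eqP => wz; case: gw => _; rewrite wz => /(_ bz) //.
    by split; apply: cP.
  move=> e e0; pose x := Num.min (r / 2) (e / 2).
  have x0 : 0 < x by rewrite lt_min; lra.
  have x1 : x <= r / 2 by rewrite ge_min lexx.
  have x2 : x <= e / 2 by rewrite ge_min lexx orbT.
  have cx : cn (z + rc x - z) = x by rewrite addrC addKr cn_real gtr0_norm.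
  have [|c c0 [_ dn]] := regp (z + rc x); first by rewrite cx x0 /=; lra.
  have [|w gw wx] := dn (e / 2); first by lra.
  exists w => //; rewrite -(subrK (z + rc x) w) -addrA (le_lt_trans (cnD _ _)) // cx; lra.
(* The same extension of [A], now over all of [W]. *)
pose B := [set w | exists2 e : R, 0 < e & forall w', goodset W F w' -> cn (w' - w) < e -> A w'].
have hB : locc W B.
  move=> w Ww; have [e e0 [[P hP] dn]] := near0 w Ww; exists (e / 2) => [|w' Ww' ww]; first by lra.
  have BP v : cn (v - w) < e / 2 -> (forall e, 0 < e -> exists2 w', goodset W F w' & cn (w' - v) < e) ->
      (B v <-> P).
    have tri x : cn (x - v) < e / 2 -> cn (v - w) < e / 2 -> cn (x - w) < e.
      by move=> h1 h2; rewrite -(subrK v x) -addrA (le_lt_trans (cnD _ _)) //; lra.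
    move=> vw dv; split=> [[c c0 hc]|pP].
      have [|x gx xv] := dv (Num.min c (e / 2)); first by rewrite lt_min c0; lra.
      move: xv; rewrite lt_min => /andP[xc xe]; apply/(hP x gx (tri _ xe vw)).
      exact: hc.
    exists (e / 2) => [|x gx xv]; first by lra.
    by apply/(hP x gx (tri _ xv vw)).
  have [e' e'0 [_ dn']] := near0 w' Ww'.
  apply: iff_trans (BP w' ww dn') (iff_sym (BP w _ dn)).
  by rewrite subrr cn0; lra.
have BA w : goodset W F w -> (B w <-> A w).
  move=> gw; have [e e0 he] := hA w gw; split=> [[c c0 hc]|Aw].
    by apply: hc => //; rewrite subrr cn0.
  by exists e => // w' gw' ww; apply/(he w' gw' ww).
move=> z w gz gw /(BA z gz) Bz; apply/(BA w gw).
by apply: (cW B hB z w) => //; [case: gz|case: gw].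
Qed.

End Removal.

(** * The complex extension of sigma *)

Section RealBounds.
Variable R : realType.
Implicit Types x y : R.

Lemma mvt_sin x : exists2 c, `|c| <= `|x| & sin x = cos c * x.
Proof.
have pos y : 0 <= y -> exists2 c, `|c| <= `|y| & sin y = cos c * y.
  move=> y0; have cs : {within `[0, y], continuous (@sin R)}.
    by apply: continuous_subspaceT => t; exact: continuous_sin.
  have [c] := MVT_segment y0 (fun t _ => is_derive_sin t) cs.
  rewrite in_itv /= => /andP[c0 cy]; rewrite sin0 !subr0 => e.
  by exists c => //; rewrite !ger0_norm.
have [/pos//|x0] := leP 0 x.
have [c hc e] := pos (- x) (eqbRL (oppr_ge0 x) (ltW x0)).
exists c; first by rewrite -(normrN x).
by apply: oppr_inj; rewrite -sinN e; ring.
Qed.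

Lemma sin_abs_le x : `|sin x| <= `|x|.
Proof. by have [c _ ->] := mvt_sin x; rewrite normrM ler_piMl // cos_max. Qed.

Lemma cos_sub1_le x : `|cos x - 1| <= x ^+ 2.
Proof.
have -> : cos x - 1 = - (sin (x / 2) ^+ 2 * 2).
  by rewrite [x in cos x](_ : _ = (x / 2) *+ 2) ?cos_mulr2n ?sin2cos2; [ring|lra].
rewrite normrN normrM (ger0_norm (ler0n R 2)) normrX.
have h := sin_abs_le (x / 2); rewrite normrM (@ger0_norm _ 2^-1) // in h.
have := normr_ge0 (sin (x / 2)); rewrite -(real_normK (num_real x)).
move: (`|sin _|) (`|x|) h => s t h s0; nra.
Qed.

Lemma sin_sub_le x : `|x| <= 1 -> `|sin x - x| <= x ^+ 2.
Proof.
move=> x1; have [c hc ->] := mvt_sin x.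
have -> : cos c * x - x = (cos c - 1) * x by ring.
rewrite normrM; have := cos_sub1_le c; rewrite -(real_normK (num_real c)) -(real_normK (num_real x)).
have := normr_ge0 (cos c - 1); have := normr_ge0 c.
move: (`|cos _ - _|) (`|x|) (`|c|) hc x1 => s t u; nra.
Qed.

Lemma expR_sub_le x : `|x| <= 2^-1 -> 0 <= expR x - 1 - x <= 2 * x ^+ 2.
Proof.
move=> hx; have := expR_ge1Dx x; have := expR_ge1Dx (- x); rewrite expRN => h1 h2.
have [xl xu] := ler_normlP _ _ hx; have e0 := expR_gt0 x.
apply/andP; split; first by lra.
have h3 : (1 - x) * expR x <= 1.
  by rewrite -ler_pdivlMr // div1r.
nra.
Qed.

End RealBounds.

(** * The complex exponential and the hyperbolic tangent *)

Section Cexp.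
Variable R : realType.
Local Notation C := R[i].
Implicit Types (z w h : C) (x y r : R).

Definition cexp z : C := rc (expR (re z)) * (rc (cos (im z)) + 'i%C * rc (sin (im z))).

Lemma re_cexp z : re (cexp z) = expR (re z) * cos (im z).
Proof. by rewrite /cexp !reimE; ring. Qed.
Lemma im_cexp z : im (cexp z) = expR (re z) * sin (im z).
Proof. by rewrite /cexp !reimE; ring. Qed.

Lemma cexpD z w : cexp (z + w) = cexp z * cexp w.
Proof.
by apply: cplx_ext; rewrite ?(re_cexp, im_cexp, reimE) expRD ?cosD ?sinD; ring.
Qed.

Lemma cexp0 : cexp 0 = 1.
Proof. by apply: cplx_ext; rewrite ?(re_cexp, im_cexp, reimE) expR0 ?cos0 ?sin0 mul1r. Qed.

Lemma cn_cexp z : cn (cexp z) = expR (re z).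
Proof.
rewrite cnE re_cexp im_cexp !exprMn -mulrDr cos2Dsin2 mulr1 sqrtr_sqr ger0_norm // expR_ge0.
Qed.

Lemma cexp_neq0 z : cexp z != 0.
Proof. by rewrite -cn_gt0 cn_cexp expR_gt0. Qed.

Lemma cexpN z : cexp (- z) = (cexp z)^-1.
Proof.
apply: (mulfI (cexp_neq0 z)); rewrite mulfV ?cexp_neq0 // -cexpD subrr; exact: cexp0.
Qed.

Lemma cexpMn z n : cexp (z *+ n) = cexp z ^+ n.
Proof. by elim: n => [|n IH]; rewrite ?mulr0n ?cexp0 // mulrS exprS cexpD IH. Qed.

Lemma cexp_rc x : cexp (rc x) = rc (expR x).
Proof. by apply: cplx_ext; rewrite ?(re_cexp, im_cexp, reimE) ?cos0 ?sin0; ring. Qed.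

Lemma cexp_bound h : cn h <= 2^-1 -> cn (cexp h - 1 - h) <= 12 * cn h ^+ 2.
Proof.
move=> hh; have hx := le_trans (le_re_cn h) hh; have hy := le_trans (le_im_cn h) hh.
have /andP[e1 e2] := expR_sub_le hx.
have c1 := cos_sub1_le (im h).
have s1 : `|sin (im h) - im h| <= im h ^+ 2 by apply: sin_sub_le; lra.
apply: le_trans (le_cn_reim _) _; rewrite !(reD, imD, reN, imN) re_cexp im_cexp re1 im1 oppr0 addr0.
rewrite -(real_normK (num_real (re h))) in e2.
rewrite -(real_normK (num_real (im h))) in c1 s1.
have cx := le_re_cn h; have cy := le_im_cn h.
have n1 := normr_ge0 (re h); have n2 := normr_ge0 (im h).
have cm := cos_max (im h); have sm := sin_abs_le (im h).
set X := re h in e1 e2 hx hy n1 n2 cx *; set Y := im h in n2 cy c1 s1 hy cm sm *.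
set E := expR X in e1 e2 *.
have h1 : `|E * cos Y - 1 - X| <= 2 * `|X| ^+ 2 + 2 * `|Y| ^+ 2.
  have -> : E * cos Y - 1 - X = (E - 1 - X) * cos Y + (1 + X) * (cos Y - 1) by ring.
  apply: le_trans (ler_normD _ _) _; rewrite !normrM (ger0_norm e1).
  apply: lerD; first by apply: le_trans e2; rewrite ler_piMr.
  apply: ler_pM => //; apply: le_trans (ler_normD _ _) _; rewrite normr1; lra.
have h2 : `|E * sin Y - Y| <= 2 * `|X| * `|Y| + `|Y| ^+ 2.
  have -> : E * sin Y - Y = (E - 1) * sin Y + (sin Y - Y) by ring.
  apply: le_trans (ler_normD _ _) _; rewrite !normrM; apply: lerD => //.
  apply: ler_pM => //; have -> : E - 1 = (E - 1 - X) + X by ring.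
  apply: le_trans (ler_normD _ _) _; rewrite (ger0_norm e1); nra.
apply: le_trans (lerD h1 h2) _.
move: (`|X|) (`|Y|) (cn h) n1 n2 cx cy; clear => a b c a0 b0 ac bc.
have : a * b <= c ^+ 2 by rewrite expr2; apply: ler_pM.
have : a ^+ 2 <= c ^+ 2 by rewrite !expr2; apply: ler_pM.
have : b ^+ 2 <= c ^+ 2 by rewrite !expr2; apply: ler_pM.
nra.
Qed.

Lemma cexp_lip h : cn h <= 2^-1 -> cn (cexp h - 1) <= 7 * cn h.
Proof.
move=> hh; have -> : cexp h - 1 = (cexp h - 1 - h) + h by ring.
apply: le_trans (cnD _ _) _; have := cexp_bound hh; have := cn_ge0 h; nra.
Qed.

Lemma cn_subX (a b : C) (m : R) n : cn a <= m -> cn b <= m ->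
  cn (a ^+ n - b ^+ n) <= n%:R * cn (a - b) * m ^+ n.-1.
Proof.
move=> am bm; have m0 : 0 <= m by apply: le_trans am; exact: cn_ge0.
rewrite subrXX cnM mulrAC mulrC; apply: ler_wpM2r; first exact: cn_ge0.
apply: le_trans (sum_cn_le (G := fun=> m ^+ n.-1) _ _) _; last first.
  by rewrite sumr_const card_ord mulr_natl.
move=> i _; rewrite cnM !cnX.
have -> : m ^+ n.-1 = m ^+ (n.-1 - i) * m ^+ i.
  by rewrite -exprD subnK //; case: i => i /= hi; case: n hi {am bm}.
by apply: ler_pM; rewrite ?exprn_ge0 ?cn_ge0 // lerXn2r ?nnegrE ?cn_ge0.
Qed.

(* (1 + z / n) ^ n converges to cexp z uniformly on discs. *)
Lemma appr_cexp z0 r : appr cexp z0 r.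
Proof.
apply: appr_unif => e e0; set q := `|r| + cn z0 + 1.
have q1 : 1 <= q by have := normr_ge0 r; have := cn_ge0 z0; rewrite /q; lra.
have q0 : 0 < q by lra.
set K := 12 * q ^+ 2 * expR q.
have K0 : 0 < K by rewrite !mulr_gt0 ?exprn_gt0 ?expR_gt0.
(* The summand [2 * q] makes z / m at most 1/2 in modulus, as [cexp_bound] requires; [K / e] makes
   the total error [K / m] at most [e]. *)
pose m := (Num.truncn (K / e + 2 * q)).+1.
have hm : K / e + 2 * q < m%:R by apply: truncnS_gt.
have m0 : 0 < m%:R :> R by rewrite ltr0n.
have Ke : 0 < K / e by rewrite divr_gt0.
exists (fun z => (1 + z / m%:R) ^+ m).
  by apply/apprX/apprD; [exact: appr_cst|apply: apprM; [exact: appr_id|exact: appr_cst]].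
move=> z zr; have zq : cn z <= q.
  rewrite -(subrK z0 z); apply: le_trans (cnD _ _) _; have := ler_norm r; rewrite /q; lra.
have mC : (m%:R : C) != 0 by rewrite pnatr_eq0.
set h := z / m%:R; have ch : cn h = cn z / m%:R by rewrite cnM cnV cn_nat.
have hz : cexp z = cexp h ^+ m by rewrite -cexpMn -mulr_natr mulfVK.
have hq : cn h <= q / m%:R by rewrite ch ler_pM2r ?invr_gt0.
have hh : cn h <= 2^-1.
  by apply: le_trans hq _; rewrite ler_pdivrMr //; lra.
rewrite hz; apply: le_trans (@cn_subX _ _ (expR (q / m%:R)) _ _ _) _.
- by rewrite cn_cexp ler_expR (le_trans (ler_norm _)) // (le_trans (le_re_cn _)).
- apply: le_trans (cnD _ _) _; rewrite cn1; apply: le_trans (expR_ge1Dx _); lra.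
have -> : cexp h - (1 + h) = cexp h - 1 - h by ring.
have b1 := cexp_bound hh.
have b2 : expR (q / m%:R) ^+ m.-1 <= expR q.
  apply: (@le_trans _ _ (expR (q / m%:R) ^+ m)); last by rewrite -expRM_natr divfK ?gt_eqF.
  by apply: ler_weXn2l; rewrite ?leq_pred // -expR0 ler_expR divr_ge0 // ltW.
have b3 : cn h ^+ 2 <= (q / m%:R) ^+ 2 by rewrite lerXn2r ?nnegrE ?cn_ge0 ?divr_ge0 // ltW.
apply: (@le_trans _ _ (m%:R * (12 * (q / m%:R) ^+ 2) * expR q)).
  apply: ler_pM => //; rewrite ?mulr_ge0 ?cn_ge0 ?exprn_ge0 ?expR_ge0 //.
  by rewrite ler_pM2l //; apply: le_trans b1 _; rewrite ler_pM2l.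
have -> : m%:R * (12 * (q / m%:R) ^+ 2) * expR q = K / m%:R.
  by rewrite /K; field; rewrite gt_eqF.
rewrite ler_pdivrMr // mulrC -ler_pdivrMr //; lra.
Qed.

Lemma rc_nat n : rc n%:R = n%:R :> C. Proof. exact: rmorph_nat. Qed.
Lemma rc_half : rc 2^-1 = 2^-1 :> C. Proof. by rewrite rcV (rc_nat 2). Qed.

(** With this scaling [i] is a period, and the poles of tanh (pi z) are the solutions of ce z =
    -1. *)
Definition ce z := cexp (rc (2 * pi) * z).

Lemma ceD z w : ce (z + w) = ce z * ce w.
Proof. by rewrite /ce mulrDr cexpD. Qed.

Lemma ce0 : ce 0 = 1. Proof. by rewrite /ce mulr0 cexp0. Qed.

Lemma ce_neq0 z : ce z != 0. Proof. exact: cexp_neq0. Qed.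

Lemma ceN z : ce (- z) = (ce z)^-1. Proof. by rewrite /ce mulrN cexpN. Qed.

Lemma ce_ihalf : ce ('i%C / 2) = -1.
Proof.
have hi : re ('i%C / 2 : C) = 0 /\ im ('i%C / 2 : C) = 2^-1.
  have -> : ('i%C / 2 : C) = 'i%C * rc 2^-1 by rewrite rc_half.
  by rewrite !reimE; split; ring.
move: ('i%C / 2) hi => t [h1 h2]; apply: cplx_ext; rewrite /ce ?re_cexp ?im_cexp !(reM, imM) h1 h2 !reimE.
  have -> : 2 * pi * 2^-1 + 0 * 0 = pi :> R by field.
  by have -> : 2 * pi * 0 - 0 * 2^-1 = 0 :> R by [ring]; rewrite expR0 cospi mul1r.
have -> : 2 * pi * 2^-1 + 0 * 0 = pi :> R by field.
by rewrite sinpi mulr0 oppr0.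
Qed.

Lemma ce_i : ce 'i%C = 1.
Proof.
have -> : 'i%C = 'i%C / 2 + 'i%C / 2 :> C by field.
by rewrite ceD ce_ihalf mulrNN mulr1.
Qed.

Lemma appr_ce z0 r : appr ce z0 r.
Proof.
apply: (appr_comp (g := cexp) (w0 := rc (2 * pi) * z0) (rho := cn (rc (2 * pi) : C) * r)).
- by apply: apprZ; exact: appr_id.
- exact: appr_cexp.
- by move=> z zr; rewrite -mulrBr cnM ler_pM2l // cn_gt0 rc_eq0 gt_eqF // mulr_gt0 ?pi_gt0.
Qed.

Lemma pi_le4 : (pi : R) <= 4.
Proof. have := @pihalf_lt2 R; lra. Qed.

Lemma ce_lip h : cn h <= 16^-1 -> cn (ce h - 1) <= 56 * cn h.
Proof.
move=> hh; have p4 := pi_le4; have p0 := @pi_gt0 R; have h0 := cn_ge0 h.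
have e : cn (rc (2 * pi) * h) = 2 * pi * cn h.
  by rewrite cnM cn_real ger0_norm // mulr_ge0 // ltW.
apply: le_trans (cexp_lip _) _; rewrite e; nra.
Qed.

(* [th z] is tanh (pi z) and [ct z] is coth (pi z). *)
Definition th z := (ce z - 1) / (ce z + 1).
Definition ct z := th (z + 'i%C / 2).

Lemma th_period z : th (z + 'i%C) = th z.
Proof. by rewrite /th ceD ce_i mulr1. Qed.

Lemma ctE z : ct z = (ce z + 1) / (ce z - 1).
Proof.
rewrite /ct /th ceD ce_ihalf mulrN1 -[X in X / _]opprK -[X in _ / X]opprK invrN mulrNN.
by rewrite !opprD !opprK.
Qed.

Lemma th_rc x : th (rc x) = rc (tanh (pi * x)).
Proof.
rewrite /th /ce -rcM cexp_rc -(rmorph1 (@real_complex R)) -rcB -rcD -rcV -rcM; congr (rc _).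
rewrite /tanh (_ : 2 * pi * x = pi * x + pi * x); last by ring.
have p0 := expR_gt0 (pi * x); set a := expR (pi * x) in p0 *.
rewrite expRN -/a expRD -/a; field; rewrite ?gt_eqF //; nra.
Qed.

(* With E = ce z: |E + 1|^2 = (1 + e^X)^2 cos^2 + (1 - e^X)^2 sin^2 at half the angle. *)
Lemma ce1_bound z : (1 + cn (ce z)) * `|cos (pi * im z)| <= cn (ce z + 1).
Proof.
have p0 := expR_gt0 (2 * pi * re z).
have ceE : cn (ce z) = expR (2 * pi * re z) by rewrite /ce cn_cexp !reimE mul0r subr0.
rewrite ceE [leRHS]cnE reD imD re1 im1 /ce re_cexp im_cexp !reimE !mul0r subr0 !addr0.
set X := expR _ in p0 *.
rewrite -[leLHS]ger0_norm ?mulr_ge0 //; last by lra.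
rewrite -sqrtr_sqr ler_wsqrtr // exprMn real_normK ?num_real //.
have -> : 2 * pi * im z = (pi * im z) *+ 2 by rewrite -mulr_natl; ring.
rewrite cos_mulr2n sin_mulr2n; have := cos2Dsin2 (pi * im z).
set c := cos _; set s := sin _ => e.
have -> : (X * (c ^+ 2 *+ 2 - 1) + 1) ^+ 2 + (X * (c * s *+ 2)) ^+ 2 =
  (1 + X) ^+ 2 * c ^+ 2 + (1 - X) ^+ 2 * s ^+ 2 +
   (4 * X ^+ 2 * c ^+ 2 - (1 - X) ^+ 2) * (c ^+ 2 + s ^+ 2 - 1).
  ring.
by rewrite e subrr mulr0 addr0 lerDl mulr_ge0 // sqr_ge0.
Qed.

End Cexp.

(** * Unconditional sums of complex families over the reals *)

Section Csum.
Variable R : realType.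
Local Notation C := R[i].
Implicit Types (z w h : C) (x y r : R) (f g : R -> C) (A B : seq R).

(* Unconditional summation over R: convergence along finite sets of reals. *)
Definition is_csum f l := forall e, 0 < e -> exists A0, forall A, uniq A ->
  {subset A0 <= A} -> cn (\sum_(x <- A) f x - l) <= e.

Definition smb (g : R -> R) := exists M, forall A, uniq A -> \sum_(x <- A) g x <= M.

Lemma csum_uniq f l l' : is_csum f l -> is_csum f l' -> l = l'.
Proof.
move=> h h'; apply/eqP; rewrite -subr_eq0; apply/eqP.
apply: (@cn_small0 _ _ 2) => e e0.
have [A hA] := h e e0; have [B hB] := h' e e0.
have s1 : {subset A <= undup (A ++ B)} by move=> x; rewrite mem_undup mem_cat => ->.
have s2 : {subset B <= undup (A ++ B)} by move=> x; rewrite mem_undup mem_cat orbC => ->.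
have := hA _ (undup_uniq _) s1; have := hB _ (undup_uniq _) s2.
set t := \sum_(x <- _) _ => b1 b2.
have -> : l - l' = (t - l') - (t - l) by ring.
apply: le_trans (cnB _ _) _; lra.
Qed.

Lemma csumD f g l l' : is_csum f l -> is_csum g l' -> is_csum (fun x => f x + g x) (l + l').
Proof.
move=> h h' e e0; have e2 : 0 < e / 2 by lra.
have [A hA] := h _ e2; have [B hB] := h' _ e2.
exists (A ++ B) => D uD sD.
have b1 := hA D uD (fun x xA => sD x (etrans (mem_cat _ _ _) (introT orP (or_introl xA)))).
have b2 := hB D uD (fun x xA => sD x (etrans (mem_cat _ _ _) (introT orP (or_intror xA)))).
have -> : \sum_(x <- D) (f x + g x) - (l + l') = (\sum_(x <- D) f x - l) + (\sum_(x <- D) g x - l').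
  by rewrite big_split /=; ring.
apply: le_trans (cnD _ _) _; lra.
Qed.

Lemma csum_ext f g l : f =1 g -> is_csum f l -> is_csum g l.
Proof.
move=> e h d /h[A hA]; exists A => B uB sB; rewrite -(eq_bigr _ (fun x _ => e x)); exact: hA.
Qed.

Lemma csumZ c f l : is_csum f l -> is_csum (fun x => c * f x) (c * l).
Proof.
move=> h e e0; have K0 : 0 < cn c + 1 by have := cn_ge0 c; lra.
have [A hA] := h _ (divr_gt0 e0 K0); exists A => B uB sB.
rewrite -mulr_sumr -mulrBr cnM; apply: le_trans (ler_wpM2l (cn_ge0 _) (hA B uB sB)) _.
by rewrite mulrA ler_pdivrMr //; have := cn_ge0 c; nra.
Qed.

Lemma csum0 : is_csum (fun=> 0) 0.
Proof. by move=> e e0; exists [::] => A _ _; rewrite big1 // subrr cn0 ltW. Qed.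

Lemma csum_sum (I : Type) (s : seq I) (P : pred I) (f : I -> R -> C) (l : I -> C) :
  (forall i, P i -> is_csum (f i) (l i)) ->
  is_csum (fun x => \sum_(i <- s | P i) f i x) (\sum_(i <- s | P i) l i).
Proof.
move=> h; elim: s => [|i s IH].
  by rewrite big_nil; apply: csum_ext csum0 => x; rewrite big_nil.
rewrite big_cons; case: ifP => Pi; last by apply: csum_ext IH => x; rewrite big_cons Pi.
by apply: csum_ext (csumD (h i Pi) IH) => x; rewrite big_cons Pi.
Qed.

Lemma csum_reindex (phi psi : R -> R) f l : cancel phi psi -> cancel psi phi ->
  is_csum f l -> is_csum (fun x => f (phi x)) l.
Proof.
move=> k1 k2 h e /h[A hA]; exists [seq psi x | x <- A] => B uB sB.
have := hA [seq phi x | x <- B]; rewrite big_map map_inj_uniq; last exact: can_inj k1.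
apply=> // x xA; apply/mapP; exists (psi x) => //; apply: sB; exact: map_f.
Qed.

Lemma csum_single p c : is_csum (fun x => if x == p then c else 0) c.
Proof.
move=> e e0; exists [:: p] => A uA sA; have pA : p \in A by apply: sA; rewrite inE.
by rewrite (bigD1_seq p) //= eqxx big1 ?addr0 ?subrr ?cn0 ?ltW // => x /negPf ->.
Qed.

Lemma sum_sub_split (V : nmodType) (F : R -> V) A B : uniq A -> uniq B -> {subset A <= B} ->
  \sum_(x <- B) F x = \sum_(x <- A) F x + \sum_(x <- B | x \notin A) F x.
Proof.
move=> uA uB sAB; rewrite -[X in _ + X]big_filter -big_cat /=; apply: perm_big.
apply: uniq_perm => //.
  rewrite cat_uniq uA filter_uniq // andbT /=; apply/hasPn => x.
  by rewrite mem_filter => /andP[].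
by move=> x; rewrite mem_cat mem_filter; case xA : (x \in A) => //=; exact: sAB.
Qed.

Lemma rsum_ex (g : R -> R) : (forall x, 0 <= g x) -> smb g -> exists2 l,
  is_csum (fun x => rc (g x)) (rc l) & forall A, uniq A -> \sum_(x <- A) g x <= l.
Proof.
move=> g0 [M hM]; pose X := [set t | exists2 A, uniq A & t = \sum_(x <- A) g x].
have hs : has_sup X.
  split; first by exists (\sum_(x <- [::]) g x), [::].
  by exists M => t [A uA ->]; exact: hM.
exists (sup X) => [|A uA]; last by apply: ub_le_sup; [case: hs|exists A].
move=> e e0; have [t [A uA ->] hA] := sup_adherent e0 hs.
exists A => B uB sB; rewrite -rc_sum -rcB cn_real.
have le1 : \sum_(x <- B) g x <= sup X by apply: ub_le_sup; [case: hs|exists B].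
have le2 : \sum_(x <- A) g x <= \sum_(x <- B) g x.
  by rewrite (sum_sub_split _ uA uB sB) lerDl sumr_ge0.
by rewrite ler_norml; apply/andP; split; lra.
Qed.

Lemma smb_le (g g' : R -> R) K : (forall x, g' x <= K * g x) -> 0 <= K -> smb g -> smb g'.
Proof.
move=> h K0 [M hM]; exists (K * M) => A uA; apply: le_trans (ler_wpM2l K0 (hM A uA)).
by rewrite mulr_sumr; apply: ler_sum => x _.
Qed.

(** Reduction to non-negative families by writing [f] as [f + g] minus [g]. *)
Lemma csum_ex_real (g f : R -> R) : (forall x, `|f x| <= g x) -> smb g ->
  exists l, is_csum (fun x => rc (f x)) (rc l).
Proof.
move=> fg sg; have g0 x : 0 <= g x by apply: le_trans (fg x).
have [l hl _] := rsum_ex g0 sg.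
have [||l' hl' _] := @rsum_ex (fun x => f x + g x).
- by move=> x; have := fg x; rewrite ler_norml => /andP[]; lra.
- apply: (smb_le (K := 2)) sg => // x; have := fg x; rewrite ler_norml => /andP[]; lra.
exists (l' - l); rewrite rcB -mulN1r.
by apply: csum_ext (csumD hl' (csumZ (-1) hl)) => x; rewrite rcD; ring.
Qed.

Lemma csum_ex (g : R -> R) f K : (forall x, cn (f x) <= K * g x) -> 0 <= K -> smb g ->
  exists l, is_csum f l.
Proof.
move=> fg K0 /(smb_le (fun x => lexx _) K0) sg.
have [a ha] := @csum_ex_real _ (fun x => re (f x)) (fun x => le_trans (le_re_cn _) (fg x)) sg.
have [b hb] := @csum_ex_real _ (fun x => im (f x)) (fun x => le_trans (le_im_cn _) (fg x)) sg.
exists (rc a + 'i%C * rc b); apply: csum_ext (csumD ha (csumZ 'i%C hb)) => x.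
by rewrite -cnP.
Qed.

Lemma csum_bound (g : R -> R) f l K M : (forall x, cn (f x) <= K * g x) -> 0 <= K ->
  (forall A, uniq A -> \sum_(x <- A) g x <= M) -> is_csum f l -> cn l <= K * M.
Proof.
move=> fg K0 hM h; apply/ler_addgt0Pr => e /h[A hA].
have := hA (undup A) (undup_uniq _) (fun x => etrans (mem_undup A x)).
set t := \sum_(x <- _) _ => b.
have b2 : cn t <= K * M.
  apply: le_trans (sum_cn_le _ (fun x _ => fg x)) _.
  by rewrite -mulr_sumr ler_wpM2l // hM // undup_uniq.
have -> : l = t - (t - l) by ring.
apply: le_trans (cnB _ _) _; lra.
Qed.

(** The Weierstrass M-test: a finite set carrying the majorant [g] up to [e / (K + 1)] gives a
    finite sum uniformly close to [F]. Where [g] vanishes the term is 0, so analyticity is asked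
    only elsewhere. *)
Lemma appr_csum (g : R -> R) (f : C -> R -> C) (F : C -> C) z0 r K :
  (forall x, 0 <= g x) -> smb g -> 0 <= K ->
  (forall z x, cn (z - z0) <= r -> cn (f z x) <= K * g x) ->
  (forall x, g x != 0 -> appr (f ^~ x) z0 r) ->
  (forall z, cn (z - z0) <= r -> is_csum (f z) (F z)) -> appr F z0 r.
Proof.
move=> g0 sg K0 fg ha hF; apply: appr_unif => e e0.
have [l hl lb] := rsum_ex g0 sg; have K1 : 0 < K + 1 by lra.
have [A hA] := hl _ (divr_gt0 e0 K1).
have {}hA : forall B, uniq B -> {subset undup A <= B} -> \sum_(x <- B | x \notin A) g x <= e / (K + 1).
  move=> B uB sB; have uA := undup_uniq A.
  have := hA _ uA (fun x => etrans (mem_undup A x)).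
  rewrite -rc_sum -rcB cn_real ler_norml => /andP[h1 _].
  have := lb _ uB; rewrite (sum_sub_split _ uA uB sB).
  rewrite [X in _ + X <= _ -> _](eq_bigl (fun x => x \notin A)); first by lra.
  by move=> x; rewrite mem_undup.
exists (fun z => \sum_(x <- undup A) f z x).
  apply: appr_sum => x _; have [gx|/ha//] := eqVneq (g x) 0.
  apply: appr_ext (appr_cst 0 _ _) => z zr; have := fg z x zr; rewrite gx mulr0 => h.
  by apply/esym/eqP; rewrite -cn_eq0 eq_le cn_ge0 h.
move=> z zr; apply/ler_addgt0Pr => d /(hF z zr)[B hB].
set D := undup (A ++ B).
have sA : {subset undup A <= D} by move=> x; rewrite !mem_undup mem_cat => ->.
have sB : {subset B <= D} by move=> x; rewrite !mem_undup mem_cat orbC => ->.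
have uD : uniq D by exact: undup_uniq.
have b1 := hB D uD sB.
have -> : F z - \sum_(x <- undup A) f z x =
  (\sum_(x <- D) f z x - \sum_(x <- undup A) f z x) - (\sum_(x <- D) f z x - F z) by ring.
apply: le_trans (cnB _ _) _; apply: lerD b1.
rewrite (sum_sub_split _ (undup_uniq A) uD sA) addrC addKr.
rewrite (eq_bigl (fun x => x \notin A)); last by move=> x; rewrite mem_undup.
apply: le_trans (sum_cn_le _ (fun x _ => fg z x zr)) _.
rewrite -mulr_sumr; apply: le_trans (ler_wpM2l K0 (hA D uD sA)) _.
by rewrite mulrA ler_pdivrMr //; nra.
Qed.

End Csum.

(** * The i-periodic extension of sigma and its domain of analyticity *)

Section Csig.
Variables (R : realType) (C0 : R) (S : set R) (c : R -> R).
Local Notation C := R[i].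
Implicit Types (z w h : C) (x y r m : R) (A B : seq R).
Hypothesis hc1 : summable S (EFin \o c).

Definition ctil x : R := if `[< S x >] then c x else 0.

Lemma fin_esum (h : R -> R) A : uniq A ->
  ((\sum_(x <- A | `[< S x >]) h x)%:E <= \esum_(x in S) (h x)%:E)%E.
Proof.
move=> uA; apply: esum_ge; exists [set` [seq x <- A | `[< S x >]]].
  split; first exact: finite_seq.
  by move=> x /=; rewrite mem_filter => /andP[/asboolP].
by rewrite -fsbig_seq ?filter_uniq // sumEFin big_filter.
Qed.

Lemma esum_ctil (h : R -> R) : (forall x, S x -> 0 <= h x) ->
  smb (fun x => if `[< S x >] then h x else 0) ->
  exists2 l, \esum_(x in S) (h x)%:E = l%:E &
   is_csum (fun x => rc (if `[< S x >] then h x else 0)) (rc l).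
Proof.
move=> h0 sh; have [|l hl lb] := rsum_ex _ sh.
  by move=> x; case: ifP => // /asboolP/h0.
have lb' A : uniq A -> \sum_(x <- A | `[< S x >]) h x <= l.
  by move=> /lb; rewrite -big_mkcond.
exists l => //; apply/le_anti/andP; split.
  apply: ge_ereal_sup => _ [X [fX XS] <-].
  rewrite fsbig_finite //= sumEFin lee_fin.
  have := lb' (fset_set X) (fset_uniq _); rewrite big_seq_cond [in X in _ -> X]big_seq.
  rewrite (eq_bigl (fun x => x \in fset_set X)) // => x.
  case xX : (x \in fset_set X) => //=; apply/asboolP/XS.
  by move: xX; rewrite in_fset_set // => /set_mem.
apply/lee_addgt0Pr => e e0; have [A hA] := hl e e0.
have := hA _ (undup_uniq A) (fun x => etrans (mem_undup A x)).
rewrite -rc_sum -rcB cn_real ler_norml => /andP[+ _]; rewrite -big_mkcond /= => b.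
apply: (@le_trans _ _ ((\sum_(x <- undup A | `[< S x >]) h x)%:E + e%:E)%E).
  by rewrite -EFinD lee_fin; lra.
by rewrite leeD2r // fin_esum // undup_uniq.
Qed.

Lemma smb_ctil : smb (fun x => `|ctil x|).
Proof.
have f : (\esum_(x in S) (`|c x|)%:E \is a fin_num)%E.
  by rewrite ge0_fin_numE //; apply: esum_ge0 => x _.
exists (fine (\esum_(x in S) (`|c x|)%:E)%E) => A uA.
rewrite -lee_fin fineK //; apply: le_trans (fin_esum _ uA).
rewrite lee_fin [leRHS]big_mkcond /=; apply: ler_sum => x _.
by rewrite /ctil; case: ifP; rewrite ?normr0.
Qed.

(** Links the sum by positive and negative parts, in which sigma is given, to sums along finite
    sets; both parts are dominated by the absolute values of [c]. *)
Lemma rsum_csum (f : R -> R) : (forall s, S s -> `|f s| <= `|c s|) ->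
  is_csum (fun x => rc (if `[< S x >] then f x else 0)) (rc (rsum S f)).
Proof.
move=> fc.
have sm (g : R -> R) : (forall s, S s -> `|g s| <= `|f s|) ->
    smb (fun x => if `[< S x >] then g x else 0).
  move=> gf; apply: (smb_le (K := 1)) smb_ctil => // x; rewrite mul1r /ctil.
  by case: ifP => [/asboolP Sx|_]; rewrite ?normr0 // (le_trans (ler_norm _)) // (le_trans (gf _ Sx)) // fc.
have [||a ea ha] := @esum_ctil (fun x => Num.max (f x) 0).
- by move=> x _; rewrite le_max lexx orbT.
- by apply: sm => s _; case: (leP (f s) 0); rewrite ?normr0.
have [||b eb hb] := @esum_ctil (fun x => Num.max (- f x) 0).
- by move=> x _; rewrite le_max lexx orbT.
- by apply: sm => s _; case: (leP (- f s) 0); rewrite ?normr0 ?normrN.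
have -> : rsum S f = a - b.
  rewrite /rsum -[a - b]/(fine (a - b)%:E) EFinB -ea -eb; congr (fine (_ - _)%E).
    by apply: eq_esum => x _; rewrite funeposE EFin_max.
  by apply: eq_esum => x _; rewrite funenegE EFin_max.
rewrite rcB -mulN1r; apply: csum_ext (csumD ha (csumZ (-1) hb)) => x.
rewrite mulN1r -rcB; congr (rc _); case: ifP => _; last by rewrite subr0.
by case: (leP (f x) 0); case: (leP (- f x) 0); lra.
Qed.

(** [xget] returns 0 where the series does not converge, so the function is total and i-periodic
    without side condition. *)
Definition csig z : C := rc C0 + xget 0 (is_csum (fun s => rc (ctil s) * th (z - rc s))).

Lemma csig_val z l : is_csum (fun s => rc (ctil s) * th (z - rc s)) l -> csig z = rc C0 + l.
Proof.
by move=> h; rewrite /csig; case: xgetP => [_ -> /(csum_uniq h) ->//|/(_ l)].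
Qed.

Lemma csig_period z : csig (z + 'i%C) = csig z.
Proof.
rewrite /csig; congr (_ + xget 0 (is_csum _)); apply/funext => s.
by rewrite -(th_period (z - rc s)) addrAC.
Qed.

Lemma csig_int z (k : int) : csig (z + 'i%C * rc k%:~R) = csig z.
Proof.
have nat n : forall z, csig (z + 'i%C * rc n%:R) = csig z.
  elim: n => [|n IH] z1; first by rewrite mulr0 addr0.
  by rewrite -natr1 rcD mulrDr mulr1 addrA csig_period IH.
case: k => n; first exact: nat.
by rewrite NegzE intrN rcN mulrN -[in RHS](subrK ('i%C * rc (n.+1%:R)) z) nat.
Qed.

Lemma th1 z : ce z + 1 != 0 -> th z = 1 - 2 / (ce z + 1).
Proof. by move=> h; rewrite /th; field. Qed.

(** For E = ce z0 the two lower bounds together say that E + 1 has modulus at least m max (1, |E|),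
    which keeps the estimate uniform as Re z0 tends to either infinity. The radius is [m / 4]
    divided by the Lipschitz constant 56 of [ce_lip]. *)
Lemma th_appr z0 m : 0 < m -> m <= 1 -> m <= cn (ce z0 + 1) -> m <= cn ((ce z0)^-1 + 1) ->
  appr (@th R) z0 (m / 224) /\ forall z, cn (z - z0) <= m / 224 -> cn (th z) <= 1 + 4 / m.
Proof.
move=> m0 m1 h1 h2; set a := ce z0 + 1 in h1 *.
have ca : 0 < cn a by lra.
have a0 : a != 0 by rewrite -cn_gt0.
have hd z : cn (z - z0) <= m / 224 -> cn (ce z + 1 - a) <= cn a / 4.
  move=> zr; have -> : ce z + 1 - a = ce z0 * (ce (z - z0) - 1).
    by rewrite mulrBr mulr1 -ceD [z0 + _]addrC subrK /a; ring.
  have b : cn (ce (z - z0) - 1) <= m / 4 by apply: le_trans (ce_lip _) _; lra.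
  have e : cn a = cn (ce z0) * cn ((ce z0)^-1 + 1).
    by rewrite -cnM mulrDr mulfV ?ce_neq0 // mulr1 addrC.
  rewrite cnM e -mulrA ler_wpM2l ?cn_ge0 //; lra.
have lb z : cn (z - z0) <= m / 224 -> cn a / 2 <= cn (ce z + 1).
  move=> /hd h; have -> : ce z + 1 = a - (a - (ce z + 1)) by ring.
  by apply: le_trans (cn_le_sub _ _); rewrite cn_distC; lra.
have nz z : cn (z - z0) <= m / 224 -> ce z + 1 != 0.
  by move=> /lb h; rewrite -cn_gt0; lra.
split.
  apply: (@appr_ext _ (fun z => 1 - 2 / (ce z + 1))) => [z zr|].
    by rewrite th1 // nz.
  apply: apprB; first exact: appr_cst.
  apply: apprM; first exact: appr_cst.
  apply: (appr_comp (g := fun z => z^-1) (w0 := a) (rho := cn a / 2)).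
  - by apply: apprD; [exact: appr_ce|exact: appr_cst].
  - exact: appr_inv.
  - by move=> z /hd; lra.
move=> z zr; rewrite th1 ?nz //; apply: le_trans (cnB _ _) _; rewrite cn1 lerD2l cnM cnV (cn_nat R 2).
have h3 := lb z zr; have h4 : 0 < cn (ce z + 1) by lra.
by rewrite ler_pdivrMr // mulrAC ler_pdivlMr //; lra.
Qed.

Lemma csig_appr z0 m : 0 < m -> m <= 1 ->
  (forall s, S s -> m <= cn (ce (z0 - rc s) + 1) /\ m <= cn ((ce (z0 - rc s))^-1 + 1)) ->
  appr csig z0 (m / 224) /\ forall z, cn (z - z0) <= m / 224 ->
   (forall s, cn (rc (ctil s) * th (z - rc s)) <= (1 + 4 / m) * `|ctil s|) /\
   is_csum (fun s => rc (ctil s) * th (z - rc s)) (csig z - rc C0).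
Proof.
move=> m0 m1 hS; have K0 : 0 <= 1 + 4 / m by rewrite addr_ge0 // divr_ge0 // ltW.
have bd z s : cn (z - z0) <= m / 224 -> cn (rc (ctil s) * th (z - rc s)) <= (1 + 4 / m) * `|ctil s|.
  move=> zr; rewrite cnM cn_real mulrC /ctil.
  case: ifP => [/asboolP Ss|_]; last by rewrite normr0 !mulr0.
  rewrite ler_wpM2r //; have [h1 h2] := hS s Ss.
  have [_] := th_appr m0 m1 h1 h2; apply.
  by have -> : z - rc s - (z0 - rc s) = z - z0 by ring.
have cs z : cn (z - z0) <= m / 224 -> is_csum (fun s => rc (ctil s) * th (z - rc s)) (csig z - rc C0).
  move=> zr; have [l hl] := csum_ex (fun s => bd z s zr) K0 smb_ctil.
  by rewrite (csig_val hl) addrC addKr.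
split; last by move=> z zr; split => [s|]; [exact: bd|exact: cs].
apply: (@appr_ext _ (fun z => rc C0 + (csig z - rc C0))) => [z _|].
  by rewrite addrC subrK.
apply: apprD; first exact: appr_cst.
apply: (appr_csum (fun s => normr_ge0 (ctil s)) smb_ctil K0 (fun z s => bd z s)) cs => s.
rewrite normr_eq0 => cs0; apply: apprZ.
have Ss : S s by move: cs0; rewrite /ctil; case: ifP => [/asboolP//|_]; rewrite eqxx.
have [h1 h2] := hS s Ss; have [h _] := th_appr m0 m1 h1 h2.
apply: (appr_comp (g := @th R) (w0 := z0 - rc s) (rho := m / 224)) => //.
  by apply: apprB; [exact: appr_id|exact: appr_cst].
by move=> z; have -> : z - rc s - (z0 - rc s) = z - z0 by ring.
Qed.

Definition tot : R := sup [set t | exists2 A, uniq A & t = \sum_(x <- A) `|ctil x|].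

Lemma tot_ub A : uniq A -> \sum_(x <- A) `|ctil x| <= tot.
Proof.
move=> uA; apply: ub_le_sup; last by exists A.
by have [M hM] := smb_ctil; exists M => t [B uB ->]; exact: hM.
Qed.

Lemma tot_ge0 : 0 <= tot.
Proof. by have := tot_ub (isT : uniq [::]); rewrite big_nil. Qed.

Lemma csig_bound z0 m : 0 < m -> m <= 1 ->
  (forall s, S s -> m <= cn (ce (z0 - rc s) + 1) /\ m <= cn ((ce (z0 - rc s))^-1 + 1)) ->
  forall z, cn (z - z0) <= m / 224 -> cn (csig z) <= `|C0| + (1 + 4 / m) * tot.
Proof.
move=> m0 m1 hS z zr; have [_ /(_ z zr)[b cs]] := csig_appr m0 m1 hS.
have -> : csig z = rc C0 + (csig z - rc C0) by ring.
apply: le_trans (cnD _ _) _; rewrite cn_real lerD2l.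
by apply: (csum_bound b _ tot_ub cs); rewrite addr_ge0 // divr_ge0 // ltW.
Qed.

(** All poles lie on the lines with Im z in Z + 1/2, and real shifts do not change Im z: one bound
    serves every [s]. *)
Lemma cos_hyp z0 : 0 < `|cos (pi * im z0)| ->
  forall s : R, `|cos (pi * im z0)| <= cn (ce (z0 - rc s) + 1) /\
    `|cos (pi * im z0)| <= cn ((ce (z0 - rc s))^-1 + 1).
Proof.
move=> c0 s; have := ce1_bound (z0 - rc s).
have -> : im (z0 - rc s) = im z0 by rewrite !reimE oppr0 addr0.
set k := `|cos _| in c0 *; have e0 : 0 < cn (ce (z0 - rc s)) by rewrite cn_gt0 ce_neq0.
set E := ce _ in e0 * => h; split; first by nra.
have -> : E^-1 + 1 = (E + 1) / E by rewrite mulrDl mulfV ?ce_neq0 // div1r addrC.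
rewrite cnM cnV ler_pdivlMr //; nra.
Qed.

Lemma csig_appr_cos z0 : 0 < `|cos (pi * im z0)| ->
  appr csig z0 (`|cos (pi * im z0)| / 224) /\ forall z, cn (z - z0) <= `|cos (pi * im z0)| / 224 ->
   cn (csig z) <= `|C0| + (1 + 4 / `|cos (pi * im z0)|) * tot.
Proof.
move=> c0; have c1 := cos_max (pi * im z0).
have h s (_ : S s) := cos_hyp c0 s.
by split; [have [] := csig_appr c0 c1 h|exact: csig_bound].
Qed.

Lemma csig_cos z0 : 0 < `|cos (pi * im z0)| ->
  (forall s, cn (rc (ctil s) * th (z0 - rc s)) <= (1 + 4 / `|cos (pi * im z0)|) * `|ctil s|) /\
   is_csum (fun s => rc (ctil s) * th (z0 - rc s)) (csig z0 - rc C0).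
Proof.
move=> c0; have c1 := cos_max (pi * im z0).
have h s (_ : S s) := cos_hyp c0 s.
have [_ H] := csig_appr c0 c1 h; apply: H; rewrite subrr cn0 divr_ge0 // ltW.
Qed.

Lemma csum_real (f : R -> C) l : (forall x, im (f x) = 0) -> is_csum f l -> im l = 0.
Proof.
move=> f0 h; have e : is_csum f (rc (re l)).
  move=> e /h[A hA]; exists A => B uB sB; apply: le_trans (hA B uB sB).
  have e0 : im (\sum_(x <- B) f x) = 0 by rewrite im_sum big1.
  apply: le_trans (le_cn_reim _) _; rewrite !reimE e0 subrr normr0 addr0; have := le_re_cn (\sum_(x <- B) f x - l).
  by rewrite !reimE.
by rewrite (csum_uniq h e).
Qed.

Lemma cos_im_rc x : `|cos (pi * im (rc x : C))| = 1.
Proof. by rewrite reimE mulr0 cos0 normr1. Qed.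

Lemma tanh_le1 x : `|tanh (pi * x)| <= 1.
Proof.
rewrite -cn_real -th_rc /th cnM cnV; have := ce1_bound (rc x); rewrite cos_im_rc mulr1 => h.
have e0 : 0 <= cn (ce (rc x)) by exact: cn_ge0.
have h1 : cn (ce (rc x) - 1) <= cn (ce (rc x)) + 1 by have := cnB (ce (rc x)) 1; rewrite cn1.
by rewrite ler_pdivrMr; lra.
Qed.

Lemma csig_rc x : csig (rc x) = rc (C0 + rsum S (fun s => c s * tanh (pi * (x - s)))).
Proof.
rewrite rcD; apply: csig_val; apply: csum_ext (rsum_csum _) => [s|s Ss]; last first.
  by rewrite normrM ler_piMr // tanh_le1.
by rewrite /ctil -rcB th_rc -rcM; case: ifP; rewrite ?mul0r.
Qed.

Lemma cos_int y (k : int) : `|cos (pi * (y + k%:~R))| = `|cos (pi * y)|.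
Proof.
have nat n : forall y, `|cos (pi * (y + n%:R))| = `|cos (pi * y)|.
  elim: n => [|n IH] t; first by rewrite addr0.
  by rewrite -natr1 addrA mulrDr mulr1 cosDpi normrN IH.
case: k => n; first exact: nat.
by rewrite NegzE intrN -[in RHS](subrK (n.+1%:R) y) nat.
Qed.

Lemma cos_onl y : ~ onl y -> 0 < `|cos (pi * y)|.
Proof.
move=> ny; have p0 := @pi_gt0 R; pose k := Num.floor (y + 2^-1).
have k1 : k%:~R <= y + 2^-1 by exact: floor_le.
have k2 : y + 2^-1 < (k + 1)%:~R by exact: floorD1_gt.
rewrite intrD in k2; rewrite -(subrK k%:~R y) cos_int normr_gt0 gt_eqF //.
have k3 : k%:~R != y + 2^-1.
  apply/negP => /eqP e; apply: ny; exists (k - 1); rewrite intrD e intrN; lra.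
have {}k1 : k%:~R < y + 2^-1 by rewrite lt_neqAle k3.
apply: cos_gt0_pihalf; apply/andP; split; nra.
Qed.

Lemma cos_strip y : `|y| <= 4^-1 -> 2^-1 <= `|cos (pi * y)|.
Proof.
move=> hy; have p0 := @pi_gt0 R; have [y1 y2] := ler_normlP _ _ hy.
have h : 0 <= cos ((pi * y) *+ 2).
  by apply: cos_ge0_pihalf; rewrite -mulr_natl; apply/andP; split; nra.
move: h; rewrite cos_mulr2n -(real_normK (num_real (cos _))); have := normr_ge0 (cos (pi * y)).
nra.
Qed.

(** The zeros of the cosine are simple. Applied to an imaginary part approaching a singular line,
    this bounds the growth of sigma by the inverse of the distance to the line. *)
Lemma cos_lower a (om : R) : om != 0 ->
  exists d k, [/\ 0 < d, 0 < k & forall y, `|y| <= d -> k * `|y| <= `|cos (pi * (a + om * y))|].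
Proof.
move=> om0; have p0 := @pi_gt0 R; have o0 : 0 < `|om| by rewrite normr_gt0.
have q0 : 0 < pi * `|om| by rewrite mulr_gt0.
have E y : cos (pi * (a + om * y)) =
    cos (pi * a) * cos (pi * om * y) - sin (pi * a) * sin (pi * om * y).
  by rewrite mulrDr cosD mulrA.
have ny y : `|pi * om * y| = pi * `|om| * `|y| by rewrite !normrM (gtr0_norm p0).
have [c0|c0] := eqVneq (cos (pi * a)) 0.
  exists ((pi * `|om|)^-1 / 2), (pi * `|om| / 2); split; [by rewrite divr_gt0 ?invr_gt0|by rewrite divr_gt0|].
  move=> y hy; rewrite E c0 mul0r sub0r normrN normrM.
  have -> : `|sin (pi * a)| = 1 by apply/eqP; rewrite norm_sin_eq1 c0.
  rewrite mul1r; set t := pi * om * y in ny *.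
  have ht : `|t| <= 2^-1.
    by rewrite ny; apply: le_trans (ler_wpM2l (ltW q0) hy) _; rewrite mulrA mulfV ?gt_eqF // mul1r.
  have h1 : `|sin t - t| <= t ^+ 2 by apply: sin_sub_le; lra.
  have h2 : `|t| - `|sin t| <= `|sin t - t| by rewrite distrC; exact: lerB_dist.
  have h3 : t ^+ 2 <= 2^-1 * `|t| by rewrite -(real_normK (num_real t)) expr2 ler_wpM2r.
  have -> : pi * `|om| / 2 * `|y| = `|t| / 2 by rewrite ny; ring.
  lra.
set k := `|cos (pi * a)|; have k0 : 0 < k by rewrite normr_gt0.
have k1 : k <= 1 by exact: cos_max.
exists (Num.min 1 (k / 4 / (pi * `|om|))), (k / 4); split; [|by lra|].
  by rewrite lt_min ltr01 !divr_gt0.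
move=> y; rewrite le_min => /andP[y1]; rewrite ler_pdivlMr // => y2; rewrite E.
set t := pi * om * y in ny *; have ht : `|t| <= k / 4 by rewrite ny mulrC.
have h1 := cos_sub1_le t; have h2 := sin_abs_le t; have h3 := sin_max (pi * a).
have h4 : k - `|cos (pi * a) * (cos t - 1) - sin (pi * a) * sin t| <=
    `|cos (pi * a) * cos t - sin (pi * a) * sin t|.
  have -> : cos (pi * a) * cos t - sin (pi * a) * sin t =
    cos (pi * a) - - (cos (pi * a) * (cos t - 1) - sin (pi * a) * sin t) by ring.
  by rewrite -[X in _ - X]normrN; exact: lerB_dist.
have h5 : `|cos (pi * a) * (cos t - 1) - sin (pi * a) * sin t| <= `|cos t - 1| + `|sin t|.
  by apply: le_trans (ler_normB _ _) _; rewrite !normrM; apply: lerD; rewrite ler_piMl // cos_max.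
have h6 : t ^+ 2 <= `|t| by rewrite -(real_normK (num_real t)) expr2 ler_piMl //; lra.
have : k / 4 * `|y| <= k / 4 by rewrite ler_piMr //; lra.
lra.
Qed.

Lemma ce_line z : onl (im z) -> ce z = - rc (expR (2 * pi * re z)).
Proof.
move=> [k ek]; have -> : z = rc (re z) + ('i%C / 2 + 'i%C * rc k%:~R).
  by rewrite -rc_half; apply: cplx_ext; rewrite !reimE ?ek; ring.
have ck : ce ('i%C * rc k%:~R) = 1 :> C.
  have nat n : ce ('i%C * rc n%:R) = 1 :> C.
    elim: n => [|n IH]; first by rewrite mulr0 ce0.
    by rewrite -natr1 rcD mulrDr mulr1 ceD IH ce_i mulr1.
  case: k {ek} => n; first exact: nat.
  by rewrite NegzE intrN rcN mulrN ceN nat invr1.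
rewrite !ceD ce_ihalf ck mulr1 mulrN1 !reimE /ce -rcM cexp_rc; congr (- rc (expR _)).
rewrite -rc_half !reimE; ring.
Qed.

(** On a singular line [ce] is real and negative, so its distance to -1 is governed by Re z alone.
    This gives analyticity on that line away from the closure of [S]. *)
Lemma line_hyp z e : 0 < e -> onl (im z) -> e <= `|re z| ->
  1 - expR (- e) <= cn (ce z + 1) /\ 1 - expR (- e) <= cn ((ce z)^-1 + 1).
Proof.
move=> e0 oz ez; have p2 := @pi_ge2 R; have e1 : expR (- e) < 1 by rewrite expR_lt1; lra.
have ep := expR_gt0 (- e).
have key X : e <= `|X| -> 1 - expR (- e) <= cn (- rc (expR X) + 1 : C).
  move=> hX; have -> : - rc (expR X) + 1 = rc (1 - expR X) :> C by rewrite rcB addrC.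
  rewrite cn_real; have [X0|X0] := leP 0 X.
    rewrite ger0_norm // in hX; rewrite -normrN opprB.
    apply: le_trans (ler_norm _).
    have h1 : expR e <= expR X by rewrite ler_expR.
    have : expR e * expR (- e) = 1 by exact: expRxMexpNx_1.
    nra.
  rewrite ltr0_norm // in hX; apply: le_trans (ler_norm _).
  by rewrite lerD2l lerN2 ler_expR; lra.
have hX : e <= `|2 * pi * re z|.
  rewrite normrM (ger0_norm (_ : 0 <= 2 * pi)) //; last by lra.
  have := normr_ge0 (re z); nra.
rewrite (ce_line oz); split; first exact: key.
have -> : (- rc (expR (2 * pi * re z)))^-1 = - rc (expR (- (2 * pi * re z))) :> C.
  by rewrite expRN rcV invrN.
by apply: key; rewrite normrN.
Qed.

Lemma csig_holo z : ~ bad S z -> holo csig z.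
Proof.
move=> gz; have [oz|nz] := pselect (onl (im z)); last first.
  have c0 := cos_onl nz; exists (`|cos (pi * im z)| / 224); first by lra.
  by have [] := csig_appr_cos c0.
have [e e0 he] : exists2 e, 0 < e & forall s, S s -> e <= `|s - re z|.
  apply: contrapT => h; apply: gz; split => // e e0; apply: contrapT => h'.
  by apply: h; exists e => // s Ss; rewrite leNgt; apply/negP => ls; apply: h'; exists s.
set m := 1 - expR (- e); have m0 : 0 < m by rewrite subr_gt0 expR_lt1; lra.
have m1 : m <= 1 by rewrite /m; have := expR_gt0 (- e); lra.
exists (m / 224); first by lra.
have [|//] := csig_appr (z0 := z) m0 m1; move=> s Ss.
apply: line_hyp => //; rewrite !reimE ?oppr0 ?addr0 //.
by rewrite distrC; exact: he.
Qed.

Lemma csig_strip : exists r M, [/\ 0 < r, 0 < M & forall z0, `|im z0| <= 4^-1 ->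
  appr csig z0 r /\ forall z, cn (z - z0) <= r -> cn (csig z) <= M].
Proof.
(* On this strip the cosine is at least 1/2, whence the radius and the factor 9 = 1 + 4 / (1/2); the
   final 1 only ensures positivity. *)
exists (2^-1 / 224), (`|C0| + 9 * tot + 1); have t0 := tot_ge0.
split; [lra|have := normr_ge0 C0; nra|move=> z0 hz].
have h := cos_strip hz; set k := `|cos _| in h; have k0 : 0 < k by lra.
have [h1 h2] := csig_appr_cos k0; split=> [|z zr]; first by apply: appr_rad h1 _; rewrite -/k; lra.
apply: le_trans (h2 z _) _; first by rewrite -/k; lra.
have : 4 / k <= 8 by rewrite ler_pdivrMr //; lra.
rewrite -/k; nra.
Qed.

Lemma csig_lip : exists2 K, 0 <= K & forall z w, `|im z| <= 4^-1 -> `|im w| <= 4^-1 ->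
  cn (csig z - csig w) <= K * cn (z - w).
Proof.
have [r [B [r0 B0 h]]] := csig_strip; exists (4 * B / r); first by apply: divr_ge0; lra.
move=> z w hz hw; have [zw|zw] := leP (cn (z - w)) (r / 2); last first.
  have b1 : cn (csig z) <= B by have [_ H] := h z hz; apply: H; rewrite subrr cn0 ltW.
  have b2 : cn (csig w) <= B by have [_ H] := h w hw; apply: H; rewrite subrr cn0 ltW.
  apply: le_trans (cnB _ _) _; rewrite mulrAC ler_pdivlMr //; nra.
have [ha hb] := h w hw; have [a ba hT] := taylor r0 ha hb.
have := hT 1%N (z - w) zw; rewrite big_ord1 expr0 mulr1 [w + _]addrC subrK expr1.
have := hT 1%N 0; rewrite cn0 => /(_ _)/wrap[]; first by lra.
rewrite big_ord1 expr0 mulr1 addr0 mul0r expr1 mulr0 => h0.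
have -> : a 0%N = csig w.
  by apply/esym/eqP; rewrite -subr_eq0 -cn_eq0 eq_le cn_ge0 h0.
move=> h1; apply: le_trans h1 _; have := cn_ge0 (z - w) => c0.
rewrite mulrA mulrAC ler_wpM2r // ler_wpM2r ?invr_ge0 ?ltW //; lra.
Qed.

End Csig.

(** * Poles *)

Section Poles.
Variable R : realType.
Local Notation C := R[i].
Implicit Types (z w h : C) (x y r m p q : R).

(** A removable singularity: the quotient is the shifted Taylor series, with value [a 1%N] at 0. *)
Lemma appr_div (f : C -> C) r : 0 < r -> appr f 0 r -> f 0 = 0 ->
  exists2 g, appr g 0 (r / 4) & forall z, z != 0 -> g z = f z / z.
Proof.
move=> r0 hf f0; have [B B0 hB] := appr_bound hf; have [a ha hT] := taylor r0 hf hB.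
have a0 : a 0%N = 0.
  have := hT 1%N 0; rewrite cn0 => /(_ _)/wrap[]; first by lra.
  rewrite big_ord1 expr0 mulr1 addr0 mul0r expr1 mulr0 f0 sub0r cnN => h.
  by apply/eqP; rewrite -cn_eq0 eq_le cn_ge0 h.
exists (fun z => if z == 0 then a 1%N else f z / z) => [|z /negPf -> //].
apply: appr_unif => e e0; have [M hM] := half_pow_small (2 * B / r) e0.
exists (fun z => \sum_(n < M.+1) a n.+1 * z ^+ n).
  by apply: appr_sum => n _; apply: apprZ; apply: apprX; exact: appr_id.
move=> z; rewrite subr0 => zr; have [->|z0] := eqVneq z 0.
  rewrite big_ord_recl expr0 mulr1 big1 ?addr0 ?subrr ?cn0 ?ltW // => i _.
  by rewrite exprS mul0r mulr0.
have cz : 0 < cn z by rewrite cn_gt0.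
have := hT M.+2 z; rewrite add0r big_ord_recl a0 mul0r add0r => /(_ _)/wrap[]; first by lra.
move=> h; have -> : f z / z - \sum_(n < M.+1) a n.+1 * z ^+ n =
   (f z - \sum_(i < M.+1) a (lift ord0 i) * z ^+ lift ord0 i) / z.
  rewrite mulrBl mulr_suml; congr (_ - _); apply: eq_bigr => i _.
  by rewrite /= /bump /= add1n exprSr -!mulrA mulfV // mulr1.
rewrite cnM cnV ler_pdivrMr //; apply: le_trans h _.
set t := cn z / r; have t0 : 0 <= t by rewrite divr_ge0 // ltW.
have t1 : t <= 2^-1 by rewrite ler_pdivrMr //; lra.
have ct : cn z = t * r by rewrite divfK ?gt_eqF.
rewrite exprS mulrCA [leRHS]mulrC ct -[leRHS]mulrA ler_wpM2l //.
have ht : t ^+ M.+1 <= 2^-1 ^+ M.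
  apply: (@le_trans _ _ (2^-1 ^+ M.+1)); first by rewrite lerXn2r ?nnegrE.
  by rewrite exprS ler_piMl ?exprn_ge0 //; lra.
apply: le_trans (_ : 2 * B * 2^-1 ^+ M <= _); first by rewrite ler_wpM2l //; lra.
have -> : 2 * B * 2^-1 ^+ M = r * (2 * B / r * 2^-1 ^+ M) by field; rewrite gt_eqF.
by rewrite ler_pM2l.
Qed.

(** Write ce z - 1 = z g1(z) with g1(0) = 2 pi. Then ce z + 1 - g1(z) / pi vanishes at 0, and its
    quotient by z g1(z) is coth (pi z) minus its principal part. *)
Lemma coth_near0 : exists d (K : C -> C), [/\ 0 < d, appr K 0 d &
  forall y : C, y != 0 -> cn y <= d -> K y = ct y - (rc pi * y)^-1].
Proof.
have p0 := @pi_gt0 R; have p4 := pi_le4 R.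
have [g1 hg1 eg1] : exists2 g, appr g 0 (4 / 4) & forall z : C, z != 0 -> g z = (ce z - 1) / z.
  apply: (@appr_div (fun z => ce z - 1)) => //; last by rewrite ce0 subrr.
  by apply: apprB; [exact: appr_ce|exact: appr_cst].
rewrite mulfV // in hg1.
have pC : rc pi != 0 :> C by rewrite rc_eq0 gt_eqF.
have g10 : g1 0 = rc (2 * pi).
  apply/eqP; rewrite -subr_eq0; apply/eqP; apply: (@cn_small0 _ _ 2) => e e0.
  have [d d0 [d1 hd]] := appr_cont ltr01 hg1 e0.
  pose x := Num.min d (Num.min 64^-1 (e / 12 / 64)).
  have x0 : 0 < x by rewrite !lt_min d0; apply/andP; split; lra.
  have xd : x <= d by rewrite ge_min lexx.
  have x1 : x <= 64^-1 by rewrite !ge_min lexx orbT.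
  have x2 : x <= e / 12 / 64 by rewrite !ge_min lexx !orbT.
  clearbody x.
  have cx : cn (rc x : C) = x by rewrite cn_real gtr0_norm.
  have rx : rc x != 0 :> C by rewrite rc_eq0 gt_eqF.
  have h1 := hd (rc x); rewrite subr0 cx eg1 // in h1.
  have ch : cn (rc (2 * pi) * rc x : C) = 2 * pi * x by rewrite cnM cx cn_real gtr0_norm // mulr_gt0.
  have h2 : cn (ce (rc x) - 1 - rc (2 * pi) * rc x : C) <= 12 * (2 * pi * x) ^+ 2.
    by rewrite -ch; apply: cexp_bound; rewrite ch; nra.
  have h3 : cn ((ce (rc x) - 1) / rc x - rc (2 * pi) : C) <= e.
    have -> : (ce (rc x) - 1) / rc x - rc (2 * pi) = (ce (rc x) - 1 - rc (2 * pi) * rc x) / rc x :> C.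
      by field.
    rewrite cnM cnV cx ler_pdivrMr //; apply: le_trans h2 _.
    have h4 : (2 * pi * x) ^+ 2 <= (8 * x) ^+ 2.
      by rewrite lerXn2r ?nnegrE ?mulr_ge0 ?(ltW x0) ?(ltW p0) // ler_wpM2r ?(ltW x0) //; lra.
    have h5 : 0 <= x * (e / 12 / 64 - x) by apply: mulr_ge0; [exact: ltW|lra].
    by rewrite exprMn in h4; clear -h4 h5; nra.
  have -> : g1 0 - rc (2 * pi) = ((ce (rc x) - 1) / rc x - rc (2 * pi)) - ((ce (rc x) - 1) / rc x - g1 0).
    by ring.
  apply: le_trans (cnB _ _) _; have := h1 xd; lra.
have g1nz : g1 0 != 0 by rewrite g10 rc_eq0 gt_eqF // mulr_gt0.
have cg : 0 < cn (g1 0) by rewrite cn_gt0.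
have [g2 hg2 eg2] : exists2 g, appr g 0 (1 / 4) & forall z : C, z != 0 ->
    g z = (ce z + 1 - g1 z / rc pi) / z.
  apply: (@appr_div (fun z => ce z + 1 - g1 z / rc pi)) => //; last first.
    by rewrite ce0 g10 rcM (rc_nat _ 2); move: (rc pi : C) pC => P0 P1; field.
  apply: apprB; first by apply: apprD; [exact: appr_ce|exact: appr_cst].
  by apply: apprM => //; exact: appr_cst.
have [d d0 [d1 hd]] := appr_cont ltr01 hg1 (divr_gt0 cg (ltr0Sn _ 1)).
have gnz z : cn z <= d -> g1 z != 0.
  move=> zd; have := hd z; rewrite subr0 => /(_ zd) h; apply/negP => /eqP e.
  by move: h; rewrite e sub0r cnN; lra.
pose d' := Num.min d (1 / 4); have d'0 : 0 < d' by rewrite lt_min d0; lra.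
exists d', (fun z => g2 z / g1 z); split => //.
  apply: apprM; first by apply: appr_rad hg2 _; rewrite ge_min lexx orbT.
  apply: (appr_comp (g := fun z => z^-1) (w0 := g1 0) (rho := cn (g1 0) / 2)).
  - by apply: appr_rad hg1 _; apply: le_trans d1; rewrite ge_min lexx.
  - exact: appr_inv.
  - by move=> z zr; apply: hd; apply: le_trans zr _; rewrite ge_min lexx.
move=> y y0 yd; have yd1 : cn y <= d by apply: le_trans yd _; rewrite ge_min lexx.
have e1 : ce y - 1 = y * g1 y by rewrite eg1 // mulrC divfK.
rewrite eg2 // ctE e1; move: (rc pi : C) pC (g1 y) (gnz y yd1) => P0 P1 G G0; field.
by rewrite P1 y0 G0.
Qed.

Lemma ct_rc x : im (ct (rc x)) = 0.
Proof.
have e : ce (rc x) = rc (expR (2 * pi * x)) :> C by rewrite /ce -rcM cexp_rc.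
rewrite ctE e -(rmorph1 (@real_complex R)) -rcD -rcB -rcV -rcM; exact: im_rc.
Qed.

Lemma coth_regular : exists (K : C -> C) d M, [/\ 0 < d, 0 < M,
  forall y : C, y != 0 -> K y = ct y - (rc pi * y)^-1,
  forall x : R, appr K (rc x) d /\ forall z, cn (z - rc x) <= d -> cn (K z) <= M &
  forall x : R, im (K (rc x)) = 0].
Proof.
have p2 := @pi_ge2 R; have p0 := @pi_gt0 R.
have [d [K [d0 hK eK]]] := coth_near0.
pose k (z : C) := if z == 0 then K 0 else ct z - (rc pi * z)^-1.
have kK z : cn z <= d -> k z = K z by move=> zd; rewrite /k; case: eqVneq => [->//|z0]; rewrite eK.
have [M1 M10 hM1] := appr_bound hK.
set m := 1 - expR (- (d / 2)).
have m0 : 0 < m by rewrite subr_gt0 expR_lt1; lra.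
have m1 : m <= 1 by rewrite /m; have := expR_gt0 (- (d / 2)); lra.
have rk (x : R) : rc x != 0 :> C -> im (k (rc x)) = 0.
  move=> x0; rewrite /k (negPf x0) imD imN ct_rc -rcM -rcV im_rc; exact: subrr.
exists k, (Num.min (d / 4) (m / 224)), (M1 + (1 + 4 / m) + 4 / d); split.
- by rewrite lt_min; apply/andP; split; lra.
- by rewrite !addr_gt0 ?divr_gt0.
- by move=> y /negPf y0; rewrite /k y0.
- move=> x; have [xd|xd] := leP (`|x|) (d / 2).
    have sub z : cn (z - rc x) <= Num.min (d / 4) (m / 224) -> cn z <= d.
      rewrite le_min => /andP[h _]; rewrite -(subrK (rc x) z); apply: le_trans (cnD _ _) _.
      by rewrite cn_real; lra.
    split.
      apply: (@appr_ext _ K) => [z /sub/kK//|]; apply: appr_le hK _.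
      by rewrite subr0 cn_real; apply: (@le_trans _ _ (d / 4 + d / 2)); [apply: lerD => //; rewrite ge_min lexx|lra].
    move=> z /sub zd; rewrite kK //; apply: le_trans (hM1 z _) _; first by rewrite subr0.
    have : 0 < 4 / m by rewrite divr_gt0.
    have : 0 < 4 / d by rewrite divr_gt0.
    by lra.
  have [h1 h2] : m <= cn (ce (rc x + 'i%C / 2) + 1) /\ m <= cn ((ce (rc x + 'i%C / 2))^-1 + 1).
    apply: line_hyp; first by lra.
      by exists 0; rewrite -rc_half !reimE; ring.
    by rewrite -rc_half !reimE mul0r mul1r subrr addr0 ltW.
  have [ha hb] := th_appr m0 m1 h1 h2.
  have x0 : rc x != 0 :> C by rewrite rc_eq0 -normr_gt0; lra.
  have far z : cn (z - rc x) <= Num.min (d / 4) (m / 224) -> d / 4 <= cn z.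
    rewrite le_min => /andP[h _]; have -> : z = rc x - (rc x - z) by ring.
    by apply: le_trans (cn_le_sub _ _); rewrite cn_real cn_distC; lra.
  have nz z : cn (z - rc x) <= Num.min (d / 4) (m / 224) -> z != 0.
    by move=> /far h; rewrite -cn_gt0; lra.
  have shift z : z + 'i%C / 2 - (rc x + 'i%C / 2) = z - rc x by ring.
  split.
    apply: (@appr_ext _ (fun z => ct z - (rc pi)^-1 * z^-1)) => [z /nz/negPf z0|].
      by rewrite /k z0 invfM.
    apply: apprB.
      apply: (appr_comp (g := @th R) (f := fun z => z + 'i%C / 2) _ ha) => [|z].
        by apply: apprD; [exact: appr_id|exact: appr_cst].
      by rewrite shift le_min => /andP[].
    apply: apprZ; apply: appr_rad (appr_inv x0) _; rewrite cn_real.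
    by apply: (@le_trans _ _ (d / 4)); [rewrite ge_min lexx|lra].
  move=> z zr; have z0 := nz z zr; rewrite /k (negPf z0); apply: le_trans (cnB _ _) _.
  have b1 : cn (ct z) <= 1 + 4 / m.
    by apply: hb; rewrite shift; move: zr; rewrite le_min => /andP[].
  have b2 : cn (rc pi * z)^-1 <= 4 / d.
    have cz : 0 < cn z by rewrite cn_gt0.
    rewrite cnV cnM cn_real (gtr0_norm p0) -[4 / d]invf_div lef_pV2 ?posrE ?mulr_gt0 ?divr_gt0 //.
    by have := far z zr; nra.
  by lra.
- move=> x; have [->|x0] := eqVneq (rc x) 0; last exact: rk.
  rewrite kK ?cn0 ?ltW //.
  have /eqP : rc (im (K 0)) == 0 :> C.
    apply/eqP; apply: (@cn_small0 _ _ 1) => e e0; rewrite mul1r.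
    have [d1 d10 [d1d hd1]] := appr_cont d0 hK e0.
    have cx : cn (rc d1 : C) = d1 by rewrite cn_real gtr0_norm.
    have := hd1 (rc d1); rewrite subr0 cx => /(_ (lexx _)) h.
    have i0 : im (K (rc d1)) = 0.
      by rewrite -kK ?cx // rk // rc_eq0 gt_eqF.
    have := le_im_cn (K (rc d1) - K 0); rewrite !reimE i0 sub0r normrN cn_real; lra.
  by move=> /eqP; rewrite rc_eq0 => /eqP.
Qed.

End Poles.

(** Exchange of quantifiers by taking the smallest of finitely many radii. *)
Lemma fin_delta (R : realType) (J : finType) (P : J -> R -> Prop) :
  (forall j, exists2 d, 0 < d & P j d) ->
  (forall j d d', P j d -> 0 < d' -> d' <= d -> P j d') ->
  exists2 d, 0 < d & forall j, P j d.
Proof.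
move=> h mono; suff [d d0 hd] : exists2 d, 0 < d & forall j, j \in enum J -> P j d.
  by exists d => // j; apply: hd; rewrite mem_enum.
elim: (enum J) => [|j s [d d0 hd]]; first by exists 1.
have [d' d'0 hd'] := h j; exists (Num.min d d'); first by rewrite lt_min d0.
have m0 : 0 < Num.min d d' by rewrite lt_min d0.
move=> k; rewrite inE => /orP[/eqP->|/hd hk].
  by apply: mono hd' m0 _; rewrite ge_min lexx orbT.
by apply: mono hk m0 _; rewrite ge_min lexx.
Qed.

(** * Isolated points in finite unions of discrete sets *)

Section Isolated.
Variable R : realType.
Implicit Types (p q : R) (P : set R).

Definition mdisc P := forall q, P q -> exists2 d, 0 < d & forall q', P q' -> `|q' - q| < d -> q' = q.

Lemma discrete_mdisc P : discrete_set P -> mdisc P.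
Proof.
move=> hP q /hP[_ [V /nbhs_ballP[d d0 hd] e]]; exists d => // q' Pq' qd.
have : (V `&` P) q' by split => //; apply: hd; rewrite /ball /= distrC.
by rewrite e.
Qed.

(** A finite union of discrete sets need not be discrete, yet it has an isolated point: if a point
    [q] of [T j] is not isolated in [P], the other points of [P] near [q] avoid [T j], and the
    induction applies to them. *)
Lemma union_isolated (J : eqType) (s : seq J) (T : J -> set R) P :
  (forall j, j \in s -> mdisc (T j)) -> (forall q, P q -> exists2 j, j \in s & T j q) ->
  P !=set0 -> exists p d, [/\ P p, 0 < d & forall q, P q -> `|q - p| < d -> q = p].
Proof.
elim: s P => [|j s IH] P hT hP [q0 Pq0]; first by have [j] := hP q0 Pq0.
have hTs k : k \in s -> mdisc (T k) by move=> ks; apply: hT; rewrite inE ks orbT.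
have [[q [Pq Tq]]|nTj] := pselect (exists q, P q /\ T j q); last first.
  apply: IH => // [q Pq|]; last by exists q0.
  have [k] := hP q Pq; rewrite inE => /orP[/eqP->|ks] Tk; last by exists k.
  by exfalso; apply: nTj; exists q.
have [d d0 hd] := hT j (mem_head _ _) q Tq.
pose P' := [set x | [/\ P x, `|x - q| < d & x != q]].
have [[q1 P'q1]|nP'] := pselect (P' !=set0); last first.
  exists q, d; split => // q1 Pq1 qd; apply/eqP; apply: contrapT => /negP ne.
  by apply: nP'; exists q1.
have [||p [e [[Pp pd pq] e0 he]]] := IH P' hTs; last 1 first.
- exists p, (Num.min e (Num.min (d - `|p - q|) `|p - q|)); split => //.
    by rewrite !lt_min e0 subr_gt0 pd normr_gt0 subr_eq0.
  move=> x Px; rewrite !lt_min => /and3P[x1 x2 x3]; apply: he => //; split => //.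
    have -> : x - q = (x - p) + (p - q) by ring.
    by apply: le_lt_trans (ler_normD _ _) _; lra.
  by apply/negP => /eqP xq; move: x3; rewrite xq distrC ltxx.
- move=> x [Px xd xq]; have [k] := hP x Px; rewrite inE => /orP[/eqP->|ks] Tk; last by exists k.
  by move: xq; rewrite (hd x Tk xd) eqxx.
- by exists q1.
Qed.

Lemma mdisc_gap P : mdisc P -> forall a b : R, a < b ->
  exists c d, [/\ a < c, c < d, d < b & forall x, c < x < d -> ~ P x].
Proof.
move=> hP a b ab.
have [[s Ps sab]|n] := pselect (exists2 s, P s & a < s < b); last first.
  exists (a + (b - a) / 3), (a + 2 * (b - a) / 3); split; [lra|lra|lra|].
  by move=> x /andP[x1 x2] Px; apply: n; exists x => //; apply/andP; split; lra.
have [d d0 hd] := hP s Ps; have /andP[s1 s2] := sab.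
pose m := Num.min d (b - s); have m0 : 0 < m by rewrite lt_min d0 subr_gt0.
have md : m <= d by rewrite ge_min lexx.
have mb : m <= b - s by rewrite ge_min lexx orbT.
exists (s + m / 3), (s + m / 2); split; [lra|lra|lra|].
move=> x /andP[x1 x2] Px; have := hd x Px; rewrite ger0_norm; last by lra.
by move=> /(_ _)/wrap[]; lra.
Qed.

End Isolated.

(** * Residues on the line Im z = 1/2 *)

Section Residues.
Variables (R : realType) (C0 : R) (S : set R) (c : R -> R).
Local Notation C := R[i].
Implicit Types (z w h : C) (x y r m p q : R).
Hypothesis hc1 : summable S (EFin \o c).
Local Notation sg := (csig C0 S c).
Local Notation ctl := (ctil S c).

Lemma affine_can (om t : R) : om != 0 ->
  cancel (fun q => om * q + t) (fun s => (s - t) / om) /\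
  cancel (fun s => (s - t) / om) (fun q => om * q + t).
Proof. by move=> om0; split=> q; field. Qed.

Lemma smb_affine (g : R -> R) (om t : R) : om != 0 -> smb g -> smb (fun q => g (om * q + t)).
Proof.
move=> om0 [M hM]; exists M => A uA; rewrite -(big_map (fun q => om * q + t) xpredT g).
by apply: hM; rewrite map_inj_uniq //; apply: can_inj (affine_can t om0).1.
Qed.

Lemma smb_sum (J : finType) (g : J -> R -> R) : (forall j, smb (g j)) -> smb (fun q => \sum_j g j q).
Proof.
move=> h; have [M hM] := choice h; exists (\sum_j M j) => A uA.
by rewrite exchange_big /=; apply: ler_sum => j _; exact: hM.
Qed.

Lemma csig_rc_im x : im (sg (rc x)) = 0.
Proof. by rewrite csig_rc. Qed.

(** An even multiple of i / 2 is a period of sigma, so such a term is analytic at the line, and real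
    on it. *)
Lemma even_part (om t p : R) (k : int) : om = (2 * k)%:~R ->
  exists d (K : C -> C), [/\ 0 < d, appr K 0 d, forall x : R, im (K (rc x)) = 0 &
   forall w, sg (rc om * (rc p + 'i%C / 2 + w) + rc t) = K w].
Proof.
move=> omE; have [r [M [r0 M0 h]]] := csig_strip C0 hc1.
have o0 : 0 <= cn (rc om : C) by exact: cn_ge0.
exists (r / (cn (rc om : C) + 1)), (fun w => sg (rc om * (rc p + w) + rc t)).
have d0 : 0 < r / (cn (rc om : C) + 1) by apply: divr_gt0 => //; lra.
split => //.
- have [|ha _] := h (rc (om * p + t)); first by rewrite im_rc normr0.
  apply: (appr_comp (f := fun w => rc om * (rc p + w) + rc t) _ ha).
    apply: apprD; last exact: appr_cst.
    by apply: apprZ; apply: apprD; [exact: appr_cst|exact: appr_id].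
  move=> z; rewrite subr0 => zr; rewrite rcD rcM.
  have -> : rc om * (rc p + z) + rc t - (rc om * rc p + rc t) = rc om * z by ring.
  rewrite cnM; apply: le_trans (ler_wpM2l o0 zr) _; rewrite mulrA ler_pdivrMr; [nra|lra].
- by move=> x; rewrite -rcD -rcM -rcD csig_rc_im.
move=> w; rewrite -[RHS](csig_int C0 S c _ k); congr (sg _).
have -> : rc om = 2 * rc k%:~R :> C by rewrite omE intrM rcM -[2%:~R]/(2%:R : R) rc_nat.
by field.
Qed.

(** An odd multiple of i / 2 turns tanh into coth, with poles at the [q] such that om q + t lies in
    [S]. The regular parts of [coth_regular] add up to [K]; the principal parts remain a sum over
    [q], because poles of different neurons may coincide or accumulate. *)
Lemma odd_part (om t p : R) (k : int) : om = (2 * k + 1)%:~R ->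
  exists d (K : C -> C), [/\ 0 < d, appr K 0 d, forall x : R, im (K (rc x)) = 0 &
   forall w, im w != 0 -> cn w <= d ->
    is_csum (fun q => rc (ctl (om * q + t) / (pi * om)) / (w + rc p - rc q))
      (sg (rc om * (rc p + 'i%C / 2 + w) + rc t) - K w)].
Proof.
move=> omE; have p0 := @pi_gt0 R.
have om0 : om != 0 by rewrite omE intr_eq0; lia.
have oC : rc om != 0 :> C by rewrite rc_eq0.
have pC : rc pi != 0 :> C by rewrite rc_eq0 gt_eqF.
have co : cn (rc om : C) = `|om| by exact: cn_real.
have o0 : 0 < `|om| by rewrite normr_gt0.
have [kap [dk [M [dk0 M0 kE kA kR]]]] := coth_regular R.
have [dc [kc [dc0 kc0 hcos]]] := cos_lower 2^-1 om0.
set g := fun q => `|ctl (om * q + t)|.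
have g0 q : 0 <= g q by exact: normr_ge0.
have sg_ : smb g by apply: (smb_affine t om0 (smb_ctil hc1)).
pose F w q := rc (ctl (om * q + t)) * kap (rc om * (w + rc p - rc q)) : C.
pose K w := xget 0 (is_csum (F w)).
set d := Num.min dc (dk / `|om|).
have d0 : 0 < d by rewrite lt_min dc0 divr_gt0.
have dist w q : rc om * (w + rc p - rc q) - rc (om * (p - q)) = rc om * w.
  by rewrite rcM rcB; ring.
have wd w : cn w <= d -> cn (rc om * w) <= dk.
  by rewrite le_min => /andP[_]; rewrite ler_pdivlMr // cnM co mulrC.
have FB w q : cn w <= d -> cn (F w q) <= M * g q.
  move=> /wd wr; rewrite /F cnM cn_real mulrC ler_wpM2r //.
  by have [_ h] := kA (om * (p - q)); apply: h; rewrite dist.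
have KP w : cn w <= d -> is_csum (F w) (K w).
  move=> wr; have [l hl] := csum_ex (fun q => FB w q wr) (ltW M0) sg_.
  by rewrite /K; case: xgetP => [l' -> //|/(_ l)].
exists d, (fun w => rc C0 + K w); split => //.
- apply: apprD; first exact: appr_cst.
  apply: (appr_csum g0 sg_ (ltW M0)) => [z q|q _|z]; rewrite ?subr0; [exact: FB| |exact: KP].
  apply: apprZ; have [ha _] := kA (om * (p - q)).
  apply: (appr_comp (f := fun z => rc om * (z + rc p - rc q)) _ ha) => [|z].
    apply: apprZ; apply: apprB; last exact: appr_cst.
    by apply: apprD; [exact: appr_id|exact: appr_cst].
  by rewrite subr0 dist; exact: wd.
- move=> x; rewrite imD im_rc add0r /K; case: xgetP => [l -> hl|_]; last by rewrite im0.
  apply: csum_real hl => q; rewrite /F imM im_rc mul0r addr0.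
  by rewrite -rcD -rcB -rcM kR mulr0.
move=> w w0 wr.
have cw : `|im w| <= dc by apply: le_trans (le_im_cn _) _; move: wr; rewrite le_min => /andP[].
set z := rc om * (w + rc p) + rc t + 'i%C / 2.
have imz : im z = 2^-1 + om * im w by rewrite /z -rc_half !reimE; ring.
have cz : 0 < `|cos (pi * im z)|.
  by rewrite imz; apply: lt_le_trans (hcos _ cw); rewrite mulr_gt0 // normr_gt0.
have -> : sg (rc om * (rc p + 'i%C / 2 + w) + rc t) = sg z.
  rewrite -[RHS](csig_int C0 S c _ k); congr (sg _); rewrite /z.
  have {1}-> : rc om = 2 * rc k%:~R + 1 :> C.
    by rewrite omE intrD intrM rcD rcM -[2%:~R]/(2%:R : R) rc_nat.
  have {1}-> : rc om = 2 * rc k%:~R + 1 :> C.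
    by rewrite omE intrD intrM rcD rcM -[2%:~R]/(2%:R : R) rc_nat.
  by field.
have [_ hz] := csig_cos C0 hc1 cz.
have {}hz := csum_reindex (affine_can t om0).1 (affine_can t om0).2 hz.
have -> : sg z - (rc C0 + K w) = (sg z - rc C0) + (-1) * K w by ring.
apply: csum_ext (csumD hz (csumZ (-1) (KP w wr))) => q /=.
have wq : w + rc p - rc q != 0.
  apply/negP => /eqP/(congr1 (@complex.Im R)); rewrite !reimE oppr0 !addr0 => /eqP.
  by rewrite (negPf w0).
have -> : z - rc (om * q + t) = rc om * (w + rc p - rc q) + 'i%C / 2.
  by rewrite /z rcD rcM; ring.
rewrite -/(ct _) /F kE ?mulf_neq0 // rcM rcV rcM.
move: (rc pi : C) pC => PC pC; move: (w + _ - _) wq => u u0; field.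
by apply/and3P; split.
Qed.

Lemma pole_expansion (I J : finType) (a : I -> J -> R) (b : I -> R) (om t : J -> R) (oz : J -> int) :
  discrete_set S -> self_avoiding S -> (forall s, S s -> c s != 0) ->
  (forall i j, a i j != 0 -> om j = (oz j)%:~R) ->
  (exists i j, a i j != 0 /\ ~~ (2 %| oz j)%Z) ->
  (forall i i' j j', a i j != 0 -> a i' j' != 0 -> om j = om j' -> t j = t j' -> j = j') ->
  exists p d (W : I -> R) (H : I -> C -> C), [/\ 0 < d, exists i, W i != 0,
    forall i, appr (H i) 0 d, forall i (x : R), im (H i (rc x)) = 0 &
    forall i w, im w != 0 -> cn w <= d ->
      \sum_j rc (a i j) * sg (rc (om j) * (rc p + 'i%C / 2 + w) + rc (t j)) + rc (b i) =
      rc (W i) / w + H i w].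
Proof.
move=> hSd hSa hc0 hz [i0 [j0 [aij0 odd0]]] inj.
have p0 := @pi_gt0 R.
(* Only odd frequencies with some non-zero coefficient produce poles. *)
pose uo j := ~~ (2 %| oz j)%Z && [exists i, a i j != 0].
have uoE j : uo j -> om j = (oz j)%:~R by move=> /andP[_ /existsP[i /hz]].
have uo0 j : uo j -> om j != 0.
  by move=> uj; rewrite (uoE _ uj) intr_eq0; case/andP: uj => + _; apply: contraNneq => ->.
pose r i q := \sum_(j | uo j) a i j * (ctl (om j * q + t j) / (pi * om j)).
pose Pi := [set q | exists i, r i q != 0].
have ctl_out s : ~ S s -> ctl s = 0 by move=> ns; rewrite /ctil asboolF.
have Pi0 : Pi !=set0.
  pose A := [pred j | uo j]; have Aj0 : j0 \in A by rewrite inE /uo odd0; apply/existsP; exists i0.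
  (* Self-avoidance provides a point [q] at which exactly one of these neurons has a pole, so its
     residue is not cancelled. *)
  have [|||k0 [q [[s Ss sq] hq]]] := @hSa #|A| (fun k => oz (enum_val k)) (fun k => t (enum_val k)).
  - by apply/card_gt0P; exists j0.
  - by move=> k; have := enum_valP k; rewrite inE => /andP[].
  - move=> k k' [e1 e2]; apply: enum_val_inj.
    have := enum_valP k; have := enum_valP k'; rewrite !inE => u' u.
    have /andP[_ /existsP[i ai]] := u; have /andP[_ /existsP[i' ai']] := u'.
    by apply: (inj _ _ _ _ ai ai') => //; rewrite (hz _ _ ai) (hz _ _ ai') e1.
  set j := enum_val k0 in sq; have uj : uo j by have := enum_valP k0; rewrite inE.
  have /andP[_ /existsP[i aij]] := uj.
  have oj := uo0 _ uj.
  exists q, i; rewrite /r (bigD1 j) //= big1 ?addr0 => [|j' /andP[uj' jj']].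
    have -> : om j * q + t j = s by rewrite -sq (uoE _ uj) /=; field; rewrite -(uoE _ uj).
    have cs : ctl s != 0 by rewrite /ctil asboolT // hc0.
    by do 2 apply: mulf_neq0 => //; rewrite invr_eq0 mulf_neq0 // gt_eqF.
  rewrite ctl_out ?mul0r ?mulr0 // => Sj'.
  have Aj' : j' \in A by rewrite inE.
  have := hq (enum_rank_in Aj0 j') _; apply => [|].
    apply/negP => /eqP e; move/negP: jj'; apply; apply/eqP.
    by rewrite -(enum_rankK_in Aj0 Aj') e.
  exists (om j' * q + t j') => //; rewrite (enum_rankK_in Aj0 Aj') -(uoE _ uj').
  by field; exact: uo0.
have hT j : j \in enum uo -> mdisc [set q | S (om j * q + t j)].
  rewrite mem_enum => uj q Sq; have [d d0 hd] := discrete_mdisc hSd Sq.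
  have o0 : 0 < `|om j| by rewrite normr_gt0 uo0.
  exists (d / `|om j|); first by rewrite divr_gt0.
  move=> q' Sq'; rewrite ltr_pdivlMr // => h.
  have /addIr/(mulfI (uo0 _ uj)) // : om j * q' + t j = om j * q + t j.
  apply: hd => //; have -> : om j * q' + t j - (om j * q + t j) = (q' - q) * om j by ring.
  by rewrite normrM.
have hP q : Pi q -> exists2 j, j \in enum uo & S (om j * q + t j).
  move=> [i riq]; apply: contrapT => h; move/eqP: riq; apply; rewrite /r big1 // => j uj.
  rewrite ctl_out ?mul0r ?mulr0 // => Sj; apply: h; exists j => //.
  by rewrite mem_enum.
(* Only non-zero total residues count: [p] is isolated among these, although points where all
   residues cancel may accumulate at it. *)
have [p [del [[ip rp] del0 iso]]] := union_isolated hT hP Pi0.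
have iso' i q : q != p -> r i q != 0 -> del <= `|p - q|.
  move=> qp rq; rewrite leNgt; apply/negP => h; move/eqP: qp; apply; apply: iso; first by exists i.
  by rewrite distrC.
pose G q := \sum_i \sum_j `|a i j / (pi * om j)| * (if uo j then `|ctl (om j * q + t j)| else 0).
have G0 q : 0 <= G q.
  by apply: sumr_ge0 => i _; apply: sumr_ge0 => j _; apply: mulr_ge0 => //; case: ifP.
have sG : smb G.
  apply: smb_sum => i; apply: smb_sum => j; have [uj|nuj] := boolP (uo j); last first.
    by exists 0 => A _; rewrite big1 // => q _; rewrite mulr0.
  by apply: (smb_le (K := `|a i j / (pi * om j)|)) (smb_affine (t j) (uo0 _ uj) (smb_ctil hc1)) => [q|].
have rG i q : `|r i q| <= G q.
  apply: le_trans (ler_norm_sum _ _ _) _; rewrite /G (bigD1 i) //=.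
  apply: le_trans (_ : \sum_j `|a i j / (pi * om j)| * (if uo j then `|ctl (om j * q + t j)| else 0) <= _).
    rewrite [leLHS]big_mkcond /=; apply: ler_sum => j _; case: ifP => _; last by rewrite mulr0.
    by rewrite -normrM le_eqVlt; apply/orP; left; apply/eqP; congr `|_|; ring.
  rewrite lerDl; apply: sumr_ge0 => i' _; apply: sumr_ge0 => j _; apply: mulr_ge0 => //; by case: ifP.
(* Once the residue at [p] is removed, the remaining poles are at distance at least [del], so this
   part is analytic on the disc of radius [del / 2]. *)
pose r' i q := if q == p then 0 else r i q.
pose F i w q := rc (r' i q) / (w + rc p - rc q) : C.
pose Hm i w := xget 0 (is_csum (F i w)).
have d2 : 0 < 2 / del by rewrite divr_gt0.
have far i q w : cn w <= del / 2 -> r' i q != 0 -> del / 2 <= cn (w + rc p - rc q).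
  rewrite /r' => wr; case: (eqVneq q p) => [_|qp rq]; first by rewrite eqxx.
  have h1 := iso' _ _ qp rq.
  have -> : w + rc p - rc q = rc (p - q) - (- w) by rewrite rcB; ring.
  by apply: le_trans (cn_le_sub _ _); rewrite cnN cn_real; lra.
have FB i w q : cn w <= del / 2 -> cn (F i w q) <= 2 / del * G q.
  move=> wr; rewrite /F cnM cnV cn_real.
  have [->|rq] := eqVneq (r' i q) 0; first by rewrite normr0 mul0r mulr_ge0 // ltW.
  have h := far i q w wr rq; rewrite mulrC; apply: ler_pM => //; rewrite ?invr_ge0 ?cn_ge0 //.
    by rewrite -[2 / del]invf_div lef_pV2 ?posrE //; lra.
  by apply: le_trans (rG i q); rewrite /r'; case: ifP => //; rewrite normr0.
have HP i w : cn w <= del / 2 -> is_csum (F i w) (Hm i w).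
  move=> wr; have [l hl] := csum_ex (fun q => FB i w q wr) (ltW d2) sG.
  by rewrite /Hm; case: xgetP => [l' -> //|/(_ l)].
have HA i : appr (Hm i) 0 (del / 2).
  apply: (appr_csum G0 sG (ltW d2)) => [z q|q _|z]; rewrite ?subr0; [exact: FB| |exact: HP].
  have [e|rq] := eqVneq (r' i q) 0.
    by apply: appr_ext (appr_cst 0 _ _) => z _; rewrite /F e mul0r.
  have qp : q != p by move: rq; rewrite /r'; case: (eqVneq q p) => //; rewrite eqxx.
  have h1 : del <= `|p - q| by apply: (iso' i) => //; move: rq; rewrite /r' (negPf qp).
  apply: apprZ; apply: (appr_comp (g := fun z => z^-1) (w0 := rc (p - q)) (rho := cn (rc (p - q) : C) / 2)).
  - by apply: apprB; [apply: apprD; [exact: appr_id|exact: appr_cst]|exact: appr_cst].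
  - by apply: appr_inv; rewrite rc_eq0 subr_eq0 eq_sym.
  - move=> z; rewrite subr0 => zr; rewrite cn_real rcB.
    have -> : z + rc p - rc q - (rc p - rc q) = z by ring.
    by lra.
have HR i (x : R) : im (Hm i (rc x)) = 0.
  rewrite /Hm; case: xgetP => [l -> hl|_]; last by rewrite im0.
  by apply: csum_real hl => q; rewrite /F -rcD -rcB -rcV -rcM im_rc.
pose Q j d := exists K : C -> C, [/\ appr K 0 d, forall x : R, im (K (rc x)) = 0 &
  if uo j then forall w, im w != 0 -> cn w <= d ->
    is_csum (fun q => rc (ctl (om j * q + t j) / (pi * om j)) / (w + rc p - rc q))
      (sg (rc (om j) * (rc p + 'i%C / 2 + w) + rc (t j)) - K w)
  else forall w i, rc (a i j) * sg (rc (om j) * (rc p + 'i%C / 2 + w) + rc (t j)) = rc (a i j) * K w].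
have parts j : exists2 d, 0 < d & Q j d.
  rewrite /Q.
  have [uj|nuj] := boolP (uo j).
    have [k ek] : exists k, oz j = 2 * k + 1.
      have /andP[oj _] := uj; exists (oz j %/ 2)%Z.
      have := divz_eq (oz j) 2; have : (oz j %% 2)%Z != 0 by apply: contra oj => /eqP/dvdz_mod0P.
      have := @modz_ge0 (oz j) 2 isT; have := @ltz_pmod (oz j) 2 isT; lia.
    have [d [K [d0 K1 K2 K3]]] := @odd_part (om j) (t j) p k (etrans (uoE _ uj) (congr1 _ ek)).
    by exists d => //; exists K.
  have [/existsP[i aij]|/existsPn na] := boolP [exists i, a i j != 0]; last first.
    exists 1 => //; exists (fun=> 0); split => [|//|w i]; first exact: appr_cst.
    by have := na i; rewrite negbK => /eqP ->; rewrite !mul0r.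
  have /dvdzP[k ek] : (2 %| oz j)%Z.
    by apply: contraNT nuj => oj; rewrite /uo oj; apply/existsP; exists i.
  have [d [K [d0 K1 K2 K3]]] := @even_part (om j) (t j) p k (etrans (hz _ _ aij) (congr1 _ (etrans ek (mulrC _ _)))).
  by exists d => //; exists K; split => // w i'; rewrite K3.
have Qmono j d d' : Q j d -> 0 < d' -> d' <= d -> Q j d'.
  move=> [K [k1 k2 k3]] _ le; exists K; split => //; first exact: appr_rad le.
  by case: ifP k3 => // _ h w w0 wd; apply: h => //; exact: le_trans le.
have [d d0 /choice[K hK]] := fin_delta parts Qmono.
pose D := Num.min d (del / 2); have D0 : 0 < D by rewrite lt_min d0; lra.
have Dd : D <= d by rewrite ge_min lexx.
have Dl : D <= del / 2 by rewrite ge_min lexx orbT.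
exists p, D, (fun i => r i p), (fun i w => Hm i w + (\sum_j rc (a i j) * K j w + rc (b i))).
split => //.
- by exists ip.
- move=> i; apply: apprD; first exact: appr_rad (HA i) Dl.
  apply: apprD; last exact: appr_cst.
  by apply: appr_sum => j _; apply: apprZ; have [k1 _ _] := hK j; exact: appr_rad k1 Dd.
- move=> i x; rewrite !imD HR im_rc im_sum big1 ?addr0 // => j _.
  by have [_ k2 _] := hK j; rewrite imM k2 im_rc mulr0 mul0r addr0.
move=> i w w0 wD.
have wd : cn w <= d by apply: le_trans Dd.
have wl : cn w <= del / 2 by apply: le_trans Dl.
set V := fun j => sg (rc (om j) * (rc p + 'i%C / 2 + w) + rc (t j)).
(* The same residue series is summed twice: neuron by neuron in [e1], and with the pole at [p] split
   off in [e2]. *)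
have e1 : is_csum (fun q => rc (r i q) / (w + rc p - rc q)) (\sum_(j | uo j) rc (a i j) * (V j - K j w)).
  apply: csum_ext (csum_sum (f := fun j q => rc (a i j) * (rc (ctl (om j * q + t j) / (pi * om j)) / (w + rc p - rc q))) _ _).
    by move=> q; rewrite /r rc_sum mulr_suml; apply: eq_bigr => j _; rewrite [in RHS]rcM -[in RHS]mulrA.
  by move=> j uj; apply: csumZ; have [_ _] := hK j; rewrite uj; apply.
have e2 : is_csum (fun q => rc (r i q) / (w + rc p - rc q)) (rc (r i p) / w + Hm i w).
  apply: csum_ext (csumD (csum_single p (rc (r i p) / w)) (HP i w wl)) => q.
  rewrite /F /r'; case: eqVneq => [->|_]; last by rewrite add0r.
  by rewrite mul0r addr0 -addrA subrr addr0.
rewrite [RHS]addrA [RHS]addrA; congr (_ + _); rewrite -(csum_uniq e1 e2).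
rewrite (bigID uo) /= [X in _ = _ + X](bigID uo) /= addrA -big_split /=; congr (_ + _).
  by apply: eq_bigr => j _; rewrite /V; ring.
by apply: eq_bigr => j nuj; have [_ _] := hK j; rewrite (negPf nuj) => ->.
Qed.

End Residues.

(** * Compactness and simultaneous Diophantine approximation *)

Lemma subseq_conv1 (R : realType) (x : nat -> R) : (forall n, `|x n| <= 1) ->
  exists v, forall d m, 0 < d -> exists2 n, (m <= n)%N & `|x n - v| <= d.
Proof.
(* The limit point is the limit superior, the supremum of the levels reached infinitely often. *)
move=> hx; pose A := [set t : R | forall m, exists2 n, (m <= n)%N & t <= x n].
have hs : has_sup A.
  split; first by exists (-1) => m; exists m => //; have := hx m; rewrite ler_norml => /andP[].
  exists 1 => t /(_ 0%N)[n _ tn]; apply: le_trans tn _.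
  by have := hx n; rewrite ler_norml => /andP[].
exists (sup A) => d m d0.
have [t At tA] := sup_adherent d0 hs.
have nA : ~ A (sup A + d).
  by move=> h; have := ub_le_sup hs.2 h; lra.
have [m0 hm0] : exists m0, forall n, (m0 <= n)%N -> x n < sup A + d.
  apply: contrapT => h; apply: nA => m1; apply: contrapT => h1; apply: h; exists m1 => n mn.
  by rewrite ltNge; apply/negP => le; apply: h1; exists n.
have [n mn tn] := At (maxn m m0); exists n; first by apply: leq_trans mn; rewrite leq_maxl.
have := hm0 n (leq_trans (leq_maxr _ _) mn).
by rewrite ler_norml => h; apply/andP; split; lra.
Qed.

Lemma subseq_conv (R : realType) (I : finType) (u : nat -> I -> R) : (forall n i, `|u n i| <= 1) ->
  exists (v : I -> R) (phi : nat -> nat), forall k, (k <= phi k)%N /\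
    forall i, `|u (phi k) i - v i| <= k.+1%:R^-1.
Proof.
move=> hu; suff [v [phi h]] : exists (v : I -> R) (phi : nat -> nat), forall k, (k <= phi k)%N /\
    forall i, i \in enum I -> `|u (phi k) i - v i| <= k.+1%:R^-1.
  by exists v, phi => k; have [h1 h2] := h k; split => // i; apply: h2; rewrite mem_enum.
elim: (enum I) => [|i s [v [phi h]]]; first by exists (fun=> 0), id.
have [w hw] := @subseq_conv1 R (fun n => u (phi n) i) (fun n => hu _ _).
have /choice[psi hpsi] : forall k, exists n, (k <= n)%N /\ `|u (phi n) i - w| <= k.+1%:R^-1.
  by move=> k; have [|n kn hn] := hw k.+1%:R^-1 k; [rewrite invr_gt0 ltr0n|exists n].
exists (fun j => if j == i then w else v j), (phi \o psi) => k /=.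
have [k1 k2] := hpsi k; have [p1 p2] := h (psi k); split; first exact: leq_trans k1 p1.
move=> j; rewrite inE; case: eqVneq => [->//|_ /= js].
apply: le_trans (p2 j js) _; rewrite lef_pV2 ?posrE ?ltr0n // ler_nat; exact: leq_ltn_trans k1 _.
Qed.

Lemma invn_small (R : realType) (d : R) : 0 < d -> exists k : nat, k.+1%:R^-1 <= d.
Proof.
move=> d0; exists (Num.truncn d^-1); rewrite -[leRHS]invrK lef_pV2 ?posrE ?invr_gt0 ?ltr0n //.
exact/ltW/truncnS_gt.
Qed.

(** Two vectors of fractional parts, of n om and n' om with n < n', that are close to a common limit
    point: q = n' - n works. *)
Lemma dirichlet (R : realType) (I : finType) (om : I -> R) (d : R) : 0 < d ->
  exists (q : nat) (N : I -> int), (0 < q)%N /\ forall i, `|q%:R * om i - (N i)%:~R| <= d.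
Proof.
move=> d0; pose F (n : nat) i := Num.floor (n%:R * om i).
pose u (n : nat) i : R := n%:R * om i - (F n i)%:~R.
have hu n i : `|u n i| <= 1.
  have h1 := floor_le (n%:R * om i); have h2 := floorD1_gt (n%:R * om i).
  rewrite intrD in h2; rewrite /u /F ger0_norm; lra.
have [v [phi h]] := subseq_conv hu.
have d2 : 0 < d / 2 by lra.
have [k hk] := invn_small d2.
have [h1 h2] := h k; set n := phi k in h1 h2.
have [h3 h4] := h n.+1; set n' := phi n.+1 in h3 h4.
have nn' : (n < n')%N by exact: leq_trans h3.
have hk' : n.+2%:R^-1 <= d / 2.
  apply: le_trans hk; rewrite lef_pV2 ?posrE ?ltr0n // ler_nat; exact: leqW.
exists (n' - n)%N, (fun i => F n' i - F n i).
split=> [|i]; first by rewrite subn_gt0.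
have -> : (n' - n)%:R * om i - (F n' i - F n i)%:~R =
   (u n' i - v i) - (u n i - v i).
  rewrite natrB; last exact: ltnW.
  rewrite intrB /u; move: (F n' i) (F n i) => A B; clear; ring.
apply: le_trans (ler_normB _ _) _.
apply: le_trans (lerD (le_trans (h4 i) hk') (le_trans (h2 i) hk)) _; lra.
Qed.

(** Dividing by the largest common power of 2 leaves integers of which one is odd, as self-avoidance
    requires. *)
Lemma two_adic (V : finType) (J : {set V}) (N : V -> int) : (exists j, j \in J) ->
  (forall j, j \in J -> N j != 0) ->
  exists v : nat, (forall j, j \in J -> exists k, N j = k * 2 ^+ v) /\
    exists j, j \in J /\ forall k, N j = k * 2 ^+ v -> ~~ (2 %| k)%Z.
Proof.
move=> [j0 Jj0] N0; pose P v := [forall (j | j \in J), ((2 ^+ v : int) %| N j)%Z].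
have exP : exists v, P v by exists 0%N; apply/forall_inP => j _; rewrite expr0 dvd1z.
have ubP v : P v -> (v <= `|N j0|)%N.
  move=> /forall_inP/(_ _ Jj0); rewrite dvdzE abszX /= => /dvdn_leq h.
  apply: leq_trans (ltnW (ltn_expl v (isT : (1 < 2)%N))) (h _).
  by rewrite absz_gt0 N0.
have [v /forall_inP Pv mx] := ex_maxnP exP ubP.
exists v; split=> [j /Pv/dvdzP[k ->]|]; first by exists k.
have /forall_inPn[j Jj nj] : ~~ P v.+1 by apply/negP => /mx; rewrite ltnn.
exists j; split => // k e; apply: contra nj => /dvdzP[l el]; apply/dvdzP; exists l.
by rewrite e el exprS -!mulrA.
Qed.

(** * Layered systems restricted to a complex line *)

Section System.
Variables (R : realType) (C0 : R) (S : set R) (c : R -> R).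
Local Notation C := R[i].
Hypothesis hc1 : summable S (EFin \o c).
Hypothesis hSd : discrete_set S.
Local Notation sg := (csig C0 S c).
Variables (V : finType) (D : {set V}) (lv : V -> nat) (a : V -> V -> R) (b : V -> R).
Implicit Types (z w : C) (x r : R) (y : V -> C) (e j : V) (n m : nat).

(* [ev y n e] is the output of node e of level n when the level-0 nodes have
   inner values y, and [inn y n e] is its inner value; a e j is the weight of
   the edge from j to e. *)
Fixpoint ev y n e : C := sg (if n is m.+1 then
  \sum_(j in D | lv j == m) rc (a e j) * ev y m j + rc (b e) else y e).

Definition inn y n e : C := if n is m.+1 then
  \sum_(j in D | lv j == m) rc (a e j) * ev y m j + rc (b e) else y e.

Lemma evE y n e : ev y n e = sg (inn y n e). Proof. by case: n. Qed.

Lemma inn_real y n e : (forall e, im (y e) = 0) -> im (inn y n e) = 0.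
Proof.
move=> hy; have evr m : (forall e, im (inn y m e) = 0) -> forall e, im (ev y m e) = 0.
  by move=> h e'; rewrite evE; have := h e'; case: (inn y m e') => u v /= ->; exact: csig_rc_im.
elim: n e => [|n IH] e //=.
rewrite imD im_rc addr0 im_sum big1 // => j _; rewrite imM im_rc mul0r addr0.
by rewrite (evr n IH) mulr0.
Qed.

Lemma inn_period y (k : V -> int) n e :
  inn (fun e => y e + 'i%C * rc (k e)%:~R) n.+1 e = inn y n.+1 e /\
  ev (fun e => y e + 'i%C * rc (k e)%:~R) n e = ev y n e.
Proof.
elim: n e => [|n IH] e.
  have h e' : ev (fun e => y e + 'i%C * rc (k e)%:~R) 0 e' = ev y 0 e' by rewrite /= csig_int.
  by split; [rewrite /inn; apply: (congr1 (fun t => t + rc (b e))); apply: eq_bigr => j _; rewrite h|exact: h].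
split; last by have [h _] := IH e; rewrite !evE h.
rewrite /inn; apply: (congr1 (fun t => t + rc (b e))); apply: eq_bigr => j _.
by have [h _] := IH j; rewrite !evE h.
Qed.

Lemma ev_period y (k : V -> int) n e : ev (fun e => y e + 'i%C * rc (k e)%:~R) n e = ev y n e.
Proof. by have [] := inn_period y k n e. Qed.

(** Real inputs give real inner values, and sigma is analytic, bounded and Lipschitz on the strip of
    half-width 1/4. By induction on the level, a thin enough strip of inputs stays inside that
    strip, with constants common to all levels up to [N]. *)
Lemma near_real N : exists h L M : R, [/\ 0 < h, 0 < L, 0 < M &
  forall n, (n <= N)%N ->
  [/\ forall y y' d, (forall e, `|im (y e)| <= h) -> (forall e, `|im (y' e)| <= h) ->
        (forall e, cn (y e - y' e) <= d) -> forall e, cn (ev y n e - ev y' n e) <= L * d,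
      forall y e, (forall e, `|im (y e)| <= h) -> `|im (inn y n e)| <= 4^-1,
      forall y e, (forall e, `|im (y e)| <= h) -> cn (ev y n e) <= M &
      forall (f : V -> C -> C) z0 r e, 0 <= r -> (forall e, appr (f e) z0 r) ->
        (forall e z, cn (z - z0) <= r -> `|im (f e z)| <= h /\ cn (f e z - f e z0) <= h) ->
        appr (fun z => inn (f ^~ z) n e) z0 r /\ appr (fun z => ev (f ^~ z) n e) z0 r]].
Proof.
have [K K0 hK] := csig_lip C0 hc1; have [r0 [M [r00 M0 hM]]] := csig_strip C0 hc1.
set A := \sum_e \sum_j `|a e j| + 1.
have A0 : 0 < A by apply: ltr_wpDl => //; apply: sumr_ge0 => e _; apply: sumr_ge0.
have hA e (P : pred V) : \sum_(j | P j) `|a e j| <= A.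
  apply: (@le_trans _ _ (\sum_j `|a e j|)).
    by rewrite [leLHS]big_mkcond; apply: ler_sum => j _; case: ifP.
  rewrite /A [X in _ <= X + 1](bigD1 e) //= -addrA lerDl addr_ge0 //.
  by apply: sumr_ge0 => e' _; apply: sumr_ge0.
have sgM y n e : `|im (inn y n e)| <= 4^-1 -> cn (ev y n e) <= M.
  by move=> h; rewrite evE; have [_ H] := hM _ h; apply: H; rewrite subrr cn0 ltW.
have main n : exists h L, [/\ 0 < h, 0 < L,
   forall y y' d, (forall e, `|im (y e)| <= h) -> (forall e, `|im (y' e)| <= h) ->
        (forall e, cn (y e - y' e) <= d) -> forall e, cn (inn y n e - inn y' n e) <= L * d &
   forall y e, (forall e, `|im (y e)| <= h) -> `|im (inn y n e)| <= 4^-1].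
  elim: n => [|n [h [L [h0 L0 h1 h2]]]].
    by exists 4^-1, 1; split => // y y' d _ _ hd e; rewrite mul1r; exact: hd.
  set L' := A * (K * L) + 1; have L'0 : 0 < L'.
    by rewrite ltr_wpDl // mulr_ge0 ?mulr_ge0 // ltW.
  (* Inputs within [h'] of real ones give inner values within [L' * h'], hence within 1/4, of real
     ones. *)
  set h' := Num.min h (4^-1 / L'); have h'0 : 0 < h' by rewrite lt_min h0 divr_gt0.
  have h'h : h' <= h by rewrite ge_min lexx.
  have lip y y' d : (forall e, `|im (y e)| <= h') -> (forall e, `|im (y' e)| <= h') ->
        (forall e, cn (y e - y' e) <= d) -> forall e, cn (inn y n.+1 e - inn y' n.+1 e) <= L' * d.
    move=> hy hy' hd e.
    have hy1 e' := le_trans (hy e') h'h; have hy1' e' := le_trans (hy' e') h'h.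
    have d0 : 0 <= d by apply: le_trans (cn_ge0 _) (hd e).
    have evd j : cn (ev y n j - ev y' n j) <= K * (L * d).
      rewrite !evE; apply: le_trans (hK _ _ (h2 _ _ hy1) (h2 _ _ hy1')) _.
      by rewrite ler_wpM2l // h1.
    rewrite /= opprD addrACA subrr addr0 -sumrB.
    apply: le_trans (sum_cn_le (G := fun j => `|a e j| * (K * (L * d))) _ _) _.
      by move=> j _; rewrite -mulrBr cnM cn_real ler_wpM2l.
    rewrite -mulr_suml; apply: (@le_trans _ _ (A * (K * (L * d)))).
      by rewrite ler_wpM2r ?hA // !mulr_ge0 // ltW.
    have -> : L' * d = A * (K * (L * d)) + d by rewrite /L'; ring.
    by rewrite lerDl.
  exists h', L'; split => // y e hy.
  have hr : forall e, im (rc (re (y e))) = 0 :> R by [].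
  have := lip y (fun e => rc (re (y e))) h' hy _ _ e.
  have hd e' : cn (y e' - rc (re (y e'))) <= h'.
    by apply: le_trans (le_cn_reim _) _; rewrite !reimE subrr normr0 add0r subr0.
  move=> /(_ _ hd)/wrap[e'|]; first by rewrite im_rc normr0 ltW.
  have := le_im_cn (inn y n.+1 e - inn (fun e => rc (re (y e))) n.+1 e).
  rewrite imD imN (inn_real _ _ hr) subr0 => l1 l2; apply: le_trans l1 (le_trans l2 _).
  by rewrite -ler_pdivlMl // mulrC ge_min lexx orbT.
have all n : exists h L, [/\ 0 < h, 0 < L & forall m, (m <= n)%N ->
   (forall y y' d, (forall e, `|im (y e)| <= h) -> (forall e, `|im (y' e)| <= h) ->
        (forall e, cn (y e - y' e) <= d) -> forall e, cn (inn y m e - inn y' m e) <= L * d) /\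
   forall y e, (forall e, `|im (y e)| <= h) -> `|im (inn y m e)| <= 4^-1].
  elim: n => [|n [h [L [h0 L0 hh]]]].
    by have [h [L [h0 L0 h1 h2]]] := main 0%N; exists h, L; split => // m; rewrite leqn0 => /eqP->.
  have [h' [L' [h'0 L'0 h1 h2]]] := main n.+1.
  exists (Num.min h h'), (Num.max L L'); split; [by rewrite lt_min h0|by rewrite lt_max L0|].
  have m1 : Num.min h h' <= h by rewrite ge_min lexx.
  have m2 : Num.min h h' <= h' by rewrite ge_min lexx orbT.
  move=> m; rewrite leq_eqVlt => /orP[/eqP->|]; last rewrite ltnS => /hh[l1 l2].
    split=> [y y' d hy hy' hd e|y e hy]; last by apply: h2 => e'; apply: le_trans m2.
    apply: le_trans (h1 _ _ _ (fun e => le_trans (hy e) m2) (fun e => le_trans (hy' e) m2) hd e) _.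
    by rewrite ler_wpM2r ?(le_trans (cn_ge0 _) (hd e)) // le_max lexx orbT.
  split=> [y y' d hy hy' hd e|y e hy]; last by apply: l2 => e'; apply: le_trans m1.
  apply: le_trans (l1 _ _ _ (fun e => le_trans (hy e) m1) (fun e => le_trans (hy' e) m1) hd e) _.
  by rewrite ler_wpM2r ?(le_trans (cn_ge0 _) (hd e)) // le_max lexx.
have [h [L [h0 L0 hh]]] := all N.
set h' := Num.min h (r0 / L); have h'0 : 0 < h' by rewrite lt_min h0 divr_gt0.
have h'h : h' <= h by rewrite ge_min lexx.
have up y : (forall e, `|im (y e)| <= h') -> forall e, `|im (y e)| <= h.
  by move=> hy e; apply: le_trans h'h.
exists h', (K * L + 1), M; split => //; first by rewrite ltr_wpDl // mulr_ge0 // ltW.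
move=> n nN; have [l1 l2] := hh n nN; split.
- move=> y y' d /up hy /up hy' hd e; rewrite !evE.
  apply: le_trans (hK _ _ (l2 _ _ hy) (l2 _ _ hy')) _.
  have d0 : 0 <= d by apply: le_trans (cn_ge0 _) (hd e).
  by rewrite mulrDl mul1r -mulrA; apply: ler_wpDr => //; rewrite ler_wpM2l // l1.
- by move=> y e /up/l2.
- by move=> y e /up/l2/sgM.
move=> f z0 r e r_0 hf hb.
have step m e' : (m <= N)%N -> appr (fun z => inn (f ^~ z) m e') z0 r -> appr (fun z => ev (f ^~ z) m e') z0 r.
  move=> mN h1; have [k1 k2] := hh m mN.
  have c0 : cn (z0 - z0) <= r by rewrite subrr cn0.
  have b0 e2 : `|im (f e2 z0)| <= h by have [+ _] := hb e2 z0 c0; move=> /le_trans; apply.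
  have [ha _] := hM _ (k2 (f ^~ z0) e' b0).
  apply: (@appr_ext _ (fun z => sg (inn (f ^~ z) m e'))) => [z _|]; first by rewrite evE.
  apply: appr_comp h1 ha _ => z zr.
  apply: le_trans (k1 _ _ h' _ b0 _ e') _.
  - by move=> e2; have [+ _] := hb e2 z zr; move=> /le_trans; apply.
  - by move=> e2; have [_] := hb e2 z zr.
  by rewrite mulrC -ler_pdivlMr // ge_min lexx orbT.
suff : appr (fun z => inn (f ^~ z) n e) z0 r by move=> h1; split => //; exact: step.
elim: n nN {l1 l2} e => [|n IH] nN e /=; first exact: hf.
apply: apprD; last exact: appr_cst.
apply: appr_sum => j _; apply: apprZ; apply: step; first exact: ltnW.
by apply: IH; exact: ltnW.
Qed.

Lemma remove_lines (T : eqType) (s : seq T) (F : T -> C -> C) (W : set C) :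
  opn W -> preconn W -> (forall x : R, W (rc x)) ->
  (forall t z, t \in s -> W z -> holo (F t) z) -> (forall t (x : R), im (F t (rc x)) = 0) ->
  let W' := [set z | W z /\ forall t, t \in s -> ~ bad S (F t z)] in
  [/\ opn W', preconn W' & forall x : R, W' (rc x)].
Proof.
move=> oW cW RW + rF; elim: s => [|t s IH] hF /=.
  have -> : [set z | W z /\ forall t, t \in [::] -> ~ bad S (F t z)] = W by apply/seteqP; split=> z //= [].
  by [].
have [|op1 c1 RR1] := IH; first by move=> t' z ts; apply: hF; rewrite inE ts orbT.
have gap := mdisc_gap (discrete_mdisc hSd).
have [||o2 c2 RR2] := remove_line gap op1 c1 RR1 (F := F t).
- by move=> z [Wz _]; apply: hF => //; rewrite mem_head.
- by move=> x; exact: rF.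
move: o2 c2 RR2; set W1 := (X in opn X) => o2 c2 RR2.
suff E : [set z | W z /\ forall t', t' \in t :: s -> ~ bad S (F t' z)] = W1.
  split; [by rewrite E|by rewrite E|move=> x].
  by have : W1 (rc x) := RR2 x; rewrite -E.
apply/seteqP; split=> z /= [].
  by move=> Wz h; split; [split => // t' ts; apply: h; rewrite inE ts orbT|apply: h; rewrite mem_head].
move=> [Wz h] h'; split => // t'; rewrite inE => /orP[/eqP->//|]; exact: h.
Qed.

Section NaturalDomain.
Variables (be v : V -> R).

Definition lin z e : C := rc (be e) + z * rc (v e).

Fixpoint ndom n : set C := if n is m.+1 then
  [set z | ndom m z /\ forall e, e \in enum [set e in D | lv e == m] -> ~ bad S (inn (lin z) m e)]
  else setT.

Lemma ndomP n : [/\ opn (ndom n), preconn (ndom n), forall x : R, ndom n (rc x),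
  forall z e, ndom n z -> holo (fun z => inn (lin z) n e) z &
  forall z e m, (m < n)%N -> ndom n z -> e \in D -> lv e = m -> holo (fun z => ev (lin z) m e) z].
Proof.
elim: n => [|n [op1 c1 RR1 h1 h2]].
  split => //; first by move=> z _; exists 1.
    by apply: convex_preconn.
  move=> z e _; apply: holoD; first exact: holo_cst.
  by apply: holoM; [exact: holo_id|exact: holo_cst].
have [||o2 c2 RR2] := @remove_lines V (enum [set e in D | lv e == n]) (fun e z => inn (lin z) n e) _ op1 c1 RR1.
- by move=> e z _ /h1.
- by move=> e x; apply: inn_real => e'; rewrite /lin -rcM -rcD.
have h3 z e : ndom n.+1 z -> e \in D -> lv e = n -> holo (fun z => ev (lin z) n e) z.
  move=> [nz gz] De le; apply: (@holo_ext _ (fun z => sg (inn (lin z) n e))).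
    by exists 1 => // w _; rewrite evE.
  apply: (holo_comp (f := fun z => inn (lin z) n e)); first exact: h1.
  by apply: csig_holo => //; apply: gz; rewrite mem_enum inE De le eqxx.
split => //.
- move=> z e nz /=; apply: holoD; last exact: holo_cst.
  by apply: holo_sum => j /andP[Dj /eqP lj]; apply: holoZ; exact: h3.
- move=> z e m; rewrite ltnS leq_eqVlt => /orP[/eqP->|mn] nz De le; first exact: h3.
  by case: nz => nz _; exact: h2.
Qed.

Lemma natural_domain : exists U : set C, [/\ opn U, preconn U, forall x : R, U (rc x),
  forall z, (forall e, e \in D -> ~ bad S (inn (lin z) (lv e) e)) -> U z &
  forall z e, U z -> e \in D -> holo (fun z => ev (lin z) (lv e) e) z].
Proof.
set N := (\max_e lv e).+1; have [op1 c1 RR1 h1 h2] := ndomP N.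
exists (ndom N); split => //; last first.
  by move=> z e Uz De; apply: h2 => //; rewrite ltnS; exact: leq_bigmax.
move=> z hz; suff : forall n, ndom n z by [].
elim=> [//|n IH]; split => // e; rewrite mem_enum inE => /andP[De /eqP <-].
exact: hz.
Qed.

End NaturalDomain.

Lemma near_int_good z (k : int) : `|im z - k%:~R| <= 4^-1 -> ~ bad S z.
Proof.
move=> h [[l el] _]; have h1 : `|(k - l)%:~R : R| < 1.
  rewrite intrB; move: h; rewrite el !ltr_norml !ler_norml => /andP[h1 h2].
  by apply/andP; split; lra.
have /eqP := int_lt1 h1; rewrite subr_eq0 => /eqP kl; move: h; rewrite el kl.
by rewrite addrC addKr ger0_norm //; lra.
Qed.

End System.

Lemma row_max_entry (R : realType) n (u : 'rV[R]_n) : u != 0 ->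
  exists i0, 0 < `|u 0 i0| /\ forall i, `|u 0 i| <= `|u 0 i0|.
Proof.
move=> /rV0Pn[i ui]; have [i0 _ hi0] := @arg_maxP _ _ _ i xpredT (fun i => `|u 0 i|) isT.
exists i0; split=> [|j]; last exact: hi0.
by apply: lt_le_trans (hi0 i isT); rewrite normr_gt0.
Qed.

(** * Integer directions *)

Section IntegerDirection.
Variables (R : realType) (C0 : R) (S : set R) (c : R -> R).
Local Notation C := R[i].
Hypothesis hc1 : summable S (EFin \o c).
Hypothesis hSd : discrete_set S.
Variables (V : finType) (D : {set V}) (lv : V -> nat) (a : V -> V -> R) (b : V -> R).
Variables (al : V -> R) (al0 : C).
Local Notation Ev := (ev C0 S c D lv a b).
Local Notation Inn := (inn C0 S c D lv a b).
Implicit Types (z : C) (x r : R) (y : V -> C) (e j : V) (k m : nat).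

Definition rel_sum y : C := \sum_(e in D) rc (al e) * Ev y (lv e) e.

Lemma rel_lip : exists h L, [/\ 0 < h, h <= 4^-1, 0 < L,
  forall y y' d, 0 <= d -> (forall e, `|im (y e)| <= h) -> (forall e, `|im (y' e)| <= h) ->
    (forall e, cn (y e - y' e) <= d) -> cn (rel_sum y - rel_sum y') <= L * d &
  forall y e, (forall e, `|im (y e)| <= h) -> `|im (Inn y (lv e) e)| <= 4^-1].
Proof.
have [h [L [M [h0 L0 M0 H]]]] := near_real C0 hc1 D lv a b (\max_e lv e).
have lN e : (lv e <= \max_e lv e)%N by exact: leq_bigmax.
have up y : (forall e, `|im (y e)| <= Num.min h 4^-1) -> forall e, `|im (y e)| <= h.
  by move=> hy e; apply: le_trans (hy e) _; rewrite ge_min lexx.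
exists (Num.min h 4^-1), (\sum_(e in D) `|al e| * L + 1); split.
- by rewrite lt_min h0 invr_gt0 ltr0n.
- by rewrite ge_min lexx orbT.
- by rewrite ltr_wpDl // sumr_ge0 // => e _; rewrite mulr_ge0 // ltW.
- move=> y y' d d0 /up hy /up hy' hd; rewrite /rel_sum -sumrB.
  apply: le_trans (sum_cn_le (G := fun e => `|al e| * L * d) _ _) _.
    move=> e _; rewrite -mulrBr cnM cn_real -mulrA ler_wpM2l //.
    by have [H1 _ _ _] := H _ (lN e); exact: H1.
  by rewrite [leRHS]mulrDl mul1r mulr_suml lerDl.
- by move=> y e /up hy; have [_ H2 _ _] := H _ (lN e); exact: H2.
Qed.

Lemma rel_period y (k : V -> int) :
  rel_sum (fun e => y e + 'i%C * rc (k e)%:~R) = rel_sum y.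
Proof. by rewrite /rel_sum; apply: eq_bigr => e _; rewrite ev_period. Qed.

Lemma rel_ext y y' : y =1 y' -> rel_sum y = rel_sum y'.
Proof. by move=> /funext ->. Qed.

Lemma rel_holo (be v : V -> R) (U : set C) :
  (forall z e, U z -> e \in D -> holo (fun z => Ev (lin be v z) (lv e) e) z) ->
  forall z, U z -> holo (fun z => rel_sum (lin be v z) - al0) z.
Proof.
move=> hU z Uz; apply: holoB; last exact: holo_cst.
by apply: holo_sum => e De; apply: holoZ; exact: hU.
Qed.

(** Continuation from the real line to the parameter i k: the contribution of [N] consists of
    periods, so only the small vector [k%:R * ek e] is felt. Its bound by [h] is what puts i k into
    the natural domain. *)
Lemma vertical_shift (h : R) (be v : V -> R) (N : V -> int) (ek : V -> R) k :
  h <= 4^-1 ->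
  (forall y e, (forall e, `|im (y e)| <= h) -> `|im (Inn y (lv e) e)| <= 4^-1) ->
  (forall x, rel_sum (fun e => rc (be e + x * v e)) = al0) ->
  (forall e, v e = (N e)%:~R + ek e) -> (forall e, `|k%:R * ek e| <= h) ->
  rel_sum (fun e => rc (be e) + 'i%C * rc (k%:R * ek e)) = al0.
Proof.
move=> h4 hI hrel vE ekh.
have [U [oU cU RU hU holU]] := natural_domain C0 hc1 hSd D lv a b be v.
set y := fun e => _.
have imy e : `|im (y e)| <= h.
  by rewrite /y !reimE mul0r mul1r !add0r.
have z0E : lin be v ('i%C * rc k%:R) =1 (fun e => y e + 'i%C * rc ((k%:Z * N e)%:~R)).
  by move=> e; rewrite /lin /y vE rcM rcD intrM rcM; ring.
have Uz : U ('i%C * rc k%:R).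
  apply: hU => e De; rewrite (funext z0E).
  case: (lv e) (hI y e imy) => [|m] him.
    apply: (@near_int_good _ _ _ (k%:Z * N e)); rewrite /inn /y !reimE !mul0r !mul1r !add0r addrK.
    by apply: le_trans h4; exact: ekh.
  have [-> _] := inn_period C0 S c D lv a b y (fun e => k%:Z * N e) m e.
  by apply: (@near_int_good _ _ _ 0); rewrite subr0.
have hol := rel_holo holU.
have := @identity_real _ U _ 0 1 cU hol (RU 0) ltr01 _ _ Uz.
rewrite (rel_ext z0E) rel_period => h1; apply/eqP; rewrite -subr_eq0; apply/eqP; apply: h1.
move=> x _; rewrite -(hrel x); apply/eqP; rewrite subr_eq0; apply/eqP; apply: rel_ext => e.
by rewrite /lin rcD rcM.
Qed.

(** The converse passage: a relation on a short imaginary segment at 0 continues to the real line by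
    isolated zeros. *)
Lemma imaginary_direction (h : R) (be v : V -> R) : 0 < h ->
  (forall r, 0 < r < h -> rel_sum (fun e => rc (be e) + 'i%C * rc (r * v e)) = al0) ->
  forall x, rel_sum (fun e => rc (be e + x * v e)) = al0.
Proof.
move=> h0 hr x.
have [U [oU cU RU hU holU]] := natural_domain C0 hc1 hSd D lv a b be v.
have hol := rel_holo holU.
have near0 : exists2 d, 0 < d & forall z, cn (z - rc 0) < d -> rel_sum (lin be v z) - al0 = 0.
  have [//|[d d0 hd]] := zero_dich (hol _ (RU 0)).
  exfalso; pose r := Num.min h d / 2.
  have m0 : 0 < Num.min h d by rewrite lt_min h0.
  have mh : Num.min h d <= h by rewrite ge_min lexx.
  have md : Num.min h d <= d by rewrite ge_min lexx orbT.
  have r0 : 0 < r by rewrite /r; lra.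
  have cr : cn ('i%C * rc r - rc 0 : C) = r by rewrite subr0 cnM cn_i mul1r cn_real gtr0_norm.
  apply: (hd ('i%C * rc r)); rewrite ?cr //; first by rewrite /r; lra.
  rewrite -(hr r); last by apply/andP; split => //; rewrite /r; lra.
  apply/eqP; rewrite subr_eq0; apply/eqP; apply: rel_ext => e.
  by rewrite /lin rcM; ring.
have := identity_thm cU hol (RU 0) near0 (RU x) => /eqP; rewrite subr_eq0 => /eqP <-.
by apply: rel_ext => e; rewrite /lin rcD rcM.
Qed.

Let n := #|V|.
Let vf (u : 'rV[R]_n) e := u 0 (enum_rank e).
Let rvec (f : V -> R) : 'rV[R]_n := \row_i f (enum_val i).

Let vfK f e : vf (rvec f) e = f e.
Proof. by rewrite /vf mxE enum_rankK. Qed.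

Let relR m (W : 'M[R]_(m, n)) := forall u, (u <= W)%MS -> rel_sum (fun e => rc (b e + vf u e)) = al0.

Let relR_line m (W : 'M[R]_(m, n)) u d x : relR W -> (u <= W)%MS -> (d <= W)%MS ->
  rel_sum (fun e => rc (b e + vf u e + x * vf d e)) = al0.
Proof.
move=> hW uW dW; have <- := hW (u + x *: d); last by rewrite addmx_sub // scalemx_sub.
by apply: rel_ext => e; rewrite /vf !mxE addrA.
Qed.

Let relR_add (h : R) (W : 'M[R]_n) (v : 'rV[R]_n) : 0 < h ->
  (forall w r, (w <= W)%MS -> 0 < r < h ->
    rel_sum (fun e => rc (b e + vf w e) + 'i%C * rc (r * vf v e)) = al0) -> relR (W + v)%MS.
Proof.
move=> h0 hW u /sub_addsmxP[[u1 u2] /= ->].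
have <- := imaginary_direction h0 (fun r => hW (u1 *m W) r (submxMl _ _)) (u2 0 0).
apply: rel_ext => e; rewrite [u2]mx11_scalar mul_scalar_mx /vf !mxE.
by rewrite eqxx mulr1n addrA.
Qed.

(* The closure of a one-parameter subgroup of a torus is a subtorus; the
   maximal relation subspace W plays the role of its Lie algebra. *)
Lemma integer_direction (om : V -> R) (del : R) : 0 < del ->
  (forall x, rel_sum (fun e => rc (b e + x * om e)) = al0) ->
  exists (q : nat) (N : V -> int), [/\ (0 < q)%N, forall e, `|q%:R * om e - (N e)%:~R| <= del &
    forall x, rel_sum (fun e => rc (b e + x * (N e)%:~R)) = al0].
Proof.
move=> del0 hom; set omr := rvec om.
(* Ranks of the subspaces that contain [om] and along which the relation holds; [W] below has
   maximal rank. *)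
pose Q (r : nat) := `[< exists W : 'M[R]_n, [/\ relR W, (omr <= W)%MS & \rank W = r] >].
have exQ : exists r : nat, Q r.
  exists (\rank <<omr>>%MS); apply/asboolP; exists <<omr>>%MS; split => //; last by rewrite genmxE.
  move=> u; rewrite genmxE => /sub_rVP[x ->]; rewrite -(hom x); apply: rel_ext => e.
  by rewrite /vf mxE -/(vf _ _) vfK.
have ubQ (r : nat) : Q r -> (r <= n)%N by move=> /asboolP[W [_ _ <-]]; exact: rank_leq_row.
have [r /asboolP[W [hW omW rW]] mx] := ex_maxnP exQ ubQ.
have [h [L [h0 h4 L0 hL hI]]] := rel_lip.
(* Projection to a complement along [W]: it extracts the part of an approximation error that [W]
   does not absorb. *)
pose P := proj_mx W^C%MS W.
have full (u : 'rV[R]_n) : (u <= W^C + W)%MS by apply: submx_full; rewrite addsmxC addsmx_compl_full.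
have cap0 : (W^C :&: W = 0)%MS by rewrite capmxC capmx_compl.
have Psub (u : 'rV[R]_n) : (u - u *m P <= W)%MS by exact: proj_mx_compl_sub.
have Pid (u : 'rV[R]_n) : u *m P *m P = u *m P by apply: proj_mx_id => //; exact: proj_mx_sub.
have P0 (u : 'rV[R]_n) : (u <= W)%MS -> u *m P = 0 by exact: proj_mx_0.
set K := \sum_(j' < n) \sum_i `|P i j'| + 1.
have K0 : 0 < K by rewrite ltr_wpDl // sumr_ge0 // => i _; rewrite sumr_ge0.
have bdP (u : 'rV[R]_n) (d : R) : (forall i, `|u 0 i| <= d) -> forall i', `|(u *m P) 0 i'| <= K * d.
  move=> hu i'; have d0 : 0 <= d by apply: le_trans (hu i').
  rewrite mxE; apply: le_trans (ler_norm_sum _ _ _) _.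
  apply: (@le_trans _ _ (\sum_i d * `|P i i'|)); first by apply: ler_sum => i _; rewrite normrM ler_wpM2r.
  rewrite -mulr_sumr mulrC ler_wpM2r // /K [X in _ <= X + 1](bigD1 i') //= -addrA lerDl addr_ge0 //.
  by rewrite sumr_ge0 // => j' _; rewrite sumr_ge0.
apply: contrapT => none.
(* If that part vanished for an approximation of q om by [N], then [N] would lie in [W] and be an
   admissible direction. So there are arbitrarily small non-zero errors [d.2] with [d.1 + d.2] in
   [W]. *)
have /choice[d hd] : forall k, exists d : (V -> int) * 'rV[R]_n, [/\ d.2 != 0, forall i, `|d.2 0 i| <= K * k.+1%:R^-1,
   d.2 *m P = d.2 & ((rvec (fun e => (d.1 e)%:~R) + d.2)%R <= W)%MS].
  move=> k; have kp : 0 < k.+1%:R^-1 :> R by rewrite invr_gt0 ltr0n.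
  have [|q [N [q0 hN]]] := @dirichlet _ _ om (Num.min del k.+1%:R^-1); first by rewrite lt_min del0.
  set Nr := rvec (fun e => (N e)%:~R); pose eps : 'rV[R]_n := q%:R *: omr - Nr.
  have epsE i : eps 0 i = q%:R * om (enum_val i) - (N (enum_val i))%:~R by rewrite /eps /omr /Nr !mxE.
  have NW : ((Nr + eps *m P)%R <= W)%MS.
    have -> : Nr + eps *m P = (q%:R *: omr - (eps - eps *m P))%R.
      by rewrite /eps; move: (_ *m P) => X; rewrite !opprB addrA addrC addrA subrK addrC.
    by rewrite addmx_sub ?scalemx_sub // eqmx_opp.
  exists (N, eps *m P); split => //=.
    apply/negP => /eqP e0; apply: none; exists q, N; split => // [e|x].
      by apply: le_trans (hN e) _; rewrite ge_min lexx.
    rewrite e0 addr0 in NW; have <- := hW (x *: Nr); last exact: scalemx_sub.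
    by apply: rel_ext => e; rewrite /vf mxE -/(vf _ _) vfK.
  apply: bdP => i; rewrite epsE; apply: le_trans (hN _) _; by rewrite ge_min lexx orbT.
pose e k := (d k).2.
have /choice[i0 hi0] : forall k, exists i0, 0 < `|e k 0 i0| /\ forall i, `|e k 0 i| <= `|e k 0 i0|.
  by move=> k; have [e0 _ _ _] := hd k; exact: row_max_entry.
pose M k := `|e k 0 (i0 k)|; have M0 k : 0 < M k by have [] := hi0 k.
pose u k i := e k 0 i / M k.
have hu k i : `|u k i| <= 1.
  by rewrite /u normrM normfV (gtr0_norm (M0 k)) ler_pdivrMr // mul1r; have [_] := hi0 k; apply.
have eu k i : e k 0 i = M k * u k i by rewrite /u mulrC divfK // gt_eqF.
(* A limit of the errors divided by their largest entry. It lies outside [W], because the errors are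
   fixed by [P] and normalised. *)
have [v [phi hphi]] := subseq_conv hu.
pose vr : 'rV[R]_n := \row_i v i.
have vW : ~ (vr <= W)%MS.
  move=> /P0 vP; have K2 : 0 < (2 * K)^-1 by rewrite invr_gt0 mulr_gt0.
  have [k hk] := invn_small K2; have [_ h2] := hphi k; set k' := phi k in h2.
  pose ur : 'rV[R]_n := \row_i u k' i.
  have urE : ur = (M k')^-1 *: e k' by apply/rowP => i; rewrite !mxE mulrC.
  have uP : ur *m P = ur by rewrite urE -scalemxAl; have [_ _ -> _] := hd k'.
  have := bdP (ur - vr) k.+1%:R^-1 _ (i0 k').
  move=> /(_ _)/wrap[i|]; first by rewrite !mxE; exact: h2.
  rewrite mulmxBl vP subr0 uP mxE => h3.
  have : `|u k' (i0 k')| = 1.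
    by rewrite /u normrM normfV (gtr0_norm (M0 k')) -/(M k') mulfV // gt_eqF.
  move=> e1; move: h3; rewrite e1; have : K * k.+1%:R^-1 <= K * (2 * K)^-1 by rewrite ler_pM2l.
  have -> : K * (2 * K)^-1 = 2^-1 by rewrite invfM mulrCA mulfV ?mulr1 // gt_eqF.
  move=> h5 h6; move: (le_trans h6 h5); apply/negP.
  by rewrite -ltNge invf_lt1 ?ltr1n // ltr0n.
have v2 i : `|v i| <= 2.
  have [_ /(_ i)] := hphi 0%N; rewrite invr1 => h1.
  have -> : v i = u (phi 0%N) i - (u (phi 0%N) i - v i) by ring.
  by apply: le_trans (ler_normB _ _) _; have := hu (phi 0%N) i; lra.
(* The multiple [l] of a small error approximates r' v to within a small distance, and
   [vertical_shift] gives the relation at each such multiple. Hence the relation holds along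
   [W + vr], against maximality. *)
have key w r' : (w <= W)%MS -> 0 < r' < h / 2 ->
    rel_sum (fun e => rc (b e + vf w e) + 'i%C * rc (r' * vf vr e)) = al0.
  move=> wW /andP[r0 rh]; apply/eqP; rewrite -subr_eq0; apply/eqP.
  apply: (@cn_small0 _ _ (L * (K + h))) => ep ep0; have [k hk] := invn_small ep0.
  have [h1 h2] := hphi k; set k' := phi k in h1 h2; pose l := Num.truncn (r' / M k').
  have /andP[l1 l2] : l%:R <= r' / M k' < l.+1%:R.
    by apply: truncn_itv; rewrite divr_ge0 // ltW.
  rewrite ler_pdivlMr // in l1; rewrite ltr_pdivrMr // -natr1 mulrDl mul1r in l2.
  have kk : k'.+1%:R^-1 <= ep.
    by apply: le_trans hk; rewrite lef_pV2 ?posrE ?ltr0n // ler_nat ltnS.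
  have Mk : M k' <= K * ep.
    by have [_ h3 _ _] := hd k'; apply: le_trans (h3 _) _; rewrite ler_pM2l.
  have leh i : `|l%:R * e k' 0 i| <= h.
    rewrite normrM (ger0_norm (ler0n _ _)); apply: (@le_trans _ _ (l%:R * M k')); last by lra.
    by rewrite ler_wpM2l //; have [_] := hi0 k'; apply.
  have [_ _ _ dW] := hd k'.
  have sh : rel_sum (fun e0 => rc (b e0 + vf w e0) + 'i%C * rc (l%:R * vf (e k') e0)) = al0.
    apply: (@vertical_shift h _ (vf (rvec (fun e => ((d k').1 e)%:~R) + (d k').2)) (d k').1) => //.
    - by move=> x; exact: (relR_line x hW wW dW).
    - by move=> e0; rewrite {1}/vf mxE -/(vf _ _) vfK.
    - by move=> e0; exact: leh.
  have d0 : 0 <= (K + h) * ep by apply: mulr_ge0; [apply: addr_ge0; exact: ltW|exact: ltW].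
  rewrite -sh -mulrA; apply: hL => // e0.
  - rewrite !reimE mul0r mul1r !add0r /vf mxE normrM (gtr0_norm r0).
    by have := v2 (enum_rank e0); have := normr_ge0 (v (enum_rank e0)); nra.
  - by rewrite !reimE mul0r mul1r !add0r; exact: leh.
  rewrite opprD addrACA subrr add0r -mulrBr cnM cn_i mul1r -rcB cn_real /vf mxE eu.
  set i := enum_rank e0.
  have -> : r' * v i - l%:R * (M k' * u k' i) = (r' - l%:R * M k') * u k' i - r' * (u k' i - v i) by ring.
  apply: le_trans (ler_normB _ _) _; rewrite [leRHS]mulrDl; apply: lerD.
    rewrite normrM; apply: le_trans (ler_piMr _ (hu _ _)) _ => //.
    by rewrite ger0_norm; lra.
  rewrite normrM (gtr0_norm r0); apply: ler_pM => //; [exact: ltW|lra|].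
  exact: le_trans (h2 i) hk.
have h2 : 0 < h / 2 by lra.
have : Q (\rank (W + vr)%MS).
  apply/asboolP; exists (W + vr)%MS; split => //; first exact: relR_add h2 key.
  exact: submx_trans omW (addsmxSl _ _).
move=> /mx; rewrite leqNgt -rW => /negP; apply; apply: rank_ltmx.
rewrite /ltmx addsmxSl /=; apply/negP => h3; apply: vW.
exact: submx_trans (addsmxSr _ _) h3.
Qed.

End IntegerDirection.

(** * Decoupling at a pole *)

Section FiniteDifferences.
Variable R : realType.
Local Notation C := R[i].
Implicit Types (f g : R -> C) (x h : R) (M : nat).

Fixpoint fd M h f x : C := if M is M'.+1 then fd M' h f (x + h) - fd M' h f x else f x.

Lemma fd_ext M h f g x : (forall k, (k <= M)%N -> f (x + k%:R * h) = g (x + k%:R * h)) ->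
  fd M h f x = fd M h g x.
Proof.
elim: M x => [|M IH] x H /=; first by have := H 0%N isT; rewrite mul0r addr0.
congr (_ - _); apply: IH => k kM; last by apply: H; exact: leqW.
have -> : x + h + k%:R * h = x + k.+1%:R * h by rewrite -(natr1 k); ring.
exact: H.
Qed.

Lemma fdD M h f g x : fd M h (fun x => f x + g x) x = fd M h f x + fd M h g x.
Proof. by elim: M x => [//|M IH] x /=; rewrite !IH; ring. Qed.

Lemma fdZ M h c f x : fd M h (fun x => c * f x) x = c * fd M h f x.
Proof. by elim: M x => [//|M IH] x /=; rewrite !IH; ring. Qed.

Lemma fd_sum (I : Type) (s : seq I) M h (F : I -> R -> C) x :
  fd M h (fun x => \sum_(i <- s) F i x) x = \sum_(i <- s) fd M h (F i) x.
Proof.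
elim: M x => [//|M IH] x /=; rewrite !IH -sumrB; by apply: eq_bigr.
Qed.

Lemma fd_bound M h f x B : (forall k, (k <= M)%N -> cn (f (x + k%:R * h)) <= B) ->
  cn (fd M h f x) <= 2 ^+ M * B.
Proof.
elim: M x => [|M IH] x H /=; first by rewrite expr0 mul1r; have := H 0%N isT; rewrite mul0r addr0.
apply: le_trans (cnB _ _) _; rewrite exprS -mulrA mulrDl mul1r; apply: lerD; apply: IH => k kM.
  have -> : x + h + k%:R * h = x + k.+1%:R * h by rewrite -(natr1 k); ring.
  exact: H.
by apply: H; exact: leqW.
Qed.

Lemma fdS M h f x : fd M.+1 h f x = fd M h (fun x => f (x + h) - f x) x.
Proof.
elim: M x => [//|M IH] x; rewrite -[LHS]/(fd M.+1 h f (x + h) - fd M.+1 h f x) !IH //.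
Qed.

Lemma fd0 M h x : fd M h (fun=> 0) x = 0.
Proof. by elim: M x => [//|M IH] x /=; rewrite !IH subrr. Qed.

Lemma fd_cst M h c x : fd M.+1 h (fun=> c) x = 0.
Proof. by rewrite fdS -(fd0 M h x); apply: fd_ext => k _; rewrite subrr. Qed.

Lemma fd_monomial M n h x : (n < M)%N -> fd M h (fun x => rc x ^+ n) x = 0.
Proof.
elim: M n x => [//|M IH] n x nM; rewrite fdS.
rewrite (@fd_ext _ _ _ (fun x => \sum_(i < n) ((rc h ^+ (n - i)) *+ 'C(n, i)) * rc x ^+ i)); last first.
  move=> k _; move: (x + k%:R * h) => t.
  rewrite rcD [rc t + rc h]addrC exprDn big_ord_recr /= subnn expr0 mul1r binn mulr1n addrK.
  by apply: eq_bigr => i _; rewrite mulrnAl.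
rewrite fd_sum big1 // => i _; rewrite fdZ IH ?mulr0 //.
by apply: leq_trans (ltn_ord i) _.
Qed.

(** The difference kills the Taylor polynomial of degree below [M]. On a segment of fixed length it
    thus gains a factor of order r^-M, and r will be proportional to t. *)
Lemma fd_appr (G : C -> C) (t r B : R) M h x : 0 < r -> appr G ('i%C * rc t) r ->
  (forall u, cn (u - 'i%C * rc t) <= r -> cn (G u) <= B) ->
  `|x| + M%:R * `|h| <= r / 2 ->
  cn (fd M h (fun x => G (rc x + 'i%C * rc t)) x) <= 2 ^+ M * (2 * B * ((`|x| + M%:R * `|h|) / r) ^+ M).
Proof.
move=> r0 hG hB hX; have [a ha hT] := taylor r0 hG hB.
have e : fd M h (fun x => \sum_(n < M) a n * rc x ^+ n) x = 0.
  by rewrite fd_sum big1 // => n _; rewrite fdZ fd_monomial ?mulr0.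
have B0 : 0 <= B by apply: le_trans (cn_ge0 _) (hB ('i%C * rc t) _); rewrite subrr cn0 ltW.
rewrite -[fd _ _ _ _]subr0 -e -[- fd _ _ _ _]mulN1r -fdZ -fdD; apply: fd_bound => k kM.
rewrite mulN1r [rc _ + _]addrC; apply: le_trans (hT M _ _) _.
  rewrite cn_real; apply: le_trans hX; apply: le_trans (ler_normD _ _) _.
  by rewrite lerD2l normrM (ger0_norm (ler0n _ _)) ler_wpM2r // ler_nat.
rewrite ler_wpM2l ?mulr_ge0 // lerXn2r ?nnegrE ?divr_ge0 ?cn_ge0 ?addr_ge0 ?mulr_ge0 ?(ltW r0) //.
rewrite ler_pM2r ?invr_gt0 // cn_real; apply: le_trans (ler_normD _ _) _.
by rewrite lerD2l normrM (ger0_norm (ler0n _ _)) ler_wpM2r // ler_nat.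
Qed.

(** Bounded polynomial sequences are constant: a non-zero constant value of one difference would
    make the preceding one grow linearly. *)
Lemma fd_zero_periodic M h f B : (forall x, cn (f x) <= B) ->
  (forall x, fd M.+1 h f x = 0) -> forall x, f (x + h) = f x.
Proof.
move=> fB; elim: M => [|M IH] H x; first by apply/eqP; rewrite -subr_eq0; apply/eqP; exact: H.
apply: IH => {}x; pose e := fd M h f.
have per t : fd M.+1 h f (t + h) = fd M.+1 h f t.
  by apply/eqP; rewrite -subr_eq0; apply/eqP; exact: (H t).
set ga := fd M.+1 h f x.
have perk k : fd M.+1 h f (x + k%:R * h) = ga.
  elim: k => [|k IHk]; first by rewrite mul0r addr0.
  by have -> : x + k.+1%:R * h = x + k%:R * h + h by [rewrite -(natr1 k); ring]; rewrite per.
have ek k : e (x + k%:R * h) = e x + k%:R * ga.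
  elim: k => [|k IHk]; first by rewrite !mul0r !addr0.
  have -> : x + k.+1%:R * h = x + k%:R * h + h by rewrite -(natr1 k); ring.
  have := perk k; rewrite -[fd _ _ _ _]/(e (x + k%:R * h + h) - e (x + k%:R * h)) IHk => h1.
  have -> : e (x + k%:R * h + h) = (e (x + k%:R * h + h) - (e x + k%:R * ga)) + (e x + k%:R * ga) by ring.
  by rewrite h1 -(natr1 k); ring.
have eB t : cn (e t) <= 2 ^+ M * B by apply: fd_bound => k _; exact: fB.
apply: (@cn_small0 _ _ (2 * (2 ^+ M * B))) => ep ep0.
have [k hk] := invn_small ep0.
have k0 : 0 < k.+1%:R :> R by rewrite ltr0n.
have h1 : k.+1%:R * cn ga <= 2 * (2 ^+ M * B).
  have -> : k.+1%:R * cn ga = cn (e (x + k.+1%:R * h) - e x) by rewrite ek addrC addKr cnM cn_nat.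
  by apply: le_trans (cnB _ _) _; have := eB x; have := eB (x + k.+1%:R * h); lra.
have b0 : 0 <= 2 * (2 ^+ M * B) by apply: le_trans h1; rewrite mulr_ge0 ?cn_ge0 // ltW.
apply: le_trans (_ : 2 * (2 ^+ M * B) * k.+1%:R^-1 <= _); last by rewrite ler_wpM2l.
by rewrite ler_pdivlMr // mulrC.
Qed.

End FiniteDifferences.

Lemma dirichlet_large (R : realType) (I : finType) (W : I -> R) (d T : R) : 0 < d ->
  exists (t : R) (N : I -> int), T <= t /\ forall i, `|W i * t - (N i)%:~R| <= d.
Proof.
move=> d0; pose m := (Num.truncn `|T|).+1.
have m0 : 0 < m%:R :> R by rewrite ltr0n.
have [q [N [q0 hN]]] := dirichlet W (divr_gt0 d0 m0).
exists (m%:R * q%:R), (fun i => m%:Z * N i); split=> [|i].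
  apply: le_trans (ler_norm _) _; apply: le_trans (ltW (truncnS_gt _)) _.
  by rewrite ler_peMr ?ler0n // ler1n.
have -> : W i * (m%:R * q%:R) - (m%:Z * N i)%:~R = m%:R * (q%:R * W i - (N i)%:~R) by rewrite intrM; ring.
rewrite normrM (gtr0_norm m0); apply: le_trans (ler_wpM2l (ltW m0) (hN i)) _.
by rewrite mulrCA mulfV ?mulr1 // gt_eqF.
Qed.

Lemma inv_sub_inv (F : fieldType) (p y : F) : p != 0 -> y + p != 0 ->
  p^-1 - (y + p)^-1 = y * p^-1 * (y + p)^-1.
Proof. by move=> p0 y0; field; rewrite p0 y0. Qed.

Section Decouple.
Variables (R : realType) (I : finType).
Local Notation C := R[i].
Variables (A : R -> (I -> R) -> C -> C) (F : C -> C) (W : I -> R) (al0 : C).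
Variables (eta d B L K ka T : R).
Hypotheses (eta0 : 0 < eta) (d0 : 0 < d) (B0 : 0 < B) (L0 : 0 < L) (K0 : 0 < K) (ka0 : 0 < ka).
Hypotheses (ka2 : ka <= 2^-1) (T0 : 1 <= T) (Td : 2 / d <= T).
Hypothesis hA : forall x s, (forall i, `|s i| <= eta) ->
  appr (A x s) 0 d /\ forall w, cn w <= d -> cn (A x s w) <= B.
Hypothesis hL : forall x s s' de, (forall i, `|s i| <= eta) -> (forall i, `|s' i| <= eta) -> 0 <= de ->
  (forall i, `|s i - s' i| <= de) -> forall w, cn w <= d -> cn (A x s w - A x s' w) <= L * de.
Hypothesis hF : forall t, T <= t -> appr (fun u => F u^-1) ('i%C * rc t) (ka * t) /\
  forall u, cn (u - 'i%C * rc t) <= ka * t -> cn (F u^-1) <= K * t.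
Hypothesis hrel : forall (x t : R) (k : I -> int), T <= t ->
  (forall i, `|W i * t - (k i)%:~R| <= eta) ->
  A x (fun i => W i * t - (k i)%:~R) (rc x + 'i%C * rc t)^-1 + F (rc x + 'i%C * rc t)^-1 = al0.

Let small (s : I -> R) := forall i, `|s i| <= eta.

Let coefs : exists a : R -> (I -> R) -> nat -> C, forall x s, small s ->
  (forall n, cn (a x s n) * d ^+ n <= B) /\
  forall M z, cn z <= d / 2 -> cn (A x s z - \sum_(n < M) a x s n * z ^+ n) <= 2 * B * (cn z / d) ^+ M.
Proof.
have h (p : R * (I -> R)) : exists a : nat -> C, small p.2 ->
  (forall n, cn (a n) * d ^+ n <= B) /\
  forall M z, cn z <= d / 2 -> cn (A p.1 p.2 z - \sum_(n < M) a n * z ^+ n) <= 2 * B * (cn z / d) ^+ M.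
  have [sp|ns] := pselect (small p.2); last by exists (fun=> 0).
  have [h1 h2] := hA p.1 sp.
  have [|a a1 a2] := taylor d0 h1 (B := B); first by move=> z; rewrite subr0; exact: h2.
  by exists a => _; split => // M z zd; have := a2 M z zd; rewrite add0r.
have [a ha] := choice h; exists (fun x s => a (x, s)) => x s; exact: (ha (x, s)).
Qed.

(** The phases [s] record W t modulo integers. By induction on [l], the Taylor coefficient of index
    [l] does not depend on x at any attained phase: in the relation, [F] and the lower terms are
    analytic in u = x + i t on discs of radius proportional to t, so high differences in x nearly
    kill them, whereas the term of index [l] has size t^-l. *)
Lemma decouple x w : cn w <= d / 2 -> A x (fun=> 0) w = A 0 (fun=> 0) w.
Proof.
have [a ha] := coefs.
have eta0' := eta0; have d0' := d0; have B0' := B0; have L0' := L0; have K0' := K0.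
have ka0' := ka0; have ka2' := ka2; have T0' := T0; have Td' := Td.
have cU r n z : (cn z / d) ^+ n * r = r / d ^+ n * cn z ^+ n by rewrite expr_div_n mulrC mulrA mulrAC.
have alip x' s s' de n : small s -> small s' -> 0 <= de -> (forall i, `|s i - s' i| <= de) ->
    cn (a x' s n - a x' s' n) <= L * de / d ^+ n.
  move=> ss ss' de0 hd; have [a1 a2] := ha x' s ss; have [b1 b2] := ha x' s' ss'.
  have [A1 _] := hA x' ss; have [A2 _] := hA x' ss'.
  have [|g g1 g2] := taylor d0 (apprB A1 A2) (B := L * de).
    by move=> z; rewrite subr0; exact: hL.
  have -> : a x' s n - a x' s' n = g n; last by rewrite ler_pdivlMr ?exprn_gt0.
  have d2 : 0 < d / 2 by rewrite divr_gt0.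
  apply: (@taylor_uniq _ (fun z => A x' s z - A x' s' z) (fun n => a x' s n - a x' s' n) g (d / 2)
     (fun M => (4 * B + 2 * (L * de)) / d ^+ M) d2 _ _ n).
    move=> M z zd; rewrite -cU; have := a2 M z zd; have := b2 M z zd.
    have -> : A x' s z - A x' s' z - \sum_(n0 < M) (a x' s n0 - a x' s' n0) * z ^+ n0 =
      (A x' s z - \sum_(n0 < M) a x' s n0 * z ^+ n0) - (A x' s' z - \sum_(n0 < M) a x' s' n0 * z ^+ n0).
      under eq_bigr do rewrite mulrBl.
      by rewrite sumrB; ring.
    have t0 : 0 <= (cn z / d) ^+ M by rewrite exprn_ge0 // divr_ge0 ?cn_ge0 // ltW.
    have : 0 <= L * de by rewrite mulr_ge0 // ltW.
    by move=> l0 h1 h2; apply: le_trans (cnB _ _) _; nra.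
  move=> M z zd; rewrite -cU; have := g2 M z zd; rewrite add0r => h1; apply: le_trans h1 _.
  have t0 : 0 <= (cn z / d) ^+ M by rewrite exprn_ge0 // divr_ge0 ?cn_ge0 // ltW.
  have : 0 <= B * (cn z / d) ^+ M by rewrite mulr_ge0 // ltW.
  nra.
have aB x' s n : small s -> cn (a x' s n) <= B / d ^+ n.
  by move=> ss; rewrite ler_pdivlMr ?exprn_gt0 //; have [] := ha x' s ss.
(* All attained phases are treated together, because the induction hypothesis is used at a nearby
   phase attained at a large t. *)
have key l : forall t0 (k0 : I -> int), (forall i, `|W i * t0 - (k0 i)%:~R| < eta) ->
    forall x1 x2, a x1 (fun i => W i * t0 - (k0 i)%:~R) l = a x2 (fun i => W i * t0 - (k0 i)%:~R) l.
  elim/ltn_ind: l => l IH t0 k0 hs; set s := fun i => _.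
  have ss : small s by move=> i; exact/ltW/hs.
  suff per x1 h : a (x1 + h) s l = a x1 s l.
    by move=> x1 x2; rewrite -(subrK x1 x2) [x2 - _ + _]addrC per.
  apply: (@fd_zero_periodic _ l.+1 h (fun x => a x s l) (B / d ^+ l)) => [x'|{}x1]; first exact: aB.
  (* [F] grows like t and a difference of order [M] gains t^-M; the order l + 2 leaves t^-(l + 1),
     one power below the term of index [l]. *)
  set M := l.+2.
  set X := `|x1| + M%:R * `|h|.
  have X0 : 0 <= X by rewrite addr_ge0 // mulr_ge0.
  set K' := K + \sum_(j < l) B / d ^+ j * 2 ^+ j.
  set C1 := 2 ^+ M * (2 * K' * (X / ka) ^+ M).
  set C2 := 2 ^+ M * (2 * B / d ^+ l.+1 + B / d ^+ l * (l%:R * X)).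
  apply: (@cn_small0 _ _ (C1 + C2 + 2 ^+ M * (L / d ^+ l))) => ep ep0.
  have [de de0 hde] : exists2 de, 0 < de & forall i, `|s i| + de <= eta.
    apply: fin_delta => [i|i u v h1 _ vu]; last by lra.
    by exists (eta - `|s i|); [rewrite subr_gt0; exact: hs|lra].
  pose e' := Num.min (de / 2) ep.
  have e'0 : 0 < e' by rewrite lt_min ep0; lra.
  have e'ep : e' <= ep by rewrite ge_min lexx orbT.
  have e'de : e' <= de / 2 by rewrite ge_min lexx.
  (* An almost-period: [t0 + sg] is as large as needed while the phase moves by at most [e']. *)
  have [sg [N [sg1 hN]]] := dirichlet_large W (`|T| + `|t0| + 2 * X / ka + ep^-1) e'0.
  set t := t0 + sg; pose k i := k0 i + N i.
  have Xka : 0 <= 2 * X / ka by rewrite divr_ge0 ?mulr_ge0 // ltW.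
  have iep : 0 < ep^-1 by rewrite invr_gt0.
  have tb : `|T| + 2 * X / ka + ep^-1 <= t by have := ler_norm (- t0); rewrite normrN /t; lra.
  have tT : T <= t by have := ler_norm T; lra.
  have t1 : 1 <= t by lra.
  have tX : X <= ka * t / 2.
    have : 2 * X / ka <= t by have := normr_ge0 T; lra.
    by rewrite ler_pdivrMr //; lra.
  have tep : t^-1 <= ep by rewrite -[leRHS]invrK lef_pV2 ?posrE //; have := normr_ge0 T; lra.
  set s' := fun i => W i * t - (k i)%:~R.
  have ss'e i : `|s i - s' i| <= e'.
    have -> : s i - s' i = - (W i * sg - (N i)%:~R) by rewrite /s /s' /t /k intrD; ring.
    by rewrite normrN.
  have s's i : `|s' i| < eta.
    have -> : s' i = s i - (s i - s' i) by ring.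
    by apply: le_lt_trans (ler_normB _ _) _; have := ss'e i; have := hde i; lra.
  have ss' : small s' by move=> i; exact/ltW/s's.
  have cstj j x' : (j < l)%N -> a x' s' j = a 0 s' j by move=> jl; exact: (IH j jl t k).
  (* The lower coefficients are taken at x = 0, as the induction hypothesis permits, so that [g]
     depends on x only through u. *)
  pose g (u : C) := - F u^-1 + (-1) * (\sum_(j < l) a 0 s' j * u^-1 ^+ j).
  have tp : 0 < t by lra.
  have ct : cn ('i%C * rc t : C) = t by rewrite cnM cn_i mul1r cn_real gtr0_norm.
  have kt : 0 < ka * t by rewrite mulr_gt0.
  have far u : cn (u - 'i%C * rc t) <= ka * t -> t / 2 <= cn u.
    move=> ut; have -> : u = 'i%C * rc t - ('i%C * rc t - u) by ring.
    by apply: le_trans (cn_le_sub _ _); rewrite ct cn_distC; nra.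
  have it0 : ('i%C * rc t : C) != 0 by rewrite -cn_gt0 ct.
  have [F1 F2] := hF tT.
  have gA : appr g ('i%C * rc t) (ka * t).
    apply: apprD; first exact: apprN.
    apply: apprZ; apply: appr_sum => j _; apply: apprZ; apply: apprX.
    by apply: appr_rad (appr_inv it0) _; rewrite ct; nra.
  have gB u : cn (u - 'i%C * rc t) <= ka * t -> cn (g u) <= K' * t.
    move=> ut; rewrite /g mulN1r -opprD cnN; apply: le_trans (cnD _ _) _.
    rewrite /K' mulrDl; apply: lerD; first exact: F2.
    rewrite mulr_suml; apply: sum_cn_le => j _; rewrite cnM cnX cnV.
    have cu := far u ut; have cu0 : 0 < cn u by lra.
    have h1 : (cn u)^-1 <= 2.
      by rewrite -[leRHS]invrK lef_pV2 ?posrE ?invr_gt0 //; lra.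
    apply: (@le_trans _ _ (B / d ^+ j * 2 ^+ j)).
      apply: ler_pM; rewrite ?cn_ge0 ?exprn_ge0 ?invr_ge0 ?cn_ge0 //; first exact: aB.
      by rewrite lerXn2r ?nnegrE ?invr_ge0 ?cn_ge0.
    by rewrite ler_peMr // !mulr_ge0 ?invr_ge0 ?exprn_ge0 // ltW.
  have fdg := fd_appr kt gA gB (le_trans (lexx X) tX).
  pose lam := (('i%C * rc t)^-1 ^+ l : C).
  have clam : cn lam = t^-1 ^+ l by rewrite /lam cnX cnV ct.
  (* This gathers the Taylor tail and the replacement of u^-1 by (i t)^-1 in the power of index [l];
     both are of order t^-(l + 1). *)
  pose rho x' : C := lam * a x' s' l - (g (rc x' + 'i%C * rc t) + al0).
  have rhoB j : (j <= M)%N -> cn (rho (x1 + j%:R * h)) <=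
      (2 * B / d ^+ l.+1 + B / d ^+ l * (l%:R * X)) * t^-1 ^+ l.+1.
    move=> jM; set x' := x1 + _.
    have x'X : `|x'| <= X.
      apply: le_trans (ler_normD _ _) _; rewrite lerD2l normrM (ger0_norm (ler0n _ _)).
      by rewrite ler_wpM2r // ler_nat.
    set u := rc x' + 'i%C * rc t.
    have cu : t <= cn u.
      have := le_im_cn u; by rewrite /u !reimE mul0r mul1r !add0r (gtr0_norm tp).
    have cu0 : 0 < cn u by exact: lt_le_trans cu.
    have u0 : u != 0 by rewrite -cn_gt0.
    have cw : cn u^-1 <= t^-1 by rewrite cnV lef_pV2 ?posrE.
    have td2 : t^-1 <= d / 2.
      have h1 : 2 / d <= t by exact: le_trans Td tT.
      by rewrite -[leRHS]invrK lef_pV2 ?posrE ?invr_gt0 ?divr_gt0 // invf_div.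
    have [_ a2] := ha x' s' ss'.
    have bE : \sum_(n < l.+1) a x' s' n * u^-1 ^+ n =
       \sum_(n < l) a x' s' n * u^-1 ^+ n + a x' s' l * u^-1 ^+ l by rewrite big_ord_recr.
    have := a2 l.+1 u^-1 (le_trans cw td2); rewrite bE.
    set q := A x' s' u^-1 - _ => hq.
    have rel := hrel x' tT ss'; rewrite -/u in rel.
    have sumE : \sum_(i < l) a x' s' i * u^-1 ^+ i = \sum_(i < l) a 0 s' i * u^-1 ^+ i.
      by apply: eq_bigr => i _; rewrite (cstj i x' (ltn_ord i)).
    have -> : rho x' = (- q) + a x' s' l * (lam - u^-1 ^+ l).
      by rewrite /rho -/u /g /q sumE -[al0]rel; ring.
    apply: le_trans (cnD _ _) _; rewrite cnN mulrDl; apply: lerD.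
      apply: le_trans hq _; rewrite expr_div_n -!mulrA !ler_wpM2l ?(ltW B0) //.
      rewrite mulrC ler_wpM2l ?invr_ge0 ?exprn_ge0 ?(ltW d0) //.
      by rewrite lerXn2r ?nnegrE ?cn_ge0 ?invr_ge0 ?(ltW tp).
    rewrite cnM -[leRHS]mulrA; apply: ler_pM; rewrite ?cn_ge0 //; first exact: aB.
    apply: le_trans (@cn_subX _ _ _ t^-1 _ _ cw) _; first by rewrite cnV ct.
    have [l0|lp] := posnP l; first by rewrite l0 !mul0r.
    have -> : t^-1 ^+ l.+1 = t^-1 ^+ 2 * t^-1 ^+ l.-1 by rewrite -exprD -[in LHS](prednK lp).
    rewrite mulrA; apply: ler_wpM2r; first by rewrite exprn_ge0 // invr_ge0 ltW.
    rewrite -mulrA; apply: ler_wpM2l; first exact: ler0n.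
    have -> : ('i%C * rc t)^-1 - u^-1 = rc x' * ('i%C * rc t)^-1 * u^-1.
      exact: inv_sub_inv.
    rewrite !cnM cn_real -mulrA; apply: ler_pM; rewrite ?mulr_ge0 ?cn_ge0 //.
    by rewrite expr2; apply: ler_pM; rewrite ?cn_ge0 // cnV ct.
  have e1 : lam * fd M h (fun x => a x s' l) x1 = fd M h (fun x => g (rc x + 'i%C * rc t)) x1 + fd M h rho x1.
    rewrite -fdZ -fdD -[RHS]addr0.
    rewrite -(fd_cst l.+1 h al0 x1).
    by rewrite -fdD; apply: fd_ext => j _; rewrite /rho; ring.
  have bnd1 : cn (fd M h (fun x => a x s' l) x1) <= (C1 + C2) * t^-1.
    have tl : 0 < t^-1 ^+ l by rewrite exprn_gt0 // invr_gt0.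
    rewrite -(ler_pM2l tl) -clam -cnM e1 clam; apply: le_trans (cnD _ _) _.
    rewrite mulrCA -exprSr mulrDl; apply: lerD.
      apply: le_trans fdg _; rewrite -/X.
      have -> : X / (ka * t) = X / ka * t^-1 by rewrite invfM mulrA.
      have -> : t^-1 ^+ l.+1 = t * t^-1 ^+ M by rewrite [in RHS]exprS mulrA mulfV ?gt_eqF // mul1r.
      rewrite exprMn /C1; move: (2 ^+ M) ((X / ka) ^+ M) (t^-1 ^+ M) => u1 u2 u3.
      by rewrite le_eqVlt; apply/orP; left; apply/eqP; ring.
    by have := fd_bound rhoB; rewrite mulrA.
  have bnd2 : cn (fd M h (fun x => a x s l) x1 - fd M h (fun x => a x s' l) x1) <= 2 ^+ M * (L * ep / d ^+ l).
    rewrite -[- fd _ _ _ _]mulN1r -fdZ -fdD; apply: fd_bound => j _.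
    rewrite mulN1r; apply: alip => // [|i]; first exact: ltW.
    exact: le_trans (ss'e i) e'ep.
  have K'0 : 0 <= K'.
    by rewrite addr_ge0 ?(ltW K0) // sumr_ge0 // => j _; rewrite !mulr_ge0 ?invr_ge0 ?exprn_ge0 // ltW.
  have C120 : 0 <= C1 + C2.
    have d1 n : 0 <= d ^+ n by rewrite exprn_ge0 // ltW.
    have b1 := ltW B0; have X1 : 0 <= X / ka by rewrite divr_ge0 // ltW.
    apply: addr_ge0; (apply: mulr_ge0; first exact: exprn_ge0).
      by apply: mulr_ge0; [exact: mulr_ge0|exact: exprn_ge0].
    apply: addr_ge0; first by apply: divr_ge0 => //; exact: mulr_ge0.
    by apply: mulr_ge0; [exact: divr_ge0|exact: mulr_ge0].
  have -> : fd M h (fun x => a x s l) x1 = fd M h (fun x => a x s' l) x1 +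
     (fd M h (fun x => a x s l) x1 - fd M h (fun x => a x s' l) x1) by ring.
  apply: le_trans (cnD _ _) _; rewrite [leRHS]mulrDl; apply: lerD.
    by apply: le_trans bnd1 _; rewrite ler_wpM2l.
  by apply: le_trans bnd2 _; rewrite -[leRHS]mulrA [L / d ^+ l * ep]mulrAC.
move=> wd.
have s0E : (fun=> 0) = (fun i : I => W i * 0 - (0 : int)%:~R) by apply/funext => i; rewrite mulr0 subrr.
have ss0 : small (fun=> 0) by move=> i; rewrite normr0 ltW.
have ac n : a x (fun=> 0) n = a 0 (fun=> 0) n.
  rewrite s0E; apply: (key n 0 (fun=> 0)) => i; rewrite mulr0 subrr normr0 //.
apply/eqP; rewrite -subr_eq0 -cn_eq0 eq_le cn_ge0 andbT; apply: (@le_half_pow _ _ _ (4 * B)) => m.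
rewrite add0r; have [_ a1] := ha x _ ss0; have [_ a2] := ha 0 _ ss0.
have h1 := a1 m w wd; have h2 := a2 m w wd.
have sE : \sum_(n < m) a x (fun=> 0) n * w ^+ n = \sum_(n < m) a 0 (fun=> 0) n * w ^+ n.
  by apply: eq_bigr => n _; rewrite ac.
rewrite sE in h1; set Sm := \sum_(n < m) _ in h1 h2.
have -> : A x (fun=> 0) w - A 0 (fun=> 0) w = (A x (fun=> 0) w - Sm) - (A 0 (fun=> 0) w - Sm) by ring.
apply: le_trans (cnB _ _) _.
have tm : (cn w / d) ^+ m <= 2^-1 ^+ m.
  by rewrite lerXn2r ?nnegrE ?divr_ge0 ?cn_ge0 ?invr_ge0 ?(ltW d0) // ler_pdivrMr //; lra.
have : 2 * B * (cn w / d) ^+ m <= 2 * B * 2^-1 ^+ m by rewrite ler_wpM2l // mulr_ge0 // ltW.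
lra.
Qed.

End Decouple.

(** * Independence of layered systems *)

Section Subsystems.
Variables (R : realType) (C0 : R) (S : set R) (c : R -> R).
Local Notation C := R[i].
Variable V : finType.
Implicit Types (D : {set V}) (lv : V -> nat) (a : V -> V -> R) (b om al : V -> R) (y : V -> C).
Local Notation Ev := (ev C0 S c).
Local Notation Inn := (inn C0 S c).

(** The invariant of the induction: no node lacks input, and, in place of clones-freeness, nodes of
    one level are told apart by their parameters. Level 0 is the first hidden layer, fed by the
    variable with weights [om]. *)
Definition wf_sys D lv a b om : Prop := [/\
  forall e, e \in D -> lv e = 0%N -> om e != 0,
  forall e m, e \in D -> lv e = m.+1 -> exists j, [/\ j \in D, lv j = m & a e j != 0],
  forall e e', e \in D -> e' \in D -> lv e = 0%N -> lv e' = 0%N -> om e = om e' -> b e = b e' -> e = e' &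
  forall e e' m, e \in D -> e' \in D -> lv e = m.+1 -> lv e' = m.+1 ->
    (forall j, j \in D -> lv j = m -> a e j = a e' j) -> b e = b e' -> e = e'].

Lemma ev_ext D lv a b y y' n e : (forall e, e \in D -> lv e = 0%N -> y e = y' e) ->
  e \in D -> lv e = n -> Inn D lv a b y n e = Inn D lv a b y' n e /\ Ev D lv a b y n e = Ev D lv a b y' n e.
Proof.
move=> yy'; elim: n e => [|n IH] e De le; first by rewrite /= yy'.
suff E : Inn D lv a b y n.+1 e = Inn D lv a b y' n.+1 e by rewrite !evE E.
rewrite /inn; apply: (congr1 (fun t => t + rc (b e))); apply: eq_bigr => j /andP[Dj /eqP lj].
by have [_ ->] := IH j Dj lj.
Qed.

(** Forgetting level 0 makes the inner functions of level 1 the inputs of the rest; in this form a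
    pole of level 1 acts on the deeper nodes. *)
Lemma ev_shift D lv a b y n e :
  let D1 := [set e in D | (0 < lv e)%N] in let lv1 := fun e => (lv e).-1 in
  Inn D lv a b y n.+1 e = Inn D1 lv1 a b (fun i => Inn D lv a b y 1 i) n e /\
  Ev D lv a b y n.+1 e = Ev D1 lv1 a b (fun i => Inn D lv a b y 1 i) n e.
Proof.
move=> D1 lv1; elim: n e => [|n IH] e; first by split; rewrite ?evE.
suff E : Inn D lv a b y n.+2 e = Inn D1 lv1 a b (fun i => Inn D lv a b y 1 i) n.+1 e by split; rewrite ?evE ?E.
rewrite /inn -/inn; apply: (congr1 (fun t => t + rc (b e))); apply: eq_big => [j|j _]; last by have [_ ->] := IH j.
by rewrite inE -andbA /lv1; congr (_ && _); case: (lv j).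
Qed.

Lemma ev_cut D lv a b y m n e : (n <= m)%N ->
  Ev [set e in D | (lv e <= m)%N] lv a b y n e = Ev D lv a b y n e.
Proof.
elim: n e => [//|n IH] e nm.
suff E : Inn [set e in D | (lv e <= m)%N] lv a b y n.+1 e = Inn D lv a b y n.+1 e by rewrite !evE E.
rewrite /inn; apply: (congr1 (fun t => t + rc (b e))); apply: eq_big => [j|j /andP[_ /eqP lj]]; last by rewrite IH // ltnW.
by rewrite inE -andbA; case: (eqVneq (lv j) n) => [->|]; rewrite ?andbF // ltnW.
Qed.

Lemma wf_cut D lv a b om m : wf_sys D lv a b om -> wf_sys [set e in D | (lv e <= m)%N] lv a b om.
Proof.
move=> [h1 h2 h3 h4]; split.
- by move=> e; rewrite inE => /andP[De _]; exact: h1.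
- move=> e k; rewrite inE => /andP[De le] lk; have [j [Dj lj aj]] := h2 e k De lk.
  by exists j; split => //; rewrite inE Dj lj; rewrite lk in le; exact: ltnW.
- by move=> e e'; rewrite !inE => /andP[De _] /andP[De' _]; exact: h3.
- move=> e e' k; rewrite !inE => /andP[De le] /andP[De' le'] lk lk' hj; apply: (h4 e e' k) => // j Dj lj.
  by apply: hj => //; rewrite inE Dj lj; rewrite lk in le; exact: ltnW.
Qed.

Section Remove.
Variables (D : {set V}) (lv : V -> nat) (a : V -> V -> R) (b : V -> R) (e0 : V).
Hypothesis term : forall j, j \in D -> lv j = (lv e0).+1 -> a j e0 = 0.

Lemma ev_remove y n e : e \in D -> lv e = n -> Ev (D :\ e0) lv a b y n e = Ev D lv a b y n e.
Proof.
elim: n e => [//|n IH] e De le.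
suff E : Inn (D :\ e0) lv a b y n.+1 e = Inn D lv a b y n.+1 e by rewrite !evE E.
rewrite /inn; apply: (congr1 (fun t => t + rc (b e))).
have [De0|nDe0] := boolP (e0 \in D); last first.
  apply: eq_big => [j|j /andP[+ /eqP lj]]; first by rewrite in_setD1; case: eqVneq => [->|]; rewrite ?(negPf nDe0).
  by rewrite in_setD1 => /andP[_ Dj]; rewrite IH.
have [le0|le0] := eqVneq (lv e0) n; last first.
  apply: eq_big => [j|j /andP[+ /eqP lj]].
    by rewrite in_setD1; case: (eqVneq j e0) => [->|//]; rewrite (negPf le0) !andbF.
  by rewrite in_setD1 => /andP[_ Dj]; rewrite IH.
rewrite [RHS](bigD1 e0) /=; last by rewrite De0 le0 eqxx.
rewrite term //; last by rewrite le le0.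
rewrite mul0r add0r; apply: eq_big => [j|j /andP[+ /eqP lj]].
  by rewrite in_setD1; case: (eqVneq j e0) => _; rewrite ?andbF ?andbT.
by rewrite in_setD1 => /andP[_ Dj]; rewrite IH.
Qed.

Lemma wf_remove om : wf_sys D lv a b om -> wf_sys (D :\ e0) lv a b om.
Proof.
move=> [h1 h2 h3 h4]; split.
- by move=> e /setD1P[_ De]; exact: h1.
- move=> e k /setD1P[_ De] lk; have [j [Dj lj aj]] := h2 e k De lk.
  exists j; split => //; rewrite in_setD1 Dj andbT; apply: contraNneq aj => je.
  by rewrite je term // lk -lj je.
- by move=> e e' /setD1P[_ De] /setD1P[_ De']; exact: h3.
- move=> e e' k /setD1P[_ De] /setD1P[_ De'] lk lk' hj; apply: (h4 e e' k) => // j Dj lj.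
  have [je|je] := eqVneq j e0; last by apply: hj => //; rewrite in_setD1 je.
  by rewrite je !term // ?lk ?lk' -lj je.
Qed.

End Remove.

Lemma onl_cos (y : R) : onl y -> cos (pi * y) = 0.
Proof.
move=> [k ->]; apply/eqP; rewrite -normr_eq0 addrC cos_int cos_pihalf normr0 //.
Qed.

Lemma good_period D lv a b y (k : V -> int) n e : `|im (Inn D lv a b y n e)| <= 4^-1 ->
  ~ bad S (Inn D lv a b (fun e => y e + 'i%C * rc (k e)%:~R) n e).
Proof.
case: n => [|n] h; last first.
  have [-> _] := inn_period C0 S c D lv a b y k n e.
  by apply: (@near_int_good _ _ _ 0); rewrite subr0.
by apply: (@near_int_good _ _ _ (k e)); rewrite /inn in h *; rewrite imD imM im_i re_i im_rc re_rc mul0r add0r mul1r addrK.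
Qed.

Lemma no_pole (W d : R) (H : C -> C) (al0 : C) : 0 < d -> appr H 0 d ->
  (exists2 r, 0 < r & forall w, im w != 0 -> cn w <= r -> rc W / w + H w = al0) -> W = 0.
Proof.
move=> d0 hH [r r0 hr]; have [B B0 hB] := appr_bound hH.
suff : rc W = 0 :> C by move=> /eqP; rewrite rc_eq0 => /eqP.
apply: (@cn_small0 _ _ (B + cn al0)) => e e0.
pose t := Num.min e (Num.min d r); have t0 : 0 < t by rewrite !lt_min e0 d0.
have te : t <= e by rewrite ge_min lexx.
have td : t <= d by rewrite !ge_min lexx orbT.
have tr : t <= r by rewrite !ge_min lexx !orbT.
clearbody t; pose w : C := 'i%C * rc t.
have cw : cn w = t by rewrite /w cnM cn_i mul1r cn_real gtr0_norm.
have w0 : w != 0 by rewrite -cn_gt0 cw.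
have iw : im w != 0 by rewrite /w !reimE mul0r mul1r add0r gt_eqF.
have e1 : rc W = (al0 - H w) * w.
  by rewrite -(hr w iw) ?cw // addrK divfK.
rewrite e1 cnM cw; apply: ler_pM => //; rewrite ?cn_ge0 ?(ltW t0) //.
apply: le_trans (cnB _ _) _; have := hB w; rewrite subr0 cw => /(_ td); lra.
Qed.

Hypothesis hc1 : summable S (EFin \o c).

Lemma inv_it (t x : R) : 0 < t -> let u := rc x + 'i%C * rc t : C in
  [/\ u != 0, t <= cn u, im u^-1 != 0 & cn u^-1 <= t^-1].
Proof.
move=> t0 u; have cu : t <= cn u.
  by have := le_im_cn u; rewrite /u !reimE mul0r mul1r !add0r (gtr0_norm t0).
have cu0 : 0 < cn u by exact: lt_le_trans cu.
have u0 : u != 0 by rewrite -cn_gt0.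
split => //; last by rewrite cnV lef_pV2 ?posrE.
apply/negP => /eqP iu; have e : u^-1 = rc (re u^-1) by apply: cplx_ext; rewrite ?re_rc ?im_rc.
have : im u = 0 by rewrite -[u]invrK e -rcV im_rc.
by rewrite /u !reimE mul0r mul1r !add0r => /eqP; rewrite gt_eqF.
Qed.

(** Neurons of level 0 may have singularities accumulating at the chosen point. But for w = 1 / u
    with u near i t, Im w has order 1 / t, and [cos_lower] bounds the neuron by a multiple of t. One
    [de] serves as radius, inverse threshold and inverse growth constant. *)
Lemma level0_growth (om b p : R) : om != 0 -> exists2 de, 0 < de & [/\ de <= 2^-1,
  forall w : C, im w != 0 -> cn w <= de -> ~ bad S (rc b + (rc p + 'i%C / 2 + w) * rc om) &
  forall t, de^-1 <= t ->
    appr (fun u => csig C0 S c (rc b + (rc p + 'i%C / 2 + u^-1) * rc om)) ('i%C * rc t) (de * t) /\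
    forall u, cn (u - 'i%C * rc t) <= de * t ->
      cn (csig C0 S c (rc b + (rc p + 'i%C / 2 + u^-1) * rc om)) <= de^-1 * t].
Proof.
move=> om0; have [d [k [d0 k0 hcos]]] := cos_lower (om / 2) om0.
have imE (w : C) : im (rc b + (rc p + 'i%C / 2 + w) * rc om) = om / 2 + om * im w.
  by rewrite -rc_half !reimE; ring.
have o0 : 0 < `|om| by rewrite normr_gt0.
have t0 := tot_ge0 hc1; set tt := tot S c in t0.
set Ke := `|C0| + (1 + 4 / k) * tt + 1.
have k4 : 0 < 4 / k by rewrite divr_gt0.
have Ke0 : 0 < Ke by have := normr_ge0 C0; rewrite /Ke; nra.
pose de := Num.min (Num.min 2^-1 d) (Num.min (k / 224 / (2 * `|om|)) Ke^-1).
have de0 : 0 < de.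
  by rewrite !lt_min d0 !invr_gt0 Ke0 ltr0n /= andbT divr_gt0 // ?divr_gt0 // mulr_gt0.
have de1 : de <= 2^-1 by rewrite !ge_min lexx.
have de2 : de <= d by rewrite !ge_min lexx orbT.
have de3 : de <= k / 224 / (2 * `|om|) by rewrite !ge_min lexx !orbT.
have de4 : de <= Ke^-1 by rewrite !ge_min lexx !orbT.
clearbody de; exists de => //; split => // [w iw wd [ow _]|t ht].
  have := onl_cos ow; rewrite imE => e0.
  have := hcos (im w) (le_trans (le_im_cn _) (le_trans wd de2)).
  rewrite e0 normr0 => h; have : 0 < k * `|im w| by rewrite mulr_gt0 // normr_gt0.
  by rewrite ltNge h.
have tp : 0 < t by apply: lt_le_trans ht; rewrite invr_gt0.
have t1 : 1 <= t.
  by apply: le_trans ht; rewrite -[leLHS]invr1 lef_pV2 ?posrE //; lra.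
set it := 'i%C * rc t : C.
have cit : cn it = t by rewrite cnM cn_i mul1r cn_real gtr0_norm.
have it0 : it != 0 by rewrite -cn_gt0 cit.
have itV : it^-1 = 'i%C * rc (- t^-1).
  by apply: (mulfI it0); rewrite mulfV // /it mulrACA ii -rcM mulrN mulfV ?gt_eqF // rcN mulrNN mulr1.
have imV : im it^-1 = - t^-1 by rewrite itV !reimE mul0r mul1r add0r.
set zc := rc b + (rc p + 'i%C / 2 + it^-1) * rc om.
have mb : k * t^-1 <= `|cos (pi * im zc)|.
  rewrite imE imV; have -> : k * t^-1 = k * `|- t^-1| by rewrite normrN gtr0_norm ?invr_gt0.
  apply: hcos; rewrite normrN gtr0_norm ?invr_gt0 //.
  by apply: le_trans de2; rewrite -[leRHS]invrK lef_pV2 ?posrE ?invr_gt0.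
set m := `|cos _| in mb.
have kt : 0 < k * t^-1 by rewrite mulr_gt0 ?invr_gt0.
have m0 : 0 < m by exact: lt_le_trans mb.
have [A1 A2] := csig_appr_cos C0 hc1 m0; rewrite -/m in A1 A2.
have far u : cn (u - it) <= de * t -> t / 2 <= cn u.
  move=> ut; have -> : u = it - (it - u) by ring.
  by apply: le_trans (cn_le_sub _ _); rewrite cit cn_distC; nra.
have inc u : cn (u - it) <= de * t -> cn (rc b + (rc p + 'i%C / 2 + u^-1) * rc om - zc) <= m / 224.
  move=> ut; have fu := far u ut; have cu : 0 < cn u by lra.
  have u0 : u != 0 by rewrite -cn_gt0.
  have -> : rc b + (rc p + 'i%C / 2 + u^-1) * rc om - zc = (u^-1 - it^-1) * rc om by rewrite /zc; ring.
  have -> : u^-1 - it^-1 = (it - u) * (u^-1 * it^-1).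
    by rewrite mulrBl mulrCA mulfV // mulr1 mulrA mulfV // mul1r.
  rewrite !cnM !cnV cit cn_distC cn_real.
  apply: (@le_trans _ _ (de * t * ((t / 2)^-1 / t) * `|om|)).
    rewrite ler_wpM2r //; apply: ler_pM; rewrite ?cn_ge0 ?mulr_ge0 ?invr_ge0 ?cn_ge0 ?(ltW tp) //.
    by rewrite ler_wpM2r ?invr_ge0 ?(ltW tp) // lef_pV2 ?posrE ?divr_gt0.
  have -> : de * t * ((t / 2)^-1 / t) * `|om| = de * (2 * `|om|) * t^-1.
    by field; rewrite gt_eqF.
  apply: (@le_trans _ _ (k / 224 * t^-1)); last by lra.
  by rewrite ler_wpM2r ?invr_ge0 ?(ltW tp) // -ler_pdivlMr // mulr_gt0.
split.
  apply: (appr_comp (f := fun u => rc b + (rc p + 'i%C / 2 + u^-1) * rc om) _ A1) => //.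
  apply: apprD; first exact: appr_cst.
  apply: apprM; last exact: appr_cst.
  apply: apprD; first exact: appr_cst.
  by apply: appr_rad (appr_inv it0) _; rewrite cit; nra.
move=> u /inc/A2 h; apply: le_trans h _.
have h4 : 4 / m <= 4 / k * t.
  rewrite ler_pdivrMr // -[4 / k * t]mulrA -mulrA ler_pMr //.
  have := ler_wpM2r (ltW tp) mb; rewrite -mulrA mulVf ?gt_eqF // mulr1 => h5.
  by rewrite -mulrA ler_pdivlMl // mulr1 mulrC.
apply: (@le_trans _ _ (Ke * t)); last first.
  by rewrite ler_wpM2r ?(ltW tp) // -[leLHS]invrK lef_pV2 ?posrE ?invr_gt0.
have c0 := normr_ge0 C0; rewrite /Ke.
have h5 : (1 + 4 / m) * tt <= (1 + 4 / k) * tt * t.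
  rewrite mulrAC ler_wpM2r //; lra.
have h6 : `|C0| <= `|C0| * t by rewrite ler_peMr.
rewrite -/tt; clear -h5 h6 tp; lra.
Qed.

Hypothesis hSd : discrete_set S.

(** The approximation is finer than every non-zero |om e| and than half of every gap between the
    [om], so the integers inherit non-vanishing and distinctness, hence [wf_sys]. Dividing by the
    common power of 2 over [J] only rescales the variable. *)
Lemma odd_direction D lv a b om al (al0 : C) (J : {set V}) : wf_sys D lv a b om ->
  (forall x : R, rel_sum C0 S c D lv a b al (fun e => rc (b e + x * om e)) = al0) ->
  (exists j, j \in J) -> (forall j, j \in J -> j \in D /\ lv j = 0%N) ->
  exists (om' : V -> R) (oz : V -> int), [/\ wf_sys D lv a b om',
    forall x : R, rel_sum C0 S c D lv a b al (fun e => rc (b e + x * om' e)) = al0,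
    forall j, j \in J -> om' j = (oz j)%:~R &
    exists j, j \in J /\ ~~ (2 %| oz j)%Z].
Proof.
move=> [h1 h2 h3 h4] hrel J0 hJ.
have [de de0 hde] : exists2 de, 0 < de & forall ee : V * V,
    (om ee.1 != 0 -> de < `|om ee.1|) /\ (om ee.1 != om ee.2 -> 2 * de < `|om ee.1 - om ee.2|).
  apply: fin_delta => [[e e']|ee d d' [k1 k2] d'0 dd']; last first.
    by split=> h; [apply: le_lt_trans dd' (k1 h)|apply: le_lt_trans (k2 h); rewrite ler_pM2l].
  exists (Num.min (if om e == 0 then 1 else `|om e| / 2) (if om e == om e' then 1 else `|om e - om e'| / 4)).
    rewrite lt_min; apply/andP; split; case: eqVneq => //= h; rewrite divr_gt0 // normr_gt0 // subr_eq0 //.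
  split=> h /=; rewrite (negPf h).
    by have : 0 < `|om e| by [rewrite normr_gt0]; rewrite gt_min => h0; apply/orP; left; lra.
  have h0 : 0 < `|om e - om e'| by rewrite normr_gt0 subr_eq0.
  set mm := Num.min _ _; have : mm <= `|om e - om e'| / 4 by rewrite ge_min lexx orbT.
  by move=> h5; clear -h0 h5; lra.
have [q [N [q0 hN hrel']]] := integer_direction hc1 hSd de0 hrel.
have q1 : 1 <= q%:R :> R by rewrite ler1n.
have N0 e : om e != 0 -> N e != 0.
  move=> /((hde (e, e)).1) /= lt; apply/negP => /eqP Ne.
  have := hN e; rewrite Ne subr0 normrM (ger0_norm (ler0n _ _)) => h.
  have : `|om e| <= q%:R * `|om e| by rewrite ler_peMl.
  by lra.
have NN e e' : om e != om e' -> N e != N e'.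
  move=> /((hde (e, e')).2) /= lt; apply/negP => /eqP Ne.
  have := hN e; have := hN e'; rewrite -Ne => k1 k2.
  have : `|q%:R * (om e - om e')| <= 2 * de.
    have -> : q%:R * (om e - om e') = (q%:R * om e - (N e)%:~R) - (q%:R * om e' - (N e)%:~R) by ring.
    by apply: le_trans (ler_normB _ _) _; lra.
  rewrite normrM (ger0_norm (ler0n _ _)) => h.
  have : `|om e - om e'| <= q%:R * `|om e - om e'| by rewrite ler_peMl.
  by lra.
have [v [k1 [j [Jj k2]]]] : exists v : nat, (forall j, j \in J -> exists k, N j = k * 2 ^+ v) /\
    exists j, j \in J /\ forall k, N j = k * 2 ^+ v -> ~~ (2 %| k)%Z.
  by apply: two_adic => // j /hJ[Dj lj]; apply: N0; exact: h1.
have p2 : 2 ^+ v != 0 :> R by rewrite expf_neq0.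
pose om' e : R := (N e)%:~R / 2 ^+ v; pose oz e := (N e %/ 2 ^+ v)%Z.
have ozE i : i \in J -> N i = oz i * 2 ^+ v.
  by move=> Ji; have [k e] := k1 i Ji; rewrite /oz e mulzK // expf_neq0.
exists om', oz; split.
- split => // [e De le|e e' De De' le le' /(divIf p2)/intr_inj Ne be].
    by rewrite mulf_neq0 ?invr_eq0 // intr_eq0 N0 // h1.
  by apply: h3 => //; apply/eqP; apply: contraT => /NN; rewrite Ne eqxx.
- move=> x; rewrite -(hrel' (x / 2 ^+ v)); apply: rel_ext => e.
  by rewrite /om' mulrA mulrAC.
- by move=> i Ji; rewrite /om' (ozE i Ji) intrM rmorphXn /= mulfK.
- by exists j; split => //; apply: k2; exact: ozE.
Qed.

End Subsystems.

Section MainSystem.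
Variables (R : realType) (C0 : R) (S : set R) (c : R -> R).
Local Notation C := R[i].
Hypothesis hc1 : summable S (EFin \o c).
Hypothesis hSd : discrete_set S.
Hypothesis hSa : self_avoiding S.
Hypothesis hc0 : forall s, S s -> c s != 0.
Variable V : finType.
Implicit Types (D : {set V}) (lv : V -> nat) (a : V -> V -> R) (b om al : V -> R) (y : V -> C) (x : R).
Local Notation sg := (csig C0 S c).
Local Notation Ev := (ev C0 S c).
Local Notation Inn := (inn C0 S c).
Local Notation Rel := (rel_sum C0 S c).

Lemma rel_on_domain D lv a b om al (al0 : C) :
  (forall x, Rel D lv a b al (fun e => rc (b e + x * om e)) = al0) ->
  forall z, (forall e, e \in D -> ~ bad S (Inn D lv a b (lin b om z) (lv e) e)) ->
  Rel D lv a b al (lin b om z) = al0.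
Proof.
move=> hrel z gz; have [U [oU cU RU hU holU]] := natural_domain C0 hc1 hSd D lv a b b om.
have hol := rel_holo al al0 holU.
have := @identity_real _ U _ 0 1 cU hol (RU 0) ltr01 _ z (hU z gz).
move=> h; apply/eqP; rewrite -subr_eq0; apply/eqP; apply: h => x _.
rewrite -(hrel x); apply/eqP; rewrite subr_eq0; apply/eqP; apply: rel_ext => e.
by rewrite /lin rcD rcM.
Qed.

Lemma wf_level1 D lv a b om : wf_sys D lv a b om -> forall e, e \in D -> (0 < lv e)%N ->
  exists i, i \in D /\ lv i = 1%N.
Proof.
move=> [_ h2 _ _] e De; case El : (lv e) => [//|n] _.
elim: n e De El => [|n IH] e De le; first by exists e.
have [j [Dj lj _]] := h2 e n.+1 De le; exact: (IH j).
Qed.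

(** With a single level the relation is itself a combination of neurons, whose pole is incompatible
    with a constant value. *)
Lemma level0_case D lv a b om al (al0 : C) : wf_sys D lv a b om ->
  (forall e, e \in D -> lv e = 0%N) ->
  (forall x, Rel D lv a b al (fun e => rc (b e + x * om e)) = al0) ->
  forall e, e \in D -> al e = 0.
Proof.
move=> wf lv0 hrel e De; apply/eqP; apply: contraT => ale.
pose J := [set j in D | al j != 0].
have [||om' [oz [wf' hrel' hz [j1 [Jj1 odd1]]]]] := odd_direction hc1 hSd (J := J) wf hrel.
- by exists e; rewrite inE De.
- by move=> j; rewrite inE => /andP[Dj _]; split => //; exact: lv0.
pose A (i : unit) j := if j \in D then al j else 0.
have AJ i j : A i j != 0 -> j \in J by rewrite /A inE; case: ifP => //; rewrite eqxx.
have [k1 _ k3 _] := wf'.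
have [|||p [d [W [H [d0 [i Wi] HA _ HE]]]]] :=
    @pole_expansion R C0 S c hc1 unit V A (fun=> 0) om' b oz hSd hSa hc0.
- by move=> i j /AJ; exact: hz.
- by exists tt, j1; split => //; move: Jj1; rewrite inE /A => /andP[->].
- move=> i i' j j' /AJ + /AJ; rewrite !inE => /andP[Dj _] /andP[Dj' _].
  by apply: k3 => //; exact: lv0.
have [de de0 hde] : exists2 de, 0 < de & forall j, j \in D -> forall w : C, im w != 0 -> cn w <= de ->
    ~ bad S (rc (b j) + (rc p + 'i%C / 2 + w) * rc (om' j)).
  apply: fin_delta => [j|j d1 d2 h d20 le Dj w iw wd]; last by apply: h => //; exact: le_trans le.
  have [Dj|nD] := boolP (j \in D); last by exists 1.
  by have [d1 d10 [_ h _]] := level0_growth C0 hc1 (b j) p (k1 j Dj (lv0 j Dj)); exists d1.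
move/eqP: Wi; case; apply: (no_pole (al0 := al0) d0 (HA i)).
exists (Num.min d de); first by rewrite lt_min d0.
move=> w iw; rewrite le_min => /andP[wd wde]; rewrite -HE // addr0.
have <- := rel_on_domain hrel' (z := rc p + 'i%C / 2 + w); last first.
  by move=> j Dj; rewrite lv0 //; exact: hde.
rewrite /rel_sum [RHS]big_mkcond /=; apply: eq_bigr => j _; rewrite /A.
case: ifP => Dj; last by rewrite mul0r.
by rewrite lv0 // /= /lin [rc (b j) + _]addrC [rc (om' j) * _]mulrC.
Qed.

(** * The inductive step: reduction to a smaller system at a pole *)

Section Step.
Variables (D : {set V}) (lv : V -> nat) (a : V -> V -> R) (b om al : V -> R) (al0 : C).
Hypothesis wf : wf_sys D lv a b om.
Hypothesis hrel : forall x, Rel D lv a b al (fun e => rc (b e + x * om e)) = al0.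
Hypothesis IH : forall D' lv' a' b' om' al' (al0' : C), (#|D'| < #|D|)%N -> wf_sys D' lv' a' b' om' ->
  (forall x, Rel D' lv' a' b' al' (fun e => rc (b' e + x * om' e)) = al0') ->
  forall e, e \in D' -> al' e = 0.
Hypothesis top : forall e, e \in D -> al e = 0 -> exists j, [/\ j \in D, lv j = (lv e).+1 & a j e != 0].

Variables (p d : R) (W : V -> R) (H : V -> C -> C).
Hypotheses (d0 : 0 < d) (HA : forall i, appr (H i) 0 d) (HR : forall i (x : R), im (H i (rc x)) = 0).
Hypothesis W0 : exists i, [/\ i \in D, lv i = 1%N & W i != 0].
Hypothesis HE : forall i w, i \in D -> lv i = 1%N -> im w != 0 -> cn w <= d ->
  Inn D lv a b (lin b om (rc p + 'i%C / 2 + w)) 1 i = rc (W i) / w + H i w.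

Let D1 := [set e in D | (0 < lv e)%N].
Let lv1 e := (lv e).-1.
Local Notation Ev1 := (Ev D1 lv1 a b).
Local Notation Inn1 := (Inn D1 lv1 a b).

Let D1P e : e \in D1 -> e \in D /\ lv e = (lv1 e).+1.
Proof. by rewrite inE => /andP[De le]; split => //; rewrite prednK. Qed.

Let shifted z e : e \in D1 -> Ev D lv a b (lin b om z) (lv e) e =
  Ev1 (fun i => Inn D lv a b (lin b om z) 1 i) (lv1 e) e.
Proof.
move=> /D1P[De le]; rewrite le.
by have [_ ->] := ev_shift C0 S c D lv a b (lin b om z) (lv1 e) e.
Qed.

Let level1_input w n e : im w != 0 -> cn w <= d -> e \in D1 -> lv1 e = n ->
  Inn1 (fun i => Inn D lv a b (lin b om (rc p + 'i%C / 2 + w)) 1 i) n e =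
    Inn1 (fun i => rc (W i) / w + H i w) n e /\
  Ev1 (fun i => Inn D lv a b (lin b om (rc p + 'i%C / 2 + w)) 1 i) n e =
    Ev1 (fun i => rc (W i) / w + H i w) n e.
Proof.
move=> iw wd De le; apply: ev_ext => // i Di li; apply: HE => //; have [Di' li'] := D1P Di => //.
by rewrite li' li.
Qed.

(** Whether a node feels the pole, read off the graph: a chain of non-zero weights leads to it from
    an inner function with non-zero residue. *)
Fixpoint udep n e : bool := if n is m.+1 then
  [exists j, [&& j \in D1, lv1 j == m, a e j != 0 & udep m j]] else W e != 0.

Let udep_const u (w : C) n e : e \in D1 -> lv1 e = n -> ~~ udep n e ->
  Ev1 (fun i => rc (W i) * u + H i w) n e = Ev1 (fun i => H i w) n e.
Proof.
elim: n e => [|n IHn] e De le /=; first by rewrite negbK => /eqP ->; rewrite mul0r add0r.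
move=> nu; suff E : Inn1 (fun i => rc (W i) * u + H i w) n.+1 e = Inn1 (fun i => H i w) n.+1 e.
  by rewrite -[LHS]/(sg (Inn1 _ n.+1 e)) E.
rewrite /inn; apply: (congr1 (fun t => t + rc (b e))); apply: eq_bigr => j /andP[Dj /eqP lj].
have [->|aj] := eqVneq (a e j) 0; first by rewrite !mul0r.
rewrite IHn //; apply: contra nu => uj; apply/existsP; exists j.
by rewrite Dj lj eqxx aj.
Qed.

Let growth : exists2 de, 0 < de & forall e, e \in D -> lv e = 0%N -> [/\ de <= 2^-1,
  forall w : C, im w != 0 -> cn w <= de -> ~ bad S (rc (b e) + (rc p + 'i%C / 2 + w) * rc (om e)) &
  forall t, de^-1 <= t ->
    appr (fun u => sg (rc (b e) + (rc p + 'i%C / 2 + u^-1) * rc (om e))) ('i%C * rc t) (de * t) /\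
    forall u, cn (u - 'i%C * rc t) <= de * t ->
      cn (sg (rc (b e) + (rc p + 'i%C / 2 + u^-1) * rc (om e))) <= de^-1 * t].
Proof.
apply: fin_delta => [e|e d1 d2 h d20 le De le0].
  have [De|nD] := boolP (e \in D); last by exists 1.
  have [le|nl] := eqVneq (lv e) 0%N; last by exists 1 => // _ le; rewrite le eqxx in nl.
  have [k1 _ _ _] := wf.
  by have [d1 d10 h] := level0_growth C0 hc1 (b e) p (k1 e De le); exists d1.
have [h1 h2 h3] := h De le0.
have d10 : 0 < d1 by exact: lt_le_trans le.
have dd : d1^-1 <= d2^-1 by rewrite lef_pV2 ?posrE.
split; [exact: le_trans le h1|by move=> w iw wd; apply: h2 => //; exact: le_trans le|].
move=> t ht; have [h4 h5] := h3 t (le_trans dd ht).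
have t0 : 0 <= t by apply: le_trans ht; rewrite invr_ge0 ltW.
split; first by apply: appr_rad h4 _; rewrite ler_wpM2r.
move=> u ut; apply: le_trans (h5 u _) _; first by apply: le_trans ut _; rewrite ler_wpM2r.
by rewrite ler_wpM2r.
Qed.

Let Fl (w : C) : C := \sum_(e in D | lv e == 0%N) rc (al e) * sg (rc (b e) + (rc p + 'i%C / 2 + w) * rc (om e)).

(** The relation above level 0. For 1 / w = x + i t the term W i / w is W i x + i W i t, and by
    periodicity W i t may be replaced by its offset [s i] from an integer. *)
Let Al x (s : V -> R) (w : C) : C :=
  \sum_(e in D1) rc (al e) * Ev1 (fun i => rc (W i * x) + H i w + 'i%C * rc (s i)) (lv1 e) e.

(** Supplies what [decouple] asks for. Beyond [T] the point w = 1 / (x + i t) lies in the discs of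
    [near_real] and of [growth], so every inner value is good when the W i t are almost integers. *)
Let radius : exists eta d' L M T : R, [/\ [/\ 0 < eta, 0 < d', d' <= d, 0 < L & 0 < M], 1 <= T,
  2 / d' <= T,
  forall (f : V -> C -> C) x s, (forall i, `|s i| <= eta) -> appr (Al x s) 0 d' /\
     forall w, cn w <= d' -> cn (Al x s w) <= M &
  (forall x s s' de, (forall i, `|s i| <= eta) -> (forall i, `|s' i| <= eta) -> 0 <= de ->
    (forall i, `|s i - s' i| <= de) -> forall w, cn w <= d' -> cn (Al x s w - Al x s' w) <= L * de) /\
  (forall x t (k : V -> int), T <= t -> (forall i, `|W i * t - (k i)%:~R| <= eta) ->
    let w := (rc x + 'i%C * rc t)^-1 in
    (forall e, e \in D -> ~ bad S (Inn D lv a b (lin b om (rc p + 'i%C / 2 + w)) (lv e) e)) /\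
    Al x (fun i => W i * t - (k i)%:~R) w + Fl w = al0)].
Proof.
have [h [L [M [h0 L0 M0 hn]]]] := near_real C0 hc1 D1 lv1 a b (\max_e lv1 e).
have lN e : (lv1 e <= \max_e lv1 e)%N by exact: leq_bigmax.
have [de de0 hde] := growth.
have h2 : 0 < h / 2 by lra.
have [d1 d10 hd1] : exists2 d1, 0 < d1 & forall i, d1 <= d /\ forall w, cn w <= d1 -> cn (H i w - H i 0) <= h / 2.
  apply: fin_delta => [i|i u v [k1 k2] v0 vu]; last first.
    by split=> [|w wv]; [exact: le_trans vu k1|apply: k2; exact: le_trans vu].
  have [d1 d10 [d1d hd1]] := appr_cont d0 (HA i) h2; exists d1 => //; split=> // w wd.
  by apply: hd1; rewrite subr0.
pose d' := Num.min d1 d; have d'0 : 0 < d' by rewrite lt_min d10.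
have d'd : d' <= d by rewrite ge_min lexx orbT.
have Hc i w : cn w <= d' -> cn (H i w - H i 0) <= h / 2.
  by move=> wd; have [_ k2] := hd1 i; apply: k2; apply: le_trans wd _; rewrite ge_min lexx.
have imH i w : cn w <= d' -> `|im (H i w)| <= h / 2.
  move=> /(Hc i) k; apply: le_trans k; have := le_im_cn (H i w - H i 0).
  by rewrite imD imN (HR i 0) subr0.
pose Y x s (w : C) i := rc (W i * x) + H i w + 'i%C * rc (s i).
have imY x s w i : (forall i, `|s i| <= h / 2) -> cn w <= d' -> `|im (Y x s w i)| <= h.
  move=> hs wd; rewrite /Y !imD im_rc add0r imM im_i re_i im_rc re_rc mul0r add0r mul1r.
  by apply: le_trans (ler_normD _ _) _; have := hs i; have := imH i w wd; lra.
clearbody d'.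
exists (h / 2), d', (\sum_(e in D1) `|al e| * L + 1), (\sum_(e in D1) `|al e| * M + 1),
  (1 + 2 / d' + de^-1).
have T1 : 0 < 2 / d' by rewrite divr_gt0.
have T2 : 0 < de^-1 by rewrite invr_gt0.
split; [split => //| | | |split].
- by rewrite ltr_wpDl // sumr_ge0 // => e _; rewrite mulr_ge0 // ltW.
- by rewrite ltr_wpDl // sumr_ge0 // => e _; rewrite mulr_ge0 // ltW.
- by lra.
- by lra.
- move=> _ x s hs; split.
    apply: appr_sum => e _; apply: apprZ; have [_ _ _ n4] := hn _ (lN e).
    have [|||_ //] := n4 (fun i w => Y x s w i) 0 d' e.
    + exact: ltW.
    + move=> i; apply: apprD; last exact: appr_cst.
      by apply: apprD; [exact: appr_cst|exact: appr_rad (HA i) d'd].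
    + move=> i w; rewrite subr0 => wd; split; first exact: imY.
      have -> : Y x s w i - Y x s 0 i = H i w - H i 0 by rewrite /Y; ring.
      by apply: le_trans (Hc i w wd) _; lra.
  move=> w wd; apply: (@le_trans _ _ (\sum_(e in D1) `|al e| * M)); last by rewrite lerDl.
  apply: sum_cn_le => e _; rewrite cnM cn_real ler_wpM2l //.
  by have [_ _ n3 _] := hn _ (lN e); apply: n3 => i; exact: imY.
- move=> x s s' dd hs hs' dd0 hss w wd; rewrite /Al -sumrB.
  apply: (@le_trans _ _ (\sum_(e in D1) `|al e| * L * dd)); last first.
    by rewrite [leRHS]mulrDl mul1r mulr_suml lerDl.
  apply: sum_cn_le => e _; rewrite -mulrBr cnM cn_real -mulrA ler_wpM2l //.
  have [n1 _ _ _] := hn _ (lN e); apply: n1 => i; [exact: (imY x s)|exact: (imY x s')|].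
  have -> : Y x s w i - Y x s' w i = 'i%C * rc (s i - s' i) by rewrite /Y rcB; ring.
  by rewrite cnM cn_i mul1r cn_real.
- move=> x t k tT hk w.
  have t0 : 0 < t by lra.
  have [u0 cu iw cw] := inv_it x t0; rewrite -/w in iw cw.
  have wd' : cn w <= d'.
    apply: le_trans cw _; rewrite -[leRHS]invrK lef_pV2 ?posrE ?invr_gt0 //.
    have : d'^-1 <= 2 / d' by rewrite ler_peMl ?invr_ge0 ?(ltW d'0) // ler1n.
    by lra.
  have wd : cn w <= d by exact: le_trans d'd.
  have wde : cn w <= de.
    by apply: le_trans cw _; rewrite -[leRHS]invrK lef_pV2 ?posrE ?invr_gt0 //; lra.
  set s := fun i => W i * t - (k i)%:~R.
  have yE : (fun i => rc (W i) / w + H i w) = (fun i => Y x s w i + 'i%C * rc (k i)%:~R).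
    apply/funext => i; rewrite /w invrK /Y /s rcB !rcM; ring.
  set z := rc p + 'i%C / 2 + w.
  have gz e : e \in D -> ~ bad S (Inn D lv a b (lin b om z) (lv e) e).
    move=> De; have [le|nl] := eqVneq (lv e) 0%N.
      by rewrite le; have [_ g2 _] := hde e De le; exact: g2.
    have De1 : e \in D1 by rewrite inE De lt0n.
    have [_ le] := D1P De1; rewrite le.
    have [-> _] := ev_shift C0 S c D lv a b (lin b om z) (lv1 e) e.
    have [-> _] := level1_input iw wd De1 erefl; rewrite yE.
    apply: good_period; have [_ n2 _ _] := hn _ (lN e); apply: n2 => i; exact: imY.
  split => //; have <- := rel_on_domain hrel gz.
  rewrite /rel_sum (bigID (fun e => lv e == 0%N)) /= addrC; congr (_ + _); last by apply: eq_bigr => e /andP[De /eqP ->].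
  rewrite /Al; apply: eq_big => [e|e De1]; first by rewrite inE lt0n.
  rewrite -[LHS]/(rc (al e) * Ev1 (Y x s w) (lv1 e) e); congr (_ * _).
  rewrite (shifted z De1); have [_ ->] := level1_input iw wd De1 erefl.
  by rewrite yE ev_period.
Qed.

Let decoupled : exists2 d', 0 < d' & d' <= d /\ forall x w, cn w <= d' -> Al x (fun=> 0) w = Al 0 (fun=> 0) w.
Proof.
have [eta [d' [L [M [T [[e0 d'0 d'd L0 M0] T1 T2 hA [hL hr]]]]]]] := radius.
have [de de0 hde] := growth.
pose de' := Num.min de 2^-1; have de'0 : 0 < de' by rewrite lt_min de0 invr_gt0 ltr0n.
have de'1 : de' <= 2^-1 by rewrite ge_min lexx orbT.
have de'd : de' <= de by rewrite ge_min lexx.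
pose K := \sum_(e in D | lv e == 0%N) `|al e| * de^-1 + 1.
have K0 : 0 < K by rewrite ltr_wpDl // sumr_ge0 // => e _; rewrite mulr_ge0 // invr_ge0 ltW.
have di : 0 < de^-1 by rewrite invr_gt0.
exists (d' / 2); first by lra.
split=> [|x w wd]; first by lra.
apply: (@decouple R V Al Fl W al0 eta d' M L K de' (T + de^-1)) => //; try lra.
- by move=> x' s hs; exact: (hA H).
- move=> t ht; have ht1 : de^-1 <= t by lra.
  have t0 : 0 <= t by lra.
  have le1 : de' * t <= de * t by rewrite ler_wpM2r.
  split.
    apply: appr_sum => e /andP[De /eqP le]; apply: apprZ.
    have [_ _ g3] := hde e De le; have [g4 _] := g3 t ht1; exact: appr_rad g4 le1.
  move=> u ut; apply: (@le_trans _ _ (\sum_(e in D | lv e == 0%N) `|al e| * de^-1 * t)).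
    apply: sum_cn_le => e /andP[De /eqP le]; rewrite cnM cn_real -mulrA ler_wpM2l //.
    have [_ _ g3] := hde e De le; have [_ g5] := g3 t ht1; apply: g5; exact: le_trans le1.
  by rewrite /K [leRHS]mulrDl mul1r mulr_suml lerDl.
- move=> x' t k ht hk; have tT : T <= t by lra.
  by have [_] := hr x' t k tT hk.
Qed.

Let fu (w : C) e : C := Ev1 (fun i => H i w) (lv1 e) e.

(** The part of the difference of two inner functions that is free of x. At a small real w it is the
    difference of the two biases in the reduced system. *)
Let Delta (ee : V * V) (w : C) : C := let: (e, e') := ee in
  if lv1 e is m.+1 then
    rc (b e - b e') + \sum_(j in D1 | (lv1 j == m) && ~~ udep m j) rc (a e j - a e' j) * fu w j
  else H e w - H e' w.

(** Pairs with equal incoming weights in the reduced system, which only the biases can separate. *)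
Let conflict (ee : V * V) : Prop := let: (e, e') := ee in
  [/\ e != e', e \in D1, e' \in D1, lv1 e = lv1 e' &
   if lv1 e is m.+1 then forall j, j \in D1 -> lv1 j = m -> udep m j -> a e j = a e' j else W e = W e'].

Let fu_holo e : holo (fu ^~ e) 0.
Proof.
have [h [L [M [h0 L0 M0 hn]]]] := near_real C0 hc1 D1 lv1 a b (lv1 e).
have [_ _ _ n4] := hn _ (leqnn _).
have h2 : 0 < h by [].
have [d1 d10 hd1] : exists2 d1, 0 < d1 & forall i, d1 <= d /\ forall w, cn w <= d1 -> cn (H i w - H i 0) <= h.
  apply: fin_delta => [i|i u v [k1 k2] v0 vu]; last first.
    by split=> [|w wv]; [exact: le_trans vu k1|apply: k2; exact: le_trans vu].
  have [d1 d10 [d1d hd1]] := appr_cont d0 (HA i) h2; exists d1 => //; split=> // w wd.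
  by apply: hd1; rewrite subr0.
exists d1 => //; have [|||_ //] := n4 H 0 d1 e.
- exact: ltW.
- by move=> i; apply: appr_rad (HA i) _; have [] := hd1 i.
- move=> i w; rewrite subr0 => wd; have [_ k] := hd1 i; have k1 := k w wd; split => //.
  apply: le_trans k1; have := le_im_cn (H i w - H i 0).
  by rewrite imD imN (HR i 0) subr0.
Qed.

Let Delta_holo ee : holo (Delta ee) 0.
Proof.
case: ee => e e'; rewrite /Delta; case: (lv1 e) => [|m].
  by apply: holoB; exists d.
apply: holoD; first exact: holo_cst.
by apply: holo_sum => j _; apply: holoZ; exact: fu_holo.
Qed.

(** Otherwise the two inner functions would agree near a good point close to the pole, hence on the
    real line. Their difference is a linear relation among nodes one level below, so [IH] makes all
    weights agree, and [wf] then gives e = e'. *)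
Let Delta_nonzero ee : conflict ee ->
  ~ exists2 r, 0 < r & forall w, cn w < r -> Delta ee w = 0.
Proof.
case: ee => e e' [ne De1 De1' lee cf] [r r0 hr].
have [De le] := D1P De1; have [De' le'] := D1P De1'.
have [eta [d' [L [M [T [[eta0 d'0 d'd L0 M0] T1 T2 _ [_ hrad]]]]]]] := radius.
(* Yields a point with all inner values good, thus in the natural domain, and with w inside the
   radii [r] and [d] since t is large. *)
have [t [k [tT hk]]] := dirichlet_large W (T + (2 / r) + 2 / d) eta0.
have r2 : 0 < 2 / r by rewrite divr_gt0.
have d2 : 0 < 2 / d by rewrite divr_gt0.
have t0 : 0 < t by lra.
have [|gz _] := hrad 0 t k _ hk; first by lra.
have [u0 cu iw0 cw0] := inv_it 0 t0.
set w0 := (rc 0 + 'i%C * rc t)^-1 in gz iw0 cw0.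
set z0 := rc p + 'i%C / 2 + w0 in gz.
have tr : t^-1 <= r / 2 by rewrite -[leRHS]invrK lef_pV2 ?posrE ?invr_gt0 ?divr_gt0 // invf_div; lra.
have td : t^-1 <= d / 2 by rewrite -[leRHS]invrK lef_pV2 ?posrE ?invr_gt0 ?divr_gt0 // invf_div; lra.
set m := lv1 e in le lee cf.
pose be j : R := if lv j == m then a e j - a e' j else 0.
pose G z : C := \sum_(j in D | lv j == m) rc (a e j - a e' j) * Ev D lv a b (lin b om z) m j + rc (b e - b e').
have [U [oU cU RU hU holU]] := natural_domain C0 hc1 hSd D lv a b b om.
have Uz0 : U z0 by exact: hU.
have holG z : U z -> holo G z.
  move=> Uz; apply: holoD; last exact: holo_cst.
  by apply: holo_sum => j /andP[Dj /eqP lj]; apply: holoZ; have := holU z j Uz Dj; rewrite lj.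
have near0 : exists2 q, 0 < q & forall z, cn (z - z0) < q -> G z = 0.
  have wi : 0 < `|im w0| by rewrite normr_gt0.
  exists (Num.min (`|im w0|) (Num.min (r / 2) (d / 2))).
    by rewrite !lt_min wi; apply/andP; split; lra.
  move=> z; rewrite !lt_min => /and3P[zi zr zd].
  pose w := z - (rc p + 'i%C / 2).
  have zE : z = rc p + 'i%C / 2 + w by rewrite /w addrC subrK.
  have ww0 : w - w0 = z - z0 by rewrite /w /z0; ring.
  have iw : im w != 0.
    apply/negP => /eqP e0; have := le_im_cn (w - w0); rewrite {2}ww0 imD imN e0 sub0r normrN.
    by rewrite leNgt zi.
  have cw : cn w <= cn (z - z0) + t^-1.
    by rewrite -(subrK w0 w) ww0; apply: le_trans (cnD _ _) _; rewrite lerD2l.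
  have wr : cn w < r by lra.
  have wd : cn w <= d by lra.
  have := hr w wr; rewrite /Delta /G -/m.
  case Em : m cf => [|m'] cf D0.
    have HE1 := HE De; rewrite le Em in HE1; have HE2 := HE De'; rewrite le' -lee Em in HE2.
    have := HE1 w erefl iw wd; have := HE2 w erefl iw wd; rewrite -zE /inn => E2 E1.
    have X0 : \sum_(j in D | lv j == 0%N) rc (a e j) * Ev D lv a b (lin b om z) 0 j + rc (b e) -
      (\sum_(j in D | lv j == 0%N) rc (a e' j) * Ev D lv a b (lin b om z) 0 j + rc (b e')) = 0.
      by rewrite E1 E2 cf -[RHS]D0; ring.
    rewrite -[RHS]X0 rcB.
    under eq_bigr => j _ do rewrite rcB mulrBl.
    by rewrite sumrB; ring.
  rewrite -[RHS]D0 addrC; congr (_ + _).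
  rewrite (bigID (fun j => udep m' j)) /= big1 ?add0r; last first.
    move=> j /andP[/andP[Dj /eqP lj] uj].
    have Dj1 : j \in D1 by rewrite inE Dj lj.
    have [_ lj1] := D1P Dj1; rewrite lj in lj1.
    by rewrite (cf j) ?subrr ?mul0r //; case: lj1.
  apply: eq_big => [j|j /andP[/andP[Dj /eqP lj] nuj]].
    by rewrite inE -!andbA /lv1; case: (j \in D) => //=; case: (lv j).
  have Dj1 : j \in D1 by rewrite inE Dj lj.
  have [_ lj1] := D1P Dj1; rewrite lj in lj1; case: lj1 => lj1.
  congr (_ * _); rewrite -[sg _]/(Ev D lv a b (lin b om z) m'.+1 j) zE -lj shifted //.
  have [_ ->] := level1_input iw wd Dj1 erefl.
  rewrite /fu; transitivity (Ev1 (fun i => rc (W i) * w^-1 + H i w) (lv1 j) j) => //.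
  by apply: udep_const => //; rewrite -lj1.
have G0 x : G (rc x) = 0 by apply: (identity_thm cU holG Uz0 near0).
have lin_rc x : lin b om (rc x) = (fun e => rc (b e + x * om e)).
  by apply/funext => j; rewrite /lin rcD rcM.
have IHm j : j \in D -> lv j = m -> a e j = a e' j.
  move=> Dj lj; apply/eqP; rewrite -subr_eq0; apply/eqP.
  have -> : a e j - a e' j = be j by rewrite /be lj eqxx.
  apply: (@IH [set e in D | (lv e <= m)%N] lv a b om be (- rc (b e - b e'))); last by rewrite inE Dj lj leqnn.
  (* The node [e] lies above level [m], so truncation at [m] loses it. *)
  - apply: proper_card; apply/properP; split; first by apply/fintype.subsetP => i; rewrite inE => /andP[].
    by exists e => //; rewrite inE De le ltnn.
  - exact: wf_cut.
  move=> x; have := G0 x; rewrite /G => /eqP; rewrite addr_eq0 => /eqP <-.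
  rewrite /rel_sum [LHS]big_mkcond [RHS]big_mkcond /=; apply: eq_bigr => i _; rewrite inE.
  rewrite /be; case: (i \in D) => //=; case: (eqVneq (lv i) m) => [li|nl].
    by rewrite li leqnn ev_cut // lin_rc.
  by case: ifP => //; rewrite mul0r.
have bb : b e = b e'.
  have := G0 0; rewrite /G big1 ?add0r => [/eqP|j /andP[Dj /eqP lj]]; last by rewrite (IHm j) // subrr mul0r.
  by rewrite rc_eq0 subr_eq0 => /eqP.
have [_ _ _ k4] := wf; move/eqP: ne; apply; apply: (k4 e e' m) => //.
by rewrite le' -lee.
Qed.

(** The nodes that feel the pole form a smaller system in the variable x with frequencies [W], at a
    small real w where no relevant [Delta] vanishes. [IH] kills [al] on it; but then a node of
    maximal level has, by [top], a successor, which feels the pole as well. *)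
Lemma step_absurd : False.
Proof.
have [d' d'0 [d'd hdec]] := decoupled.
have [r r0 hr] : exists2 r, 0 < r & forall ee, conflict ee -> forall w, 0 < cn w -> cn w < r -> Delta ee w <> 0.
  apply: fin_delta => [ee|ee u v h v0 vu cf w w0 wv]; last by apply: h => //; exact: lt_le_trans vu.
  have [cf|ncf] := pselect (conflict ee); last by exists 1.
  have [h|[u u0 hu]] := zero_dich (Delta_holo ee); last first.
    by exists u => // _ w w0 wu; apply: hu; rewrite subr0.
  exfalso; apply: (Delta_nonzero cf); have [u u0 hu] := h; exists u => // w wu.
  by apply: hu; rewrite subr0.
pose o := Num.min d' r / 2.
have m0 : 0 < Num.min d' r by rewrite lt_min d'0.
have md : Num.min d' r <= d' by rewrite ge_min lexx.
have mr : Num.min d' r <= r by rewrite ge_min lexx orbT.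
have o0 : 0 < o by rewrite /o; lra.
have od : o <= d' by rewrite /o; lra.
have or : o < r by rewrite /o; lra.
clearbody o; pose w : C := rc o.
have cw : cn w = o by rewrite cn_real gtr0_norm.
pose D' := [set e in D1 | udep (lv1 e) e].
(* Nodes that do not feel the pole are constant in x, and real because w is real: they enter the
   biases. *)
pose b' e : R := if lv1 e is m.+1 then
    b e + \sum_(j in D1 | (lv1 j == m) && ~~ udep m j) a e j * re (fu w j) else re (H e w).
have rcre (z : C) : im z = 0 -> rc (re z) = z.
  by move=> iz; apply: cplx_ext; rewrite ?re_rc ?im_rc.
have fuR j : rc (re (fu w j)) = fu w j.
  apply: (rcre _ _); rewrite /fu evE.
  rewrite -(rcre _ (inn_real C0 hc1 D1 lv1 a b (lv1 j) j (fun i => HR i o))).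
  exact: (csig_rc_im C0 hc1).
have evD' x n : forall e, e \in D' -> lv1 e = n ->
    Ev D' lv1 a b' (fun e => rc (b' e + x * W e)) n e = Ev1 (fun i => rc (W i) * rc x + H i w) n e.
  elim: n => [|n IHn] e; rewrite inE => /andP[De ue] le.
    rewrite !evE /inn; congr (sg _); rewrite /b' le rcD rcM (rcre _ (HR e o)) addrC.
    by rewrite [rc x * _]mulrC.
  suff E : Inn D' lv1 a b' (fun e => rc (b' e + x * W e)) n.+1 e =
           Inn1 (fun i => rc (W i) * rc x + H i w) n.+1 e by rewrite -[LHS]/(sg (Inn _ _ _ _ _ n.+1 e)) E.
  have b'E : b' e = b e + \sum_(j in D1 | (lv1 j == n) && ~~ udep n j) a e j * re (fu w j) by rewrite /b' le.
  rewrite /inn b'E rcD rc_sum [RHS]addrC [LHS]addrC -[LHS]addrA.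
  apply: (congr1 (fun t => rc (b e) + t)).
  rewrite [RHS](bigID (fun j => udep n j)) /= [RHS]addrC; congr (_ + _).
    apply: eq_big => [j|j /andP[Dj /andP[/eqP lj nuj]]]; first by rewrite andbA.
    by rewrite rcM fuR udep_const // /fu lj.
  apply: eq_big => [j|j /andP[Dj /eqP lj]].
    by rewrite inE -!andbA; case: (eqVneq (lv1 j) n) => [->|]; rewrite ?andbF ?andbT.
  by rewrite IHn.
have D'P e : e \in D' -> e \in D1 /\ udep (lv1 e) e by rewrite inE => /andP[].
have wf' : wf_sys D' lv1 a b' W.
  split.
  - by move=> e; rewrite inE => /andP[_ +] le; rewrite le.
  - move=> e m; rewrite inE => /andP[_ +] le; rewrite le /= => /existsP[j /and4P[Dj /eqP lj aj uj]].
    by exists j; split => //; rewrite inE Dj lj.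
  - move=> e e' /D'P[De ue] /D'P[De' ue'] le le' We be; apply/eqP/contraT => ne.
    have cf : conflict (e, e') by split => //; rewrite ?le ?le'.
    case: (hr _ cf w); rewrite ?cw // /Delta le -(rcre _ (HR e o)) -(rcre _ (HR e' o)).
    by move: be; rewrite /b' le le' => ->; rewrite subrr.
  - move=> e e' m /D'P[De ue] /D'P[De' ue'] le le' hj be; apply/eqP/contraT => ne.
    have cf : conflict (e, e').
      split => //; rewrite ?le ?le' // => j Dj lj uj; apply: hj => //.
      by rewrite inE Dj lj.
    case: (hr _ cf w); rewrite ?cw // /Delta le.
    have -> : \sum_(j in D1 | (lv1 j == m) && ~~ udep m j) rc (a e j - a e' j) * fu w j =
       rc (\sum_(j in D1 | (lv1 j == m) && ~~ udep m j) (a e j * re (fu w j) - a e' j * re (fu w j))).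
      by rewrite rc_sum; apply: eq_bigr => j _; rewrite -mulrBl rcM fuR.
    rewrite sumrB -rcD; move: be; rewrite /b' le le' => be.
    have -> : b e - b e' + (\sum_(j in D1 | (lv1 j == m) && ~~ udep m j) a e j * re (fu w j) -
       \sum_(j in D1 | (lv1 j == m) && ~~ udep m j) a e' j * re (fu w j)) =
      (b e + \sum_(j in D1 | (lv1 j == m) && ~~ udep m j) a e j * re (fu w j)) -
      (b e' + \sum_(j in D1 | (lv1 j == m) && ~~ udep m j) a e' j * re (fu w j)) by ring.
    by rewrite be subrr.
have [i [Di li Wi]] := W0.
have Di1 : i \in D1 by rewrite inE Di li.
have lt : (#|D'| < #|D|)%N.
  have [_ k2 _ _] := wf; have [j [Dj lj _]] := k2 i 0%N Di li.
  apply: proper_card; apply/properP; split.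
    by apply/fintype.subsetP => e; rewrite inE => /andP[/D1P[]].
  by exists j => //; rewrite !inE lj ltnn andbF.
have hrel' x : Rel D' lv1 a b' al (fun e => rc (b' e + x * W e)) =
    Al 0 (fun=> 0) w - \sum_(e in D1 | ~~ udep (lv1 e) e) rc (al e) * fu w e.
  rewrite -(hdec x w) ?cw // /Al (bigID (fun e => udep (lv1 e) e)) /=.
  have Ye : (fun i => rc (W i * x) + H i w + 'i%C * rc 0) = (fun i => rc (W i) * rc x + H i w).
    by apply/funext => j; rewrite mulr0 addr0 rcM.
  rewrite Ye [X in _ = _ + X - _](eq_bigr (fun e => rc (al e) * fu w e)); last first.
    by move=> e /andP[De ue]; rewrite udep_const.
  rewrite addrK /rel_sum; apply: eq_big => [e|e De]; first by rewrite inE.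
  by rewrite evD'.
have al_zero := IH lt wf' hrel'.
have Di' : i \in D' by rewrite inE Di1 /lv1 li.
have [e De' emax] := @arg_maxnP _ i (fun e => e \in D') lv1 Di'.
have [j [Dj lj aj]] := top (D1P (D'P e De').1).1 (al_zero e De').
have : j \in D'.
  move: De'; rewrite inE => /andP[De1 ue]; have [De le] := D1P De1.
  have lj1 : lv1 j = (lv1 e).+1 by rewrite /lv1 lj le.
  rewrite inE [j \in D1]inE Dj lj lj1 /=; apply/existsP; exists e.
  by rewrite De1 eqxx aj.
move=> /emax; rewrite /lv1 lj /=; have : e \in D1 by move: De'; rewrite inE => /andP[].
by move=> /D1P[_ le]; rewrite {1}le ltnn.
Qed.

End Step.

(** A node with zero coefficient and no successor can be deleted. When none is left, every node of
    zero coefficient has a successor, which is the hypothesis [top] of the inductive step. *)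
Theorem system_independence n D lv a b om al (al0 : C) : (#|D| <= n)%N -> wf_sys D lv a b om ->
  (forall x, Rel D lv a b al (fun e => rc (b e + x * om e)) = al0) ->
  forall e, e \in D -> al e = 0.
Proof.
elim: n D lv a b om al al0 => [|n IHn] D lv a b om al al0.
  by rewrite leqn0 cards_eq0 => /eqP-> _ _ e; rewrite inE.
move=> cD wf hrel.
have IH D' lv' a' b' om' al' (al0' : C) : (#|D'| < #|D|)%N -> wf_sys D' lv' a' b' om' ->
  (forall x, Rel D' lv' a' b' al' (fun e => rc (b' e + x * om' e)) = al0') ->
  forall e, e \in D' -> al' e = 0.
  by move=> lt; apply: IHn; rewrite -ltnS; exact: leq_trans lt cD.
have [[e0 [De0 ale0 term]]|top] := pselect (exists e0, [/\ e0 \in D, al e0 = 0 &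
    forall j, j \in D -> lv j = (lv e0).+1 -> a j e0 = 0]).
  move=> e De; have [->//|ne] := eqVneq e e0.
  apply: (IH (D :\ e0) lv a b om al al0); last by rewrite in_setD1 ne.
  - by rewrite [X in (_ < X)%N](cardsD1 e0) De0.
  - exact: wf_remove.
  move=> x; rewrite -(hrel x) /rel_sum [RHS](bigD1 e0) //= ale0 mul0r add0r.
  apply: eq_big => [j|j /setD1P[_ Dj]]; first by rewrite in_setD1 andbC.
  by rewrite ev_remove.
have {}top e : e \in D -> al e = 0 -> exists j, [/\ j \in D, lv j = (lv e).+1 & a j e != 0].
  move=> De ae; apply: contrapT => h; apply: top; exists e; split => // j Dj lj.
  by apply/eqP; apply: contraT => aj; exfalso; apply: h; exists j.
have [[e [De le]]|nolev] := pselect (exists e, e \in D /\ (0 < lv e)%N); last first.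
  apply: (level0_case wf _ hrel) => e De; apply/eqP; rewrite -leqn0 leqNgt; apply/negP => le.
  by apply: nolev; exists e.
exfalso; have [i1 [Di1 li1]] := wf_level1 wf De le.
pose lev1 i := (i \in D) && (lv i == 1%N).
(* Rows of indices outside level 1 are zero, so by [no_pole] a non-zero residue can only occur at
   level 1. *)
pose A i j := if [&& lev1 i, j \in D & lv j == 0%N] then a i j else 0.
pose J := [set j in D | [exists i, A i j != 0]].
have AJ i j : A i j != 0 -> [/\ lev1 i, j \in D & lv j = 0%N].
  by rewrite /A; case: ifP => [/and3P[? ? /eqP]|]; rewrite ?eqxx.
have [_ w2 _ _] := wf; have [j1 [Dj1 lj1 aj1]] := w2 i1 0%N Di1 li1.
have [||om' [oz [wf' hrel' hz [j2 [Jj2 odd2]]]]] := odd_direction hc1 hSd (J := J) wf hrel.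
- exists j1; rewrite inE Dj1; apply/existsP; exists i1.
  by rewrite /A /lev1 Di1 li1 Dj1 lj1.
- by move=> j; rewrite inE => /andP[_ /existsP[i /AJ[]]].
have [_ _ k3 _] := wf'.
have [|||p [d [W [H [d0 [i Wi] HA HR HE]]]]] :=
    @pole_expansion R C0 S c hc1 V V A b om' b oz hSd hSa hc0.
- by move=> i j aij; apply: hz; rewrite inE; have [_ -> _] := AJ _ _ aij; apply/existsP; exists i.
- by move: Jj2; rewrite inE => /andP[_ /existsP[i Ai]]; exists i, j2.
- by move=> i i' j j' /AJ[_ Dj lj] /AJ[_ Dj' lj']; exact: k3.
apply: (@step_absurd D lv a b om' al al0 wf' hrel' IH top p d W H d0 HA HR).
  exists i; have [/andP[Di /eqP li]|nl] := boolP (lev1 i); first by [].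
  exfalso; move/eqP: Wi; apply; apply: (no_pole (al0 := rc (b i)) d0 (HA i)).
  exists d => // w iw wd; rewrite -HE // big1 ?add0r // => j _.
  by rewrite /A (negPf nl) mul0r.
move=> k w Dk lk iw wd; rewrite -HE // /inn; apply: (congr1 (fun t => t + rc (b k))).
rewrite [LHS]big_mkcond /=; apply: eq_bigr => j _; rewrite /A /lev1 Dk lk /=.
case: ifP => _; last by rewrite mul0r.
by rewrite /lin [rc (b j) + _]addrC [rc (om' j) * _]mulrC.
Qed.

End MainSystem.

(** * From networks to systems *)

Lemma exists_nonroot (R : realType) (P : {poly R}) : P != 0 -> exists y, P.[y] != 0.
Proof.
move=> P0; apply: contrapT => h.
pose rs : seq R := [seq k%:R | k <- iota 0 (size P)].
have : (size rs < size P)%N.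
  apply: max_poly_roots => //.
    apply/allP => y _; rewrite rootE; apply: contraT => ny; exfalso; apply: h; by exists y.
  by rewrite map_inj_uniq ?iota_uniq // => k l /eqP; rewrite eqr_nat => /eqP.
by rewrite size_map size_iota ltnn.
Qed.

(* A point of the moment curve avoids finitely many hyperplanes. *)
Lemma generic_vector (R : realType) (K I : finType) (v : K -> I -> R) :
  exists t : I -> R, forall k, (exists i, v k i != 0) -> \sum_i v k i * t i != 0.
Proof.
pose m := #|{: I}|.
pose P (k : K) : {poly R} := \poly_(j < m) (if insub j is Some i then v k (@enum_val I predT i) else 0).
have Pc k (i : I) : (P k)`_(enum_rank i) = v k i.
  by rewrite coef_poly ltn_ord valK enum_rankK.
pose Q := \prod_(k | P k != 0) P k.
have Q0 : Q != 0 by apply/prodf_neq0.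
have [y hy] := exists_nonroot Q0; exists (fun i => y ^+ enum_rank i) => k [i vi].
have Pk : P k != 0 by apply: contraNneq vi => e; rewrite -Pc e coef0.
have : (P k).[y] != 0.
  apply: contra hy; rewrite /Q (bigD1 k) //= hornerM => /eqP ->; by rewrite mul0r.
rewrite /P horner_poly; congr (_ != 0).
rewrite (reindex (@enum_rank I)) /=; last by exists enum_val => j _; rewrite ?enum_rankK ?enum_valK.
by apply: eq_bigr => j _; rewrite valK enum_rankK.
Qed.

Section Network.
Variables (R : realType) (T : choiceType) (Vin : {fset T}) (M : gfnn R Vin).
Implicit Types u v : T.

Lemma edge_not_input u v : edge M u v -> v \notin Vin.
Proof.
move=> uv; apply/negP; rewrite {1}(inputsE M) in_fset /= inE => /andP[_ /eqP e].
have /andP[uM _] := edge_nodes uv.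
have : u \in [fset u in nodes M | edge M u v]%fset by rewrite in_fset /= inE uM uv.
by rewrite e inE.
Qed.

Lemma input_nodes v : v \in Vin -> v \in nodes M.
Proof. by rewrite {1}(inputsE M) in_fset /= inE => /andP[]. Qed.

Lemma has_parent v : v \in nodes M -> v \notin Vin -> exists u, edge M u v.
Proof.
move=> vM vI; have : par M v != fset0.
  by apply: contra vI => e; rewrite {1}(inputsE M) in_fset /= inE vM.
by case/fset0Pn => u; rewrite in_fset /= inE => /andP[_ uv]; exists u.
Qed.

Lemma level_eq0 v : v \in nodes M -> (level M v == 0%N) = (v \in Vin).
Proof. by move=> vM; rewrite levelE //; case: ifP. Qed.

Lemma sum_par (A : nmodType) (U : {fset T}) (F : T -> A) v : (forall u, edge M u v -> u \in U) ->
  \sum_(u <- par M v) F u = \sum_(p : U | edge M (val p) v) F (val p).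
Proof.
move=> sub; rewrite -[RHS]big_filter -(big_map val xpredT F); apply: perm_big.
apply: uniq_perm; first exact: fset_uniq.
  rewrite map_inj_uniq; last exact: val_inj.
  by rewrite filter_uniq // index_enum_uniq.
move=> u; rewrite in_fset /= inE; apply/andP/mapP => [[uM uv]|[p]].
  exists [` sub _ uv]%fset => //; by rewrite mem_filter mem_index_enum uv.
rewrite mem_filter => /andP[pv _] ->; split => //.
by have /andP[] := edge_nodes pv.
Qed.

Lemma node_map_input rho (i : Vin) t : node_map M rho (val i) t = t i.
Proof. rewrite node_mapE ?input_nodes ?(valP i) //; case: insubP => [j _ /val_inj -> //|]; by rewrite (valP i). Qed.

Lemma node_map_noninput rho v t : v \in nodes M -> v \notin Vin ->
  node_map M rho v t = rho (\sum_(u <- par M v) weight M v u * node_map M rho u t + bias M v).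
Proof. by move=> vM vI; rewrite node_mapE //; case: insubP => // i; rewrite (negPf vI). Qed.

(** Weights on edges being non-zero, the extension by 0 also encodes the edge relation, so edges and
    weights are transported together. *)
Definition ewt (w v : T) : R := if edge M v w then weight M w v else 0.

Lemma ewt_neq0 w v : (ewt w v != 0) = edge M v w.
Proof. by rewrite /ewt; case: ifP => [/weight_neq0|]; rewrite ?eqxx. Qed.

Lemma eq_of_ewt v w : clones_free M -> v \in nodes M -> w \in nodes M -> v \notin Vin -> w \notin Vin ->
  bias M v = bias M w -> (forall u, ewt v u = ewt w u) -> v = w.
Proof.
move=> cf vM wM vI wI b E; apply/eqP; apply: contraT => ne; exfalso; apply: (@cf v w).
have eE u : edge M u v = edge M u w by rewrite -!ewt_neq0 E.
split; rewrite ?inE ?vM ?wM ?vI ?wI //.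
- by apply/fsetP => u; rewrite !in_fset /= !inE eE.
- by move=> u; rewrite in_fset /= inE => /andP[_ uv]; have := E u; rewrite /ewt -eE uv.
Qed.

End Network.

(** * Identification of the nodes that compute the same expression *)

Section Expressions.
Variables (R : realType) (T : choiceType) (Vin : {fset T}) (n : nat) (N : 'I_n -> gfnn R Vin).
Hypothesis hlfnn : forall j, is_lfnn (N j).
Hypothesis hcf : forall j, clones_free (N j).

Definition all_nodes : {fset T} := seq_fset tt (flatten [seq enum_fset (nodes (N j)) | j <- enum 'I_n]).
Local Notation U := all_nodes.
Local Notation V := ('I_n * U)%type.

Lemma nodes_sub j : (nodes (N j) `<=` U)%fset.
Proof.
apply/fsubsetP => v vN; rewrite seq_fsetE; apply/flatten_mapP; exists j => //.
by rewrite mem_enum.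
Qed.

Definition nt (x : V) := N x.1.
Definition nd (x : V) : T := val x.2.

(** The index is the level minus one: inputs are not nodes of the system, so level 1 of a network is
    level 0 of the system. *)
Definition ok (k : nat) (x : V) :=
  [&& nd x \in nodes (nt x), nd x \notin Vin & level (nt x) (nd x) == k.+1].

Definition iw (x : V) (i : Vin) : R := ewt (nt x) (nd x) (val i).

(** Parents are grouped by representative. That a class contains at most one parent is known only
    after [rep_inj], hence the sum. *)
Definition pw (r : V -> V) (x u : V) : R :=
  \sum_(p : U | edge (nt x) (val p) (nd x) && (r (x.1, p) == u)) weight (nt x) (nd x) (val p).

Definition bs (x : V) : R := bias (nt x) (nd x).

Definition same_with (r : V -> V) (k : nat) (x x' : V) :=
  (bs x == bs x') && (if k is _.+1 then [forall u, pw r x u == pw r x' u] else [forall i, iw x i == iw x' i]).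

(* A canonical representative among all nodes of all networks computing the
   same expression; the parents are identified first. *)
Fixpoint rep (k : nat) (x : V) : V :=
  odflt x [pick x' | ok k x' && same_with (if k is m.+1 then rep m else id) k x x'].

Definition same k := same_with (if k is m.+1 then rep m else id) k.

Lemma repE k x : rep k x = odflt x [pick x' | ok k x' && same k x x'].
Proof. by case: k. Qed.

Lemma same_refl k x : same k x x.
Proof. by rewrite /same /same_with eqxx; case: k => [|k]; apply/forallP. Qed.

Lemma same_sym k x x' : same k x x' = same k x' x.
Proof.
rewrite /same /same_with eq_sym; congr (_ && _).
by case: k => [|k]; apply: eq_forallb => u; rewrite eq_sym.
Qed.

Lemma same_trans k x y z : same k x y -> same k y z -> same k x z.
Proof.
rewrite /same /same_with => /andP[/eqP-> h1] /andP[/eqP-> h2]; rewrite eqxx /=.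
case: k h1 h2 => [|k] /forallP h1 /forallP h2; apply/forallP => u; by rewrite (eqP (h1 u)) (eqP (h2 u)).
Qed.

Lemma rep_ok k x : ok k x -> ok k (rep k x) /\ same k x (rep k x).
Proof.
move=> okx; rewrite repE; case: pickP => [y /andP[]//|/(_ x)]; by rewrite okx same_refl.
Qed.

Lemma rep_eq k x x' : ok k x -> ok k x' -> same k x x' -> rep k x = rep k x'.
Proof.
move=> okx okx' s; rewrite !repE.
have E : (fun y => ok k y && same k x y) =1 (fun y => ok k y && same k x' y).
  move=> y; congr (_ && _); apply/idP/idP; last exact: same_trans s.
  by apply: same_trans; rewrite same_sym.
rewrite (eq_pick E); case: pickP => [//|/(_ x')]; by rewrite okx' same_refl.
Qed.

Lemma rep_same k x x' : ok k x -> ok k x' -> rep k x = rep k x' -> same k x x'.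
Proof.
move=> okx okx' e; have [_ s1] := rep_ok okx; have [_ s2] := rep_ok okx'.
by apply: (same_trans s1); rewrite e same_sym.
Qed.

Lemma rep_id k x : ok k x -> rep k (rep k x) = rep k x.
Proof. by move=> okx; have [okr s] := rep_ok okx; rewrite -(rep_eq okx okr s). Qed.

Lemma parent_ok k x (p : U) : ok k.+1 x -> edge (nt x) (val p) (nd x) -> ok k (x.1, p).
Proof.
move=> /and3P[_ _ /eqP lx] px; rewrite /ok /nt /nd /=.
have /andP[pN _] := edge_nodes px; rewrite pN /=.
have := hlfnn px; rewrite -/(nt x) lx => -[<-]; rewrite eqxx andbT.
by rewrite -(level_eq0 pN) -[level _ _]/(level (nt x) (val p)); have := hlfnn px; rewrite lx => -[<-].
Qed.

Lemma parent_input x v : ok 0 x -> edge (nt x) v (nd x) -> v \in Vin.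
Proof.
move=> /and3P[_ _ /eqP lx] px; have /andP[pN _] := edge_nodes px.
by rewrite -(level_eq0 pN); have := hlfnn px; rewrite lx => -[<-].
Qed.

Lemma pw_rep_inj k x (p : U) :
  (forall y z, ok k y -> ok k z -> y.1 = z.1 -> rep k y = rep k z -> y = z) ->
  ok k.+1 x -> ok k (x.1, p) -> pw (rep k) x (rep k (x.1, p)) = ewt (nt x) (nd x) (val p).
Proof.
move=> inj okx okp; rewrite /pw /ewt.
rewrite (eq_bigl (fun q : U => (q == p) && edge (nt x) (val p) (nd x))).
  by case: ifP => e; [under eq_bigl do rewrite andbT; rewrite big_pred1_eq|rewrite big_pred0 // => q; rewrite andbF].
move=> q; apply/andP/andP => [[qx /eqP e]|[/eqP-> e]]; last by [].
have := inj _ _ (parent_ok okx qx) okp erefl e; case=> qp; by rewrite -qp qx eqxx.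
Qed.

Lemma eq_node x x' : x.1 = x'.1 -> nd x = nd x' -> x = x'.
Proof. by case: x x' => [j p] [j' p']; rewrite /nd /= => -> /val_inj ->. Qed.

Lemma ewt_notin x v : v \notin U -> ewt (nt x) (nd x) v = 0.
Proof.
move=> vU; apply/eqP; apply: contraNT vU; rewrite ewt_neq0 => /edge_nodes/andP[vN _].
exact: (fsubsetP (nodes_sub x.1)).
Qed.

(** By induction the parents are identified injectively, so equal grouped weights are equal weights
    on the same parents, and two such nodes would be clones. *)
Lemma rep_inj k x x' : ok k x -> ok k x' -> x.1 = x'.1 -> rep k x = rep k x' -> x = x'.
Proof.
elim: k x x' => [|k IH] x x' okx okx' j e; have := rep_same okx okx' e; rewrite /same /same_with => /andP[/eqP b];
  have /and3P[xN xI _] := okx; have /and3P[xN' xI' _] := okx'; move=> /forallP h; apply: eq_node => //;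
  have jt : nt x' = nt x by [rewrite /nt -j]; rewrite jt in xN'; rewrite /bs jt in b;
  apply: (eq_of_ewt (@hcf x.1)) => // v.
  have [vI|vI] := boolP (v \in Vin); first by have /eqP := h [` vI]%fset; rewrite /iw jt.
  have z y : ok 0 y -> ewt (nt y) (nd y) v = 0.
    by move=> oky; apply/eqP; apply: contraNT vI; rewrite ewt_neq0; exact: parent_input.
  by rewrite -/(nt x) z // -jt z.
have [vU|vU] := boolP (v \in U); last by rewrite -/(nt x) ewt_notin // -jt ewt_notin.
pose p : U := [` vU]%fset.
have [okp|nokp] := boolP (ok k (x.1, p)); last first.
  have z y : y.1 = x.1 -> ok k.+1 y -> ewt (nt y) (nd y) v = 0.
    move=> jy oky; apply/eqP; apply: contraNT nokp; rewrite ewt_neq0 -jy; exact: (@parent_ok k y p).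
  by rewrite -/(nt x) z // -jt z.
have /eqP := h (rep k (x.1, p)); rewrite (pw_rep_inj IH okx okp) => ->.
by rewrite j pw_rep_inj // -?j // jt.
Qed.

Lemma pw_rep k x (p : U) : ok k.+1 x -> ok k (x.1, p) -> pw (rep k) x (rep k (x.1, p)) = ewt (nt x) (nd x) (val p).
Proof. exact: pw_rep_inj (@rep_inj k). Qed.

Definition lvl (x : V) := (level (nt x) (nd x)).-1.
Definition reps : {set V} := [set x | ok (lvl x) x && (rep (lvl x) x == x)]%SET.
Definition lin_w (x u : V) : R := if lvl x is m.+1 then pw (rep m) x u else 0.

Lemma ok_lvl k x : ok k x -> lvl x = k.
Proof. by move=> /and3P[_ _ /eqP e]; rewrite /lvl e. Qed.

Lemma repsP x : reflect (ok (lvl x) x /\ rep (lvl x) x = x) (x \in reps).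
Proof. by rewrite inE; apply: (iffP andP) => -[? /eqP]. Qed.

Lemma rep_reps k x : ok k x -> rep k x \in reps.
Proof.
move=> okx; have [okr _] := rep_ok okx; apply/repsP; rewrite (ok_lvl okr); split => //.
exact: rep_id.
Qed.

Variable ta : Vin -> R.
Hypothesis hta : forall x x', ((exists i, iw x i != 0) -> \sum_i iw x i * ta i != 0) /\
  ((exists i, iw x i - iw x' i != 0) -> \sum_i (iw x i - iw x' i) * ta i != 0).
Definition om (x : V) : R := \sum_i iw x i * ta i.

(** The generic line enters at level 0: non-zero weight vectors, and differences of distinct ones,
    have a non-zero product with [ta]. *)
Lemma reps_wf : wf_sys reps lvl lin_w bs om.
Proof.
split.
- move=> x /repsP[okx _] l0; rewrite l0 in okx; apply: (hta x x).1.
  have /and3P[xN xI _] := okx; have [u ux] := has_parent xN xI.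
  have uI := parent_input okx ux; exists [` uI]%fset.
  by rewrite /iw ewt_neq0.
- move=> x m /repsP[okx _] lm; rewrite lm in okx.
  have /and3P[xN xI _] := okx; have [u ux] := has_parent xN xI.
  have /andP[uN _] := edge_nodes ux; pose p : U := [` fsubsetP (nodes_sub x.1) _ uN]%fset.
  have okp : ok m (x.1, p) by exact: (@parent_ok m x p okx ux).
  exists (rep m (x.1, p)); split; first exact: rep_reps.
    by apply: ok_lvl; have [] := rep_ok okp.
  by rewrite /lin_w lm pw_rep // ewt_neq0.
- move=> x x' /repsP[okx rx] /repsP[okx' rx'] l0 l0' e be; rewrite -rx -rx' l0 l0'.
  rewrite l0 in okx; rewrite l0' in okx'; apply: rep_eq => //.
  rewrite /same /same_with be eqxx; apply/forallP => i; apply: contraT => ne.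
  have : \sum_i (iw x i - iw x' i) * ta i != 0 by apply: (hta x x').2; exists i; rewrite subr_eq0.
  under eq_bigr do rewrite mulrBl.
  by rewrite sumrB -/(om x) -/(om x') e subrr eqxx.
- move=> x x' m /repsP[okx rx] /repsP[okx' rx'] lm lm' hj be; rewrite -rx -rx' lm lm'.
  rewrite lm in okx; rewrite lm' in okx'; apply: rep_eq => //.
  rewrite /same /same_with be eqxx; apply/forallP => u.
  have [/andP[Du /eqP lu]|nu] := boolP ((u \in reps) && (lvl u == m)).
    by have := hj u Du lu; rewrite /lin_w lm lm' => ->.
  have z y : ok m.+1 y -> pw (rep m) y u = 0.
    move=> oky; rewrite /pw big_pred0 // => p; apply/negP => /andP[py /eqP rp].
    move/negP: nu; apply; have okp := parent_ok oky py; rewrite -rp rep_reps //=.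
    by apply/eqP; apply: ok_lvl; have [] := rep_ok okp.
  by rewrite !z.
Qed.

Variables (C0 : R) (S : set R) (c : R -> R) (sigma : R -> R).
Hypothesis hsig : forall x, csig C0 S c (rc x) = rc (sigma x).

(** Both sides obey the same recursion, with the parents on the left gathered class by class; the
    inputs run along the line spanned by [ta]. *)
Lemma ev_rep (t : R) k x : ok k x ->
  ev C0 S c reps lvl lin_w bs (fun e => rc (bs e + t * om e)) k (rep k x) =
  rc (node_map (nt x) sigma (nd x) (fun i => t * ta i)).
Proof.
elim: k x => [|k IH] x okx; have [okr s] := rep_ok okx; have /and3P[xN xI _] := okx;
  rewrite node_map_noninput // -hsig evE; apply: (congr1 (csig C0 S c));
  move: s; rewrite /same /same_with => /andP[/eqP bE] /forallP h.
  rewrite /inn -bE; congr (rc _); rewrite addrC; congr (_ + _).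
  rewrite /om mulr_sumr (sum_par (U := Vin)); last by move=> u; exact: parent_input.
  rewrite [RHS]big_mkcond; apply: eq_bigr => i _; rewrite -(eqP (h i)) /iw /ewt.
  by case: ifP => _; rewrite ?mul0r ?mulr0 // node_map_input mulrCA.
rewrite /inn -bE rmorphD /=; apply: (congr1 (fun t => t + rc (bs x))).
rewrite (sum_par (U := U)) ?rmorph_sum /=; last first.
  by move=> u /edge_nodes/andP[uN _]; exact: (fsubsetP (nodes_sub x.1)).
rewrite (partition_big (fun p : U => rep k (x.1, p)) (fun u => (u \in reps) && (lvl u == k))) /=; last first.
  move=> p px; have okp := parent_ok okx px; have [okrp _] := rep_ok okp.
  by rewrite rep_reps //= (ok_lvl okrp).
apply: eq_bigr => u _; rewrite /lin_w (ok_lvl okr) -(eqP (h u)) /pw rmorph_sum mulr_suml.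
apply: eq_bigr => p /andP[px /eqP <-]; rewrite rmorphM /=; congr (_ * _).
by rewrite IH //; exact: parent_ok.
Qed.

(** * Isomorphism of networks with identified outputs *)

Lemma rep_lvl k k' x x' : ok k x -> ok k' x' -> rep k x = rep k' x' -> k = k'.
Proof. by move=> /rep_ok[/ok_lvl e _] /rep_ok[/ok_lvl e' _] h; rewrite -e h e'. Qed.

Lemma ok_noninput x : nd x \in nodes (nt x) -> nd x \notin Vin -> ok (lvl x) x.
Proof.
by move=> xN xI; rewrite /ok xN xI /= /lvl prednK // lt0n level_eq0.
Qed.

(** The grouped weight of [x] on the class of [p] is a single non-zero weight; as [x'] has the same
    one, it must have a parent in that class. *)
Lemma match_parent k x x' (p : U) : ok k.+1 x -> ok k.+1 x' -> rep k.+1 x = rep k.+1 x' ->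
  edge (nt x) (val p) (nd x) ->
  exists2 p' : U, edge (nt x') (val p') (nd x') & rep k (x'.1, p') = rep k (x.1, p).
Proof.
move=> okx okx' e px; have /andP[_ /forallP/(_ (rep k (x.1, p)))/eqP E] := rep_same okx okx' e.
have : pw (rep k) x' (rep k (x.1, p)) != 0.
  by rewrite -[pw _ _ _]E pw_rep ?ewt_neq0 //; exact: parent_ok.
rewrite /pw; have [/existsP[q /andP[qx /eqP rq]] _|/existsPn nq] :=
    boolP [exists q : U, edge (nt x') (val q) (nd x') && (rep k (x'.1, q) == rep k (x.1, p))].
  by exists q.
by rewrite big_pred0 ?eqxx // => q; exact/negbTE/nq.
Qed.

Lemma ewt_match k m x x' (p p' : U) : ok k x -> ok k x' -> rep k x = rep k x' ->
  ok m (x.1, p) -> ok m (x'.1, p') -> rep m (x.1, p) = rep m (x'.1, p') ->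
  ewt (nt x) (nd x) (val p) = ewt (nt x') (nd x') (val p').
Proof.
move=> okx okx' e okp okp' ep; have [ek|nk] := eqVneq k m.+1; last first.
  have z y (q : U) : ok k y -> ok m (y.1, q) -> ewt (nt y) (nd y) (val q) = 0.
    move=> oky okq; apply/eqP; apply: contraNT nk; rewrite ewt_neq0 => qy.
    have /and3P[_ _ /eqP lk] := oky; have /and3P[_ _ /eqP lm] := okq.
    by have := hlfnn qy; move: lm; rewrite -/(nt y) lk /nt /nd /= => -> [->].
  by rewrite !z.
subst k; have /andP[_ /forallP/(_ (rep m (x.1, p)))/eqP E] := rep_same okx okx' e.
by rewrite -(pw_rep okx okp) -(pw_rep okx' okp') -ep; exact: E.
Qed.

(* Input nodes are labelled by their name, the others by the expression that they compute. *)
Definition label (j : 'I_n) (v : T) : T + V :=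
  if (v \in Vin, insub v) is (false, Some p) then inr (rep (lvl (j, p)) (j, p)) else inl v.

Lemma label_input j v : v \in Vin -> label j v = inl v.
Proof. by rewrite /label => ->. Qed.

Lemma label_node j (p : U) : val p \notin Vin -> label j (val p) = inr (rep (lvl (j, p)) (j, p)).
Proof. by rewrite /label => /negbTE ->; rewrite valK. Qed.

Lemma labelP j v : v \in nodes (N j) ->
  (v \in Vin /\ label j v = inl v) \/
  exists k (p : U), [/\ val p = v, v \notin Vin, ok k (j, p) & label j v = inr (rep k (j, p))].
Proof.
move=> vN; case/orP: (orbN (v \in Vin)) => vI; [left|right]; first by rewrite label_input.
pose p : U := [` fsubsetP (nodes_sub j) _ vN]%fset.
exists (lvl (j, p)), p; split => //; last exact: (@label_node j p vI).
exact: ok_noninput.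
Qed.

Lemma label_inj j v w : v \in nodes (N j) -> w \in nodes (N j) -> label j v = label j w -> v = w.
Proof.
move=> /labelP[[_ ->]|[k [p [<- _ okp ->]]]] /labelP[[_ ->]|[k' [p' [<- _ okp' ->]]]] // [] // e.
have ek := rep_lvl okp okp' e; subst k'.
by have [->] := rep_inj okp okp' erefl e.
Qed.

Lemma label_ewt j j' v v' w w' : v \in nodes (N j) -> v' \in nodes (N j') ->
  w \in nodes (N j) -> w' \in nodes (N j') -> label j v = label j' v' -> label j w = label j' w' ->
  ewt (N j) w v = ewt (N j') w' v'.
Proof.
move=> vN vN' wN wN' lv lw.
case: (labelP wN) (labelP wN') lw => [[wI ->]|[k [q [qw wI okq ->]]]] [[wI' ->]|[k' [q' [qw' wI' okq' ->]]]] // [] // ew.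
  have z i u y : y \in Vin -> ewt (N i) y u = 0.
    by move=> yI; apply/eqP; apply: contraLR yI; rewrite ewt_neq0; exact: edge_not_input.
  by rewrite !z.
have ek := rep_lvl okq okq' ew; subst k'.
case: (labelP vN) (labelP vN') lv => [[vI ->]|[m [p [pv vI okp ->]]]] [[vI' ->]|[m' [p' [pv' vI' okp' ->]]]] // [] // ev.
  subst v'; case: k okq okq' ew => [|k] okq okq' ew.
    have /andP[_ /forallP/(_ [` vI]%fset)/eqP] := rep_same okq okq' ew.
    by rewrite /iw /nt /nd /= qw qw'.
  have z i (y : U) : ok k.+1 (i, y) -> ewt (N i) (val y) v = 0.
    move=> oky; apply/eqP; apply: contraLR vI; rewrite ewt_neq0 => e.
    have /andP[vNi _] := edge_nodes e.
    have /and3P[_ + _] := @parent_ok k (i, y) [` fsubsetP (nodes_sub i) _ vNi]%fset oky e; exact.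
  by rewrite -qw -qw' !z.
have em := rep_lvl okp okp' ev; subst m'.
by rewrite -qw -qw' -pv -pv'; exact: (@ewt_match k m (j, q) (j', q')).
Qed.

Variable vout : T.
Hypothesis hnd : forall j, non_degenerate (N j).
Hypothesis hout : forall j, outputs (N j) = [fset vout]%fset.

Lemma vout_node j : vout \in nodes (N j) /\ vout \notin Vin.
Proof.
have := fsubsetP (outputs_sub (N j)) vout; rewrite hout !inE eqxx => /(_ isT) /andP[-> ->]; by [].
Qed.

Lemma path_vout j v : v \in nodes (N j) -> exists2 s, path (edge (N j)) v s & last v s = vout.
Proof.
move=> /hnd[]; rewrite hout ?inE; first by move=> /eqP ->; exists [::].
by case=> s ps; rewrite inE => /eqP; exists s.
Qed.

(** Induction along a path from [v] to the output, which exists by non-degeneracy: the partner of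
    the successor has, by [match_parent], a parent with the label of [v]. Inputs are common to both
    networks. *)
Lemma label_onto j j' v : label j vout = label j' vout -> v \in nodes (N j) ->
  exists2 v', v' \in nodes (N j') & label j' v' = label j v.
Proof.
move=> e vN; have [s] := path_vout vN.
elim: s v vN => [|w s IH] v vN /=.
  by move=> _ ->; exists vout; [have [] := vout_node j'|].
move=> /andP[vw ws] wl; have /andP[_ wN] := edge_nodes vw.
have [w' wN' lw] := IH w wN ws wl.
case: (labelP vN) => [[vI lv]|[m [p [pv vI okp lv]]]].
  by exists v; rewrite ?input_nodes // lv label_input.
have wI := edge_not_input vw.
case: (labelP wN) lw => [[wI2 _]|[k [q [qw _ okq ->]]]]; first by rewrite wI2 in wI.
case: (labelP wN') => [[_ ->]//|[k' [q' [qw' _ okq' ->]]]] [ew].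
have ek := rep_lvl okq' okq ew; subst k'; subst v w.
have km : k = m.+1.
  have /and3P[_ _ /eqP lq] := okq; have /and3P[_ _ /eqP lp] := okp.
  by have := hlfnn vw; rewrite -[level _ (val q)]/(level (nt (j, q)) (nd (j, q))) lq -[level _ (val p)]/(level (nt (j, p)) (nd (j, p))) lp => -[].
subst k; have [p' pq' rp] := @match_parent m (j, q) (j', q') p okq okq' (esym ew) vw.
have okp' : ok m (j', p') by exact: (@parent_ok m (j', q') p' okq' pq').
have /and3P[pN' pI' _] := okp'; exists (val p') => //.
by rewrite (@label_node j' p' pI') lv (ok_lvl okp'); congr inr.
Qed.

(** Labels are injective on each network and the two sets of labels coincide, so matching labels is
    a bijection; [label_ewt] transports edges and weights. *)
Lemma label_iso j j' : label j vout = label j' vout -> ext_isomorphic (N j) (N j').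
Proof.
move=> e.
have /choice[f fE] : forall v : nodes (N j), exists v' : nodes (N j'), label j' (val v') = label j (val v).
  by move=> v; have [v' vN' l] := label_onto e (valP v); exists [` vN']%fset.
have /choice[g gE] : forall v : nodes (N j'), exists v' : nodes (N j), label j (val v') = label j' (val v).
  by move=> v; have [v' vN' l] := label_onto (esym e) (valP v); exists [` vN']%fset.
have wE v w : ewt (N j') (val (f w)) (val (f v)) = ewt (N j) (val w) (val v).
  by apply: label_ewt; rewrite ?fE //; exact: valP.
have eE v w : edge (N j) (val v) (val w) = edge (N j') (val (f v)) (val (f w)).
  by rewrite -!ewt_neq0 wE.
exists f; split.
- exists g => v; apply: val_inj; apply: label_inj; try exact: valP; by rewrite ?gE ?fE ?gE.
- move=> v vI; have := fE v; rewrite (label_input j vI).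
  by case: (labelP (valP (f v))) => [[_ ->] []//|[k [p [_ _ _ ->]]]].
- have oE : val (f [` (vout_node j).1]%fset) = vout.
    by apply: (@label_inj j'); [exact: valP|have [] := vout_node j'|rewrite fE].
  apply/seteqP; split => [_ [v /= + <-]|v /=]; rewrite !hout !inE => /eqP vo.
    by rewrite -[X in _ == X]oE; apply/eqP; congr (val (f _)); exact: val_inj.
  exists [` (vout_node j).1]%fset; last by rewrite oE.
  by rewrite /= inE.
- split => // [v w vw|v vI]; first by have := wE v w; rewrite /ewt -eE vw.
  have := fE v; case: (labelP (valP v)) => [[vI2 _]|[k [p [pv _ okp ->]]]]; first by rewrite vI2 in vI.
  case: (labelP (valP (f v))) => [[_ ->]//|[k' [p' [pv' _ okp' ->]]]] [er].
  have ek := rep_lvl okp' okp er; subst k'.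
  by have /andP[/eqP] := rep_same okp' okp er; rewrite /bs /nt /nd /= pv pv'.
Qed.

End Expressions.

Theorem theorem4 (R : realType) (T : choiceType) (Vin : {fset T}) (vout : T)
    (n : nat) (N : 'I_n -> gfnn R Vin)
    (C : R) (S : set R) (c : R -> R) (sigma : R -> R)
    (hlfnn : forall j, is_lfnn (N j))
    (hnd : forall j, non_degenerate (N j))
    (hcf : forall j, clones_free (N j))
    (hout : forall j, outputs (N j) = [fset vout]%fset)
    (hiso : forall j1 j2, j1 != j2 -> ~ ext_isomorphic (N j1) (N j2))
    (hSd : discrete_set S)
    (hSa : self_avoiding S)
    (hc0 : forall s, S s -> c s != 0)
    (hc1 : summable S (EFin \o c))
    (hsigma : forall x, sigma x = C + rsum S (fun s => c s * tanh (pi * (x - s)))) :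
  linearly_independent
    (fun (i : option 'I_n) (t : Vin -> R) =>
       if i is Some j then node_map (N j) sigma vout t else 1).
Proof.
move=> a ha; pose V : finType := ('I_n * all_nodes N)%type.
have sumO (F : option 'I_n -> R) : \sum_i F i = F None + \sum_j F (Some j).
  rewrite (bigD1 None) //=; congr (_ + _).
  rewrite (reindex_omap Some id); last by case.
  by apply: eq_bigl => j; rewrite eqxx.
have [ta hta] : exists ta : Vin -> R, forall x x' : V,
    ((exists i, iw x i != 0) -> \sum_i iw x i * ta i != 0) /\
    ((exists i, iw x i - iw x' i != 0) -> \sum_i (iw x i - iw x' i) * ta i != 0).
  have [ta h] := @generic_vector R (V * V * bool)%type Vin
    (fun k i => if k.2 then iw k.1.1 i else iw k.1.1 i - iw k.1.2 i).
  exists ta => x x'; split => hx; first exact: (h (x, x', true)).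
  exact: (h (x, x', false)).
have hsig x : csig C S c (rc x) = rc (sigma x) by rewrite csig_rc // hsigma.
pose q j : V := (j, [` fsubsetP (nodes_sub N j) _ (vout_node hout j).1]%fset).
have okq j : ok (lvl (q j)) (q j).
  by apply: ok_noninput; have [] := vout_node hout j.
pose r j := rep (lvl (q j)) (q j).
(* A priori several outputs may share a representative, so their coefficients are added; [hiso] with
   [label_iso] shows below that each sum has a single term. *)
pose al (x : V) : R := \sum_(j | r j == x) a (Some j).
have rel (t : R) : rel_sum C S c (reps N) (@lvl _ _ _ _ N) (@lin_w _ _ _ _ N) (@bs _ _ _ _ N) al
    (fun e => rc (bs e + t * om ta e)) = rc (- a None).
  rewrite /rel_sum.
  have -> : - a None = \sum_j a (Some j) * node_map (N j) sigma vout (fun i => t * ta i).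
    by have := ha (fun i => t * ta i); rewrite sumO mulr1 => /eqP; rewrite addrC addr_eq0 => /eqP.
  rewrite rmorph_sum /= (partition_big r (fun x => x \in reps N)) /=; last by move=> j _; exact: rep_reps.
  apply: eq_bigr => x _; rewrite /al rmorph_sum mulr_suml; apply: eq_bigr => j /eqP <-.
  rewrite rmorphM /=; congr (_ * _).
  have [okr _] := rep_ok (okq j); rewrite (ok_lvl okr).
  exact: (ev_rep hlfnn ta hsig t (okq j)).
have al0 := system_independence hc1 hSd hSa hc0 (leqnn _) (reps_wf hlfnn hcf hta) rel.
have aS j : a (Some j) = 0.
  have := al0 _ (rep_reps (okq j)); rewrite /al (big_pred1 j) // => i /=.
  apply/eqP/eqP => [rij|->//]; apply/eqP; apply: contraT => /hiso; case.
  have [_ oI] := vout_node hout i.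
  by apply: (label_iso hlfnn hcf hnd hout); rewrite (@label_node _ _ _ _ N i (q i).2) // (@label_node _ _ _ _ N j (q j).2) // -/(r i) -/(r j) rij.
case=> [j|]; first exact: aS.
by have := ha (fun=> 0); rewrite sumO big1 ?addr0 ?mulr1 // => j _; rewrite aS mul0r.
Qed.
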